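(* Let $\mu$ be a compactly supported Borel probability measure on $\mathrm{SL}(2,\mathbb{R})$ which is strongly irreducible and proximal. The Frostman dimension of the Furstenberg measure $\nu_F$ of $\mu$ satisfies $\dim_F\nu_F=\zeta$, where $\zeta\in(0,1]$ is given by the unique solution of $$\sup_{\alpha\in\mathrm{A}}\{{}^*I_2(\alpha)+2\zeta\alpha\}=0.$$
   Context: Setting. $\mu$ is a compactly supported Borel probability measure on $\mathrm{SL}(2,\mathbb{R})$; $S_\mu$ is the closed semigroup generated by $\operatorname{supp}\mu$. $\mu$ is strongly irreducible if there is no nonempty finite collection of proper nonzero subspaces of $\mathbb{R}^2$ that is $S_\mu$-invariant, and proximal if $S_\mu$ contains an element whose leading eigenvalue (i.e. of maximal modulus) is simple. $\mu^n$ is the $n$-th convolution power of $\mu$. The Furstenberg measure $\nu_F$ is the unique Borel probability measure on $\mathbb{P}:=\mathbb{RP}^1$ with $\mu*\nu_F=\nu_F$, where $\mu * \nu$ is the pushforward of $\mu\times\nu$ under $(g,x)\mapsto gx$. Notation. $d_{\mathbb{P}}(\mathbb{R}u,\mathbb{R}v):=|u\wedge v|/(|u||v|)$; $|g|$ is the spectral norm. For $|g|>1$ write $g=KDL$ with $K,L\in O_2(\mathbb{R})$, $D=\mathrm{diag}(\kappa,\kappa^{-1})$, $\kappa>1$, and set $\upsilon_+(g):=\mathbb{R}Ke_1$ (the line in the image corresponding to the largest singular value); for $|g|=1$ it is an arbitrary fixed (measurable) choice. Frostman dimension: $\dim_F\nu:=\sup\{s\ge0:\exists C>0\text{ s.t.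 }\nu(B(x,r))\le Cr^s\ \forall r>0,\forall x\in\mathbb{P}\}$, $B(x,r)$ the closed $d_{\mathbb{P}}$-ball. $E(\alpha,\epsilon,n):=\{g\in\mathrm{SL}(2,\mathbb{R}):|\frac1n\log|g|-\alpha|\le\epsilon\}$; $\mathrm{A}:=\{\alpha:\lim_{\epsilon\to0}\limsup_{n\to\infty}\frac1n\log\mu^n(E(\alpha,\epsilon,n))>-\infty\}\subseteq[0,\infty)$; ${}^*E_2(\alpha,\epsilon,n,x):=\{g\in E(\alpha,\epsilon,n):d_{\mathbb{P}}(x,\upsilon_+(g))\le e^{-n(2-\epsilon)\alpha}\}$; ${}^*I_2(\alpha):=\lim_{\epsilon\to0}\limsup_{n\to\infty}\frac1n\log\sup_{x\in\mathbb{P}}\mu^n({}^*E_2(\alpha,\epsilon,n,x))$ (with $\log0=-\infty$). *)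

(* Defs.v *)
From HB Require Import structures.
From mathcomp Require Import all_boot all_order all_algebra.
From mathcomp Require Import all_classical all_reals all_analysis.
From mathcomp Require Import complex.

Set Implicit Arguments.
Unset Strict Implicit.
Unset Printing Implicit Defensive.

Import Order.TTheory GRing.Theory Num.Theory.
Import numFieldNormedType.Exports.

Local Open Scope classical_set_scope.
Local Open Scope ring_scope.

(* The Euclidean norm; the library norm `|u| on matrices is the max norm. *)
Definition enorm (R : realType) (u : 'cV[R]_2) : R :=
  Num.sqrt (\sum_i u i 0 ^+ 2).

(* |u /\ v|, under the identification of the exterior square of R^2 with R *)
Definition wedge_norm (R : realType) (u v : 'cV[R]_2) : R :=
  `| \det (row_mx u v : 'M[R]_2) |.

Definition e1 (R : realType) : 'cV[R]_2 := delta_mx 0 0.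

Record SL2 (R : realType) := MkSL2 {
  sl2mx :> 'M[R]_2;
  det_sl2mx : \det sl2mx == 1 }.

Section SL2_structures.
Variable R : realType.

HB.instance Definition _ := [isSub for @sl2mx R].
HB.instance Definition _ := [Choice of SL2 R by <:].

Lemma sl2_one_subproof : \det (1%:M : 'M[R]_2) == 1.
Proof. by rewrite det1. Qed.

Definition sl2_one : SL2 R := MkSL2 sl2_one_subproof.

Lemma sl2_mul_subproof (g h : SL2 R) : \det (sl2mx g *m sl2mx h) == 1.
Proof.
by rewrite det_mulmx (eqP (det_sl2mx g)) (eqP (det_sl2mx h)) mulr1.
Qed.

Definition sl2_mul (g h : SL2 R) : SL2 R := MkSL2 (sl2_mul_subproof g h).

HB.instance Definition _ := isPointed.Build (SL2 R) sl2_one.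

(* the topology induced by 'M[R]_2, and its Borel sigma-algebra *)
HB.instance Definition _ :=
  Topological.copy (SL2 R) (initial_topology (@sl2mx R)).
HB.instance Definition _ :=
  Measurable.copy (SL2 R) (g_sigma_algebraType (@open (SL2 R))).

End SL2_structures.

Section linear_action.
Variable R : realType.

Definition vimage (g : SL2 R) (V : {vspace 'cV[R]_2}) : {vspace 'cV[R]_2} :=
  (linfun (mulmx (sl2mx g)) @: V)%VS.

Lemma dim_vimage (g : SL2 R) V : \dim (vimage g V) = \dim V.
Proof.
apply: limg_dim_eq; apply/eqP; rewrite -subv0; apply/subvP => u.
rewrite memv_cap memv_ker lfunE /= => /andP[_ /eqP gu0].
have gU : sl2mx g \in unitmx by rewrite unitmxE (eqP (det_sl2mx g)) unitr1.
by rewrite memv0 -(mulKmx gU u) gu0 mulmx0.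
Qed.

End linear_action.

Record projline (R : realType) := MkProjline {
  line :> {vspace 'cV[R]_2};
  dim_line : \dim line == 1%N }.

Section projline_structures.
Variable R : realType.

HB.instance Definition _ := [isSub for @line R].
HB.instance Definition _ := [Choice of projline R by <:].

Lemma projline_point_subproof : \dim <[e1 R]>%VS == 1%N.
Proof.
rewrite dim_vline; suff -> : e1 R != 0 by [].
by apply/eqP => /matrixP/(_ 0 0); rewrite !mxE eqxx => /eqP; rewrite oner_eq0.
Qed.

HB.instance Definition _ :=
  isPointed.Build (projline R) (MkProjline projline_point_subproof).

Lemma act_subproof (g : SL2 R) (l : projline R) : \dim (vimage g l) == 1%N.
Proof. by rewrite dim_vimage dim_line. Qed.

Definition act (g : SL2 R) (l : projline R) : projline R :=
  MkProjline (act_subproof g l).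

(* vpick l is a nonzero vector of l; the ratio does not depend on the nonzero
   vectors chosen in the two lines. *)
Definition dP (l m : projline R) : R :=
  wedge_norm (vpick l) (vpick m) / (enorm (vpick l) * enorm (vpick m)).

Definition dP_open : set (set (projline R)) :=
  [set U | forall x, U x ->
    exists2 r : R, 0 < r & [set y | dP x y < r] `<=` U].

Lemma dP_openT : dP_open setT.
Proof. by move=> x _; exists 1. Qed.

Lemma dP_openI : setI_closed dP_open.
Proof.
move=> U V oU oV x [/oU[r r0 rU] /oV[s s0 sV]].
exists (Order.min r s); first by rewrite lt_min r0 s0.
by move=> y /=; rewrite lt_min => /andP[yr ys]; split; [apply: rU|apply: sV].
Qed.

Lemma dP_open_bigU (I : Type) (f : I -> set (projline R)) :
  (forall i, dP_open (f i)) -> dP_open (\bigcup_i f i).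
Proof.
move=> of_ x [i _ /(of_ i)[r r0 rU]]; exists r => // y /rU fiy.
by exists i.
Qed.

HB.instance Definition _ :=
  isOpenTopological.Build (projline R) dP_openT dP_openI dP_open_bigU.
HB.instance Definition _ :=
  Measurable.copy (projline R) (g_sigma_algebraType (@open (projline R))).

Definition dP_ball (x : projline R) (r : R) : set (projline R) :=
  [set y | dP x y <= r].

End projline_structures.

Section matrix_notions.
Variable R : realType.

Definition spectral_norm (g : 'M[R]_2) : R :=
  sup [set enorm (g *m u) | u in [set u : 'cV[R]_2 | enorm u = 1]].

Definition orthogonal2 (K : 'M[R]_2) : Prop := K *m K^T = 1%:M.

Definition diag2 (k : R) : 'M[R]_2 :=
  diag_mx (\row_(i < 2) (if i == 0 then k else k^-1)).

(* ups is a version of upsilon_+: it is prescribed where |g| > 1 (which is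
   equivalent to the existence of a decomposition K D L with kappa > 1) and is
   an arbitrary measurable choice where |g| = 1. *)
Definition is_upsilon_plus (ups : SL2 R -> projline R) : Prop :=
  measurable_fun setT ups /\
  forall (g : SL2 R) (K L : 'M[R]_2) (k : R),
    orthogonal2 K -> orthogonal2 L -> 1 < k ->
    sl2mx g = K *m diag2 k *m L ->
    line (ups g) = <[K *m e1 R]>%VS.

(* The (complex) eigenvalue of maximal modulus exists and is simple: it has
   algebraic multiplicity one and no other eigenvalue has the same modulus. *)
Definition simple_leading_eigenvalue (g : 'M[R]_2) : Prop :=
  let gC := map_mx (real_complex R) g in
  exists l : R[i],
    mup l (char_poly gC) = 1%N /\
    forall z : R[i], eigenvalue gC z -> z != l -> `|z| < `|l|.

End matrix_notions.

Section random_products.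
Variable R : realType.
Implicit Types mu : set (SL2 R) -> \bar R.

Definition msupp mu : set (SL2 R) :=
  [set g | forall U : set (SL2 R), open U -> U g -> (0 < mu U)%E].

Definition closed_semigroup : set (set (SL2 R)) :=
  [set S | closed S /\ forall g h, S g -> S h -> S (sl2_mul g h)].

Definition Smu mu : set (SL2 R) := smallest closed_semigroup (msupp mu).

Definition strongly_irreducible mu : Prop :=
  ~ exists C : seq {vspace 'cV[R]_2},
      [/\ C <> [::],
          (forall V, V \in C -> V != 0%VS /\ V != fullv) &
          (forall g V, Smu mu g -> V \in C -> vimage g V \in C)].

Definition proximal mu : Prop :=
  exists g, Smu mu g /\ simple_leading_eigenvalue g.

Definition conv mu1 mu2 : set (SL2 R) -> \bar R :=
  pushforward (mu1 \x mu2)%E (fun gh => sl2_mul gh.1 gh.2).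

Fixpoint conv_pow mu (n : nat) : set (SL2 R) -> \bar R :=
  if n is m.+1 then conv mu (conv_pow mu m) else dirac (sl2_one R).

Definition conv_act mu (nu : set (projline R) -> \bar R) :
    set (projline R) -> \bar R :=
  pushforward (mu \x nu)%E (fun gx => act gx.1 gx.2).

(* For mu strongly irreducible and proximal there is exactly one such nu among
   the Borel probability measures on the projective line. *)
Definition furstenberg_measure mu (nu : set (projline R) -> \bar R) : Prop :=
  forall A, measurable A -> conv_act mu nu A = nu A.

Definition frostman_dim (nu : set (projline R) -> \bar R) : \bar R :=
  ereal_sup [set s%:E | s in [set s : R | 0 <= s /\
    exists C : R, 0 < C /\
      forall (r : R) (x : projline R), 0 < r ->
        (nu (dP_ball x r) <= (C * r `^ s)%:E)%E]].

Definition Eset (alpha eps : R) (n : nat) : set (SL2 R) :=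
  [set g | `| n%:R^-1 * ln (spectral_norm (sl2mx g)) - alpha | <= eps].

Definition Aset mu : set R :=
  [set alpha | (-oo < lim (limn_esup (fun n : nat =>
     (n%:R^-1)%:E * lne (conv_pow mu n (Eset alpha eps n))) @[eps --> 0^'+]))%E].

Variable ups : SL2 R -> projline R.

Definition starE2 (alpha eps : R) (n : nat) (x : projline R) : set (SL2 R) :=
  [set g | Eset alpha eps n g /\
           dP x (ups g) <= expR (- (n%:R * (2 - eps) * alpha))].

Definition starI2 mu (alpha : R) : \bar R :=
  lim (limn_esup (fun n : nat =>
     ((n%:R^-1)%:E *
        lne (ereal_sup (range (fun x => conv_pow mu n (starE2 alpha eps n x)))))%E)
    @[eps --> 0^'+]).

End random_products.

(* Main.v *)
(* Idea. By stationarity a nu_F-random point is h b, where h = g_1 ... g_k and b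
   is an independent nu_F-random point. Stopping at the first k for which h
   stretches b by about r^(-1/2), the image h b lies within about r of
   upsilon_+(h), so up to an unlikely event where |h| is much larger than |h b|,
   nu_F(B(x, r)) is a sum over k of mu^k-probabilities that |h| is about
   r^(-1/2) and d(x, upsilon_+(h)) is at most about r. With k alpha =
   log(1/r)/2 these are governed by *I_2(alpha), and compactness in alpha turns
   the strict inequality sup {*I_2(alpha) + 2 s alpha} < 0 into the Frostman
   bound with exponent s. Conversely, if h has norm e^(k alpha), half of the nu_F
   mass is sent within a constant times e^(-2 k alpha) of upsilon_+(h), so a
   Frostman exponent s gives *I_2(alpha) <= - 2 s alpha.

   Both the boundedness of the number of relevant k by a multiple of log(1/r) and
   the unlikeliness of |h b| << |h| come from two classical facts. The Lyapunov
   exponent is positive: the conformal barycentre of nu_F, that is the quadratic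
   form Q minimising the average of log Q over nu_F, would otherwise be preserved
   by mu-almost every g, contradicting proximality. Then the inverse walk has
   positive drift uniformly in the starting line, so that a small negative power
   of |g^-1 x| contracts on average; this yields exponential tails for |g| and
   the Hoelder regularity of nu_F. *)

(* The obstacle is the event |h| >> |h b|. Hoelder regularity bounds its probability only by a small
   power of r, far weaker than the target r^s. But b is independent of h, and upsilon_+(h) must
   still be within 2r of x, which has probability at most twice the mass of B(x, D r) for a constant
   D. The error is thus a small multiple of nu_F(B(x, D r)), and the upper bound is a recursion in
   r, not a direct estimate. No path space is needed. For each n, events are stated for an
   independent pair h of law mu^n and b of law nu_F, and stationarity, written b = g b', links n to
   n + 1. zeta is the supremum of all Frostman exponents. It is the only zero because the rate
   function is bounded above on A by a negative constant: small alpha is handled by the tail of |g|,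
   the other alpha by the Hoelder exponent. *)
From HB Require Import structures.
From mathcomp Require Import all_boot all_order all_algebra.
From mathcomp Require Import all_classical all_reals all_analysis.
From mathcomp Require Import measurable_realfun complex ring lra.
Require Import Defs.

Set Implicit Arguments.
Unset Strict Implicit.
Unset Printing Implicit Defensive.

Import Order.TTheory GRing.Theory Num.Theory.
Import numFieldNormedType.Exports.

Local Open Scope classical_set_scope.
Local Open Scope ring_scope.

(** * The projective line in coordinates: distance, action, stretch factor *)

Section geometry.
Variable R : realType.
Implicit Types (g h : SL2 R) (l m z : projline R).

Lemma sum2E (T : nmodType) (F : 'I_2 -> T) : \sum_i F i = F 0 + F 1.
Proof.
by rewrite !big_ord_recl big_ord0 addr0; congr (_ + F _); apply/val_inj.
Qed.

Lemma det2E (K : comNzRingType) (A : 'M[K]_2) : \det A = A 0 0 * A 1 1 - A 0 1 * A 1 0.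
Proof.
rewrite (expand_det_row _ 0) sum2E /cofactor !det_mx11 !mxE /= expr0 expr1 mul1r.
rewrite mulN1r mulrN; congr (A _ _ * A _ _ - A _ _ * A _ _); exact/val_inj.
Qed.

Lemma enormE (u : 'cV[R]_2) : enorm u = Num.sqrt (u 0 0 ^+ 2 + u 1 0 ^+ 2).
Proof. by rewrite /enorm sum2E. Qed.

Lemma mulmx2E (A : 'M[R]_2) (u : 'cV[R]_2) i :
  (A *m u) i 0 = A i 0 * u 0 0 + A i 1 * u 1 0.
Proof. by rewrite mxE sum2E. Qed.

Lemma ord2P (i : 'I_2) : i = 0 \/ i = 1.
Proof. by case: i => -[|[|//]] h; [left|right]; exact/val_inj. Qed.

Lemma col2P (u v : 'cV[R]_2) : u 0 0 = v 0 0 -> u 1 0 = v 1 0 -> u = v.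
Proof.
by move=> h0 h1; apply/matrixP => i j; rewrite (ord1 j); have [->|->] := ord2P i.
Qed.

Lemma col2_neq0 (u : 'cV[R]_2) : u != 0 -> 0 < u 0 0 ^+ 2 + u 1 0 ^+ 2.
Proof.
move=> u0; rewrite lt_neqAle addr_ge0 ?sqr_ge0// andbT eq_sym.
rewrite paddr_eq0 ?sqr_ge0// !sqrf_eq0; apply: contra u0 => /andP[/eqP h0 /eqP h1].
by apply/eqP/col2P; rewrite mxE.
Qed.

Lemma enorm_gt0 (u : 'cV[R]_2) : u != 0 -> 0 < enorm u.
Proof. by move=> u0; rewrite enormE sqrtr_gt0 col2_neq0. Qed.

(* [pu l] is a unit vector of [l] with coordinates [px l] and [py l], defined up
   to sign; [wd] and [dt] are the determinant and the inner product of the unit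
   vectors of two lines. *)
Definition pu l : 'cV[R]_2 := (enorm (vpick l))^-1 *: vpick l.
Definition px l := pu l 0 0.
Definition py l := pu l 1 0.

Lemma vpick_line_neq0 l : vpick l != 0.
Proof.
rewrite vpick0; apply/eqP => l0; have := dim_line l.
by rewrite l0 dimv0.
Qed.

Lemma pxy1 l : px l ^+ 2 + py l ^+ 2 = 1.
Proof.
rewrite /px /py /pu !mxE !exprMn -mulrDr.
have := enorm_gt0 (vpick_line_neq0 l) => h.
rewrite [X in _ * X](_ : _ = enorm (vpick l) ^+ 2); last first.
  by rewrite enormE sqr_sqrtr// addr_ge0// sqr_ge0.
by rewrite exprVn mulVf// expf_neq0// gt_eqF.
Qed.

Lemma pu_neq0 l : pu l != 0.
Proof.
by rewrite scaler_eq0 (negbTE (vpick_line_neq0 l)) orbF invr_eq0 gt_eqF// enorm_gt0// vpick_line_neq0.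
Qed.

Lemma line_pu l : line l = <[pu l]>%VS.
Proof.
have pul : pu l \in line l by rewrite memvZ// memv_pick.
apply/esym/eqP; rewrite eqEdim -memvE pul /= dim_vline pu_neq0.
by rewrite (eqP (dim_line l)).
Qed.

Lemma lineP l (v : 'cV[R]_2) : px l * v 1 0 - py l * v 0 0 = 0 ->
  v = (px l * v 0 0 + py l * v 1 0) *: pu l.
Proof.
have := pxy1 l; rewrite /px /py; set x := pu l 0 0; set y := pu l 1 0.
move=> h1 h2; apply: col2P; rewrite mxE -/x -/y.
- rewrite [LHS](_ : _ = (x^+2 + y^+2) * v 0 0); last by rewrite h1 mul1r.
  have := congr1 (fun t => y * t) h2; rewrite mulr0 => h3; lra.
- rewrite [LHS](_ : _ = (x^+2 + y^+2) * v 1 0); last by rewrite h1 mul1r.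
  have := congr1 (fun t => x * t) h2; rewrite mulr0 => h3; lra.
Qed.

Definition wd l m := px l * py m - py l * px m.

Lemma dPE l m : dP l m = `|wd l m|.
Proof.
rewrite /dP /wedge_norm det2E.
set u := vpick l; set v := vpick m.
have -> : row_mx u v 0 0 = u 0 0.
  have -> : (0 : 'I_(1+1)) = lshift 1 0 by exact/val_inj.
  by rewrite row_mxEl.
have -> : row_mx u v 1 0 = u 1 0.
  have -> : (0 : 'I_(1+1)) = lshift 1 0 by exact/val_inj.
  by rewrite row_mxEl.
have -> : row_mx u v 0 1 = v 0 0.
  have -> : (1 : 'I_(1+1)) = rshift 1 0 by exact/val_inj.
  by rewrite row_mxEr.
have -> : row_mx u v 1 1 = v 1 0.
  have -> : (1 : 'I_(1+1)) = rshift 1 0 by exact/val_inj.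
  by rewrite row_mxEr.
have hu : 0 < enorm u by rewrite enorm_gt0// vpick_line_neq0.
have hv : 0 < enorm v by rewrite enorm_gt0// vpick_line_neq0.
rewrite /wd /px /py /pu !mxE -/u -/v.
rewrite -[X in _ / X = _]gtr0_norm ?mulr_gt0// -normf_div; congr `|_|.
by field; rewrite !gt_eqF.
Qed.

Lemma dP_ge0 l m : 0 <= dP l m. Proof. by rewrite dPE normr_ge0. Qed.

Lemma dP_sym l m : dP l m = dP m l.
Proof. by rewrite !dPE -normrN /wd; congr `|_|; ring. Qed.

Lemma dPxx l : dP l l = 0.
Proof. by rewrite dPE /wd mulrC subrr normr0. Qed.

Definition dt l m := px l * px m + py l * py m.

Lemma dt_wd l m : dt l m ^+ 2 + wd l m ^+ 2 = 1.
Proof.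
rewrite -[RHS](_ : (px l ^+ 2 + py l ^+ 2) * (px m ^+ 2 + py m ^+ 2) = 1).
  by rewrite /dt /wd; ring.
by rewrite !pxy1 mulr1.
Qed.

Lemma abs_le1 (a b : R) : a ^+ 2 + b ^+ 2 = 1 -> `|b| <= 1.
Proof.
move=> h; rewrite -(@ler_pXn2r _ 2)// ?nnegrE// -normrX expr1n ger0_norm ?sqr_ge0//.
by rewrite -h lerDr sqr_ge0.
Qed.

Lemma dP_le1 l m : dP l m <= 1.
Proof. by rewrite dPE (abs_le1 (dt_wd l m)). Qed.

Lemma dt_le1 l m : `|dt l m| <= 1.
Proof. by apply: (@abs_le1 (wd l m)); rewrite addrC dt_wd. Qed.

(** [wd] and [dt] are the sine and the cosine of the angle between the unit vectors. This is the
    addition formula for the sine, with both cosines bounded by 1. *)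
Lemma dP_triangle l m z : dP l z <= dP l m + dP m z.
Proof.
have e : wd l z = dt l m * wd m z + wd l m * dt m z.
  rewrite -[wd l z]mulr1 -(pxy1 m) /dt /wd; ring.
rewrite !dPE e; apply: (le_trans (ler_normD _ _)); rewrite addrC !normrM.
by apply: lerD; rewrite ?ler_piMl ?ler_piMr ?dt_le1.
Qed.

Lemma dP_eq0 l m : dP l m = 0 -> l = m.
Proof.
rewrite dPE => /eqP; rewrite normr_eq0 => /eqP h.
apply/val_inj => /=; rewrite (line_pu l) (line_pu m).
have := lineP h; rewrite -/(px m) -/(py m) => e.
apply/eqP; rewrite eqEdim !dim_vline !pu_neq0 leqnn andbT -memvE.
have c0 : px l * px m + py l * py m != 0.
  by apply: contra (pu_neq0 m) => /eqP c0; rewrite e c0 scale0r.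
have -> : pu l = (px l * px m + py l * py m)^-1 *: pu m by rewrite [X in _ *: X]e scalerK.
by rewrite memvZ// memv_line.
Qed.

Lemma mkline_subproof (v : 'cV[R]_2) : v != 0 -> \dim <[v]>%VS == 1%N.
Proof. by move=> v0; rewrite dim_vline v0. Qed.

(** [pu] selects one of two opposite unit vectors, so coordinates read off from a spanning vector
    are available only up to a scalar of known square. *)
Lemma line_spanned (v : 'cV[R]_2) l : v != 0 -> line l = <[v]>%VS ->
  exists c, [/\ px l = c * v 0 0, py l = c * v 1 0 &
    c ^+ 2 * (v 0 0 ^+ 2 + v 1 0 ^+ 2) = 1].
Proof.
move=> v0 lv; have /vlineP[c e] : pu l \in <[v]>%VS by rewrite -lv line_pu memv_line.
exists c; have hx : px l = c * v 0 0 by rewrite /px e mxE.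
have hy : py l = c * v 1 0 by rewrite /py e mxE.
by split => //; rewrite -(pxy1 l) hx hy; ring.
Qed.

Lemma exists_line (a b : R) : a ^+ 2 + b ^+ 2 != 0 -> exists l c,
  [/\ px l = c * a, py l = c * b & c ^+ 2 * (a ^+ 2 + b ^+ 2) = 1].
Proof.
move=> ab; pose v : 'cV[R]_2 := \col_i (if i == 0 then a else b).
have va : v 0 0 = a by rewrite mxE.
have vb : v 1 0 = b by rewrite mxE.
have v0 : v != 0.
  apply: contra ab => /eqP v0; rewrite -va -vb v0 !mxE expr0n addr0//.
exists (MkProjline (mkline_subproof v0)).
have [c] := @line_spanned v (MkProjline (mkline_subproof v0)) v0 erefl.
by rewrite va vb; exists c.
Qed.

Lemma SL2_det g : g 0 0 * g 1 1 - g 0 1 * g 1 0 = 1.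
Proof. by rewrite -det2E (eqP (det_sl2mx g)). Qed.

(* [N g l] is the factor by which [g] stretches the line [l]. *)
Definition gx g l := g 0 0 * px l + g 0 1 * py l.
Definition gy g l := g 1 0 * px l + g 1 1 * py l.
Definition N g l := Num.sqrt (gx g l ^+ 2 + gy g l ^+ 2).

Lemma gpu0 g l : (g *m pu l) 0 0 = gx g l. Proof. by rewrite mulmx2E. Qed.
Lemma gpu1 g l : (g *m pu l) 1 0 = gy g l. Proof. by rewrite mulmx2E. Qed.

Lemma gpu_neq0 g l : g *m pu l != 0.
Proof.
have gU : sl2mx g \in unitmx by rewrite unitmxE (eqP (det_sl2mx g)) unitr1.
apply: contra (pu_neq0 l) => /eqP e.
by rewrite -(mulKmx gU (pu l)) e mulmx0.
Qed.

Lemma Nsq g l : N g l ^+ 2 = gx g l ^+ 2 + gy g l ^+ 2.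
Proof. by rewrite sqr_sqrtr// addr_ge0// sqr_ge0. Qed.

Lemma N_gt0 g l : 0 < N g l.
Proof. by rewrite sqrtr_gt0 -gpu0 -gpu1 col2_neq0// gpu_neq0. Qed.

Lemma actP g l : exists c, [/\ px (act g l) = c * gx g l,
  py (act g l) = c * gy g l & `|c| * N g l = 1].
Proof.
have [|c] := @line_spanned (g *m pu l) (act g l) (gpu_neq0 g l).
  rewrite /= /vimage {1}line_pu limg_line lfunE //.
rewrite gpu0 gpu1 => -[h0 h1 h2]; exists c; split => //.
have N0 := N_gt0 g l.
apply/eqP; rewrite -(@eqrXn2 _ 2)// ?mulr_ge0// ?(ltW N0)//.
by rewrite exprMn -normrX ger0_norm ?sqr_ge0// Nsq h2 expr1n.
Qed.

(** Since det g = 1, the wedge of the two unit vectors is preserved, while their lengths become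
    [N g l] and [N g m]. *)
Lemma dP_act g l m : dP (act g l) (act g m) * (N g l * N g m) = dP l m.
Proof.
have [c [h0 h1 h2]] := actP g l; have [c' [h0' h1' h2']] := actP g m.
rewrite !dPE -[`|wd l m|]mulr1 -[in RHS](mulr1 1) -{1}h2 -h2'.
have -> : wd (act g l) (act g m) = c * c' * wd l m.
  rewrite /wd h0 h1 h0' h1' /gx /gy -[c * c']mulr1 -(SL2_det g); ring.
by rewrite !normrM; ring.
Qed.

Lemma sl2_mulE g h : [/\ sl2_mul g h 0 0 = g 0 0 * h 0 0 + g 0 1 * h 1 0,
  sl2_mul g h 0 1 = g 0 0 * h 0 1 + g 0 1 * h 1 1,
  sl2_mul g h 1 0 = g 1 0 * h 0 0 + g 1 1 * h 1 0 &
  sl2_mul g h 1 1 = g 1 0 * h 0 1 + g 1 1 * h 1 1].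
Proof. by rewrite /=; split; rewrite mxE sum2E. Qed.

Lemma gx_mul g h l : gx (sl2_mul g h) l = g 0 0 * gx h l + g 0 1 * gy h l.
Proof. by have [e1 e2 e3 e4] := sl2_mulE g h; rewrite /gx /gy e1 e2; ring. Qed.
Lemma gy_mul g h l : gy (sl2_mul g h) l = g 1 0 * gx h l + g 1 1 * gy h l.
Proof. by have [e1 e2 e3 e4] := sl2_mulE g h; rewrite /gx /gy e3 e4; ring. Qed.

(** The cocycle identity, which makes averages of [ln (N g y)] additive along the walk. *)
Lemma N_mul g h l : N (sl2_mul g h) l = N g (act h l) * N h l.
Proof.
have [c [h0 h1 h2]] := actP h l.
have N0 := N_gt0 h l.
apply/eqP; rewrite -(@eqrXn2 _ 2)// ?mulr_ge0// ?(ltW (N_gt0 _ _))//.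
rewrite exprMn !Nsq gx_mul gy_mul.
have c2 : c ^+ 2 * (gx h l ^+ 2 + gy h l ^+ 2) = 1.
  by rewrite -Nsq -[c ^+ 2]ger0_norm ?sqr_ge0// normrX -exprMn h2 expr1n.
rewrite /gx -/(gx h l) /gy -/(gy h l) h0 h1.
rewrite -/(gx h l) -/(gy h l) in c2 *.
set u := gx h l in c2 *; set v := gy h l in c2 *.
have -> : g 0 0 * (c * u) + g 0 1 * (c * v) = c * (g 0 0 * u + g 0 1 * v) by ring.
have -> : g 1 0 * (c * u) + g 1 1 * (c * v) = c * (g 1 0 * u + g 1 1 * v) by ring.
rewrite !exprMn -mulrDr mulrAC c2 mul1r//.
Qed.

Lemma act_mul g h l : act (sl2_mul g h) l = act g (act h l).
Proof.
apply/val_inj => /=; rewrite /vimage -limg_comp; congr (_ @: _)%VS.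
by apply/lfunP => u; rewrite lfunE /= comp_lfunE !lfunE /= mulmxA.
Qed.

Lemma act1 l : act (sl2_one R) l = l.
Proof.
apply/val_inj => /=; rewrite /vimage -[RHS]lim1g; congr (_ @: _)%VS.
by apply/lfunP => u; rewrite !lfunE /= mul1mx.
Qed.

Lemma N1 l : N (sl2_one R) l = 1.
Proof.
rewrite /N /gx /gy /= !mxE /= !mul1r !mul0r addr0 add0r pxy1 sqrtr1//.
Qed.

Lemma sl2_inv_subproof g : \det (invmx (sl2mx g)) == 1.
Proof. by rewrite det_inv (eqP (det_sl2mx g)) invr1. Qed.

Definition sl2_inv g := MkSL2 (sl2_inv_subproof g).

Lemma sl2_unit g : sl2mx g \in unitmx.
Proof. by rewrite unitmxE (eqP (det_sl2mx g)) unitr1. Qed.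

Lemma sl2_mulV g : sl2_mul g (sl2_inv g) = sl2_one R.
Proof. by apply/val_inj; rewrite /= mulmxV// sl2_unit. Qed.
Lemma sl2_mulVl g : sl2_mul (sl2_inv g) g = sl2_one R.
Proof. by apply/val_inj; rewrite /= mulVmx// sl2_unit. Qed.
Lemma sl2_mulA g h k : sl2_mul g (sl2_mul h k) = sl2_mul (sl2_mul g h) k.
Proof. by apply/val_inj; rewrite /= mulmxA. Qed.
Lemma sl2_mul1 g : sl2_mul g (sl2_one R) = g.
Proof. by apply/val_inj; rewrite /= mulmx1. Qed.
Lemma sl2_1mul g : sl2_mul (sl2_one R) g = g.
Proof. by apply/val_inj; rewrite /= mul1mx. Qed.
Lemma sl2_invM g h : sl2_inv (sl2_mul g h) = sl2_mul (sl2_inv h) (sl2_inv g).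
Proof.
rewrite -[LHS]sl2_mul1 -(sl2_mulV h) -[sl2_mul h _]sl2_mul1 -(sl2_mulV g).
rewrite -(sl2_mul1 (sl2_mul _ (sl2_mul g _))).
have -> : sl2_mul (sl2_mul h (sl2_inv h)) (sl2_mul g (sl2_inv g)) =
    sl2_mul (sl2_mul g h) (sl2_mul (sl2_inv h) (sl2_inv g)).
  rewrite !sl2_mulV sl2_mul1 -sl2_mulA (sl2_mulA h) sl2_mulV sl2_1mul sl2_mulV//.
by rewrite sl2_mul1 sl2_mulA sl2_mulVl sl2_1mul.
Qed.

Lemma actK g l : act g (act (sl2_inv g) l) = l.
Proof. by rewrite -act_mul sl2_mulV act1. Qed.
Lemma actVK g l : act (sl2_inv g) (act g l) = l.
Proof. by rewrite -act_mul sl2_mulVl act1. Qed.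

Lemma NV g l : N g (act (sl2_inv g) l) * N (sl2_inv g) l = 1.
Proof. by rewrite -N_mul sl2_mulV N1. Qed.

(** For unit vectors u of l and v of m, the two sides are the wedge of u with g v and the wedge of
    g^-1 u with v. *)
Lemma dP_actl g l m : dP l (act g m) * N g m = dP (act (sl2_inv g) l) m * N (sl2_inv g) l.
Proof.
rewrite -{1}(actK g l) -(dP_act g (act (sl2_inv g) l) m).
by rewrite -mulrA; congr (_ * _); rewrite mulrAC NV mul1r.
Qed.

End geometry.

(** * Operator norm, singular values and upsilon_+ *)

Section spectral.
Variable R : realType.
Implicit Types (g h : SL2 R) (l m z : projline R).

Definition snorm g : R := spectral_norm (sl2mx g).

Definition frob g := g 0 0 ^+ 2 + g 0 1 ^+ 2 + g 1 0 ^+ 2 + g 1 1 ^+ 2.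

Lemma enorm_mul_frob g (u : 'cV[R]_2) : enorm u = 1 -> enorm (g *m u) <= Num.sqrt (frob g).
Proof.
move=> u1; rewrite enormE !mulmx2E; apply: ler_wsqrtr; rewrite /frob.
have := u1; rewrite enormE => /(congr1 (fun x => x ^+ 2)).
rewrite sqr_sqrtr ?addr_ge0 ?sqr_ge0// expr1n.
set x := u 0 0; set y := u 1 0 => e.
rewrite -[leRHS]mulr1 -e -subr_ge0.
rewrite [leRHS](_ : _ = (g 0 0 * y - g 0 1 * x) ^+ 2 + (g 1 0 * y - g 1 1 * x) ^+ 2); last by ring.
by rewrite addr_ge0 ?sqr_ge0.
Qed.

Lemma enorm_pu l : enorm (pu l) = 1.
Proof. by rewrite enormE -/(px l) -/(py l) pxy1 sqrtr1. Qed.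

Lemma N_enorm g l : N g l = enorm (g *m pu l).
Proof. by rewrite enormE gpu0 gpu1. Qed.

Lemma N_le_snorm g l : N g l <= snorm g.
Proof.
apply: ub_le_sup; last by exists (pu l); rewrite ?N_enorm//; exact: enorm_pu.
by exists (Num.sqrt (frob g)) => _ [u u1 <-]; exact: enorm_mul_frob.
Qed.

Lemma snorm_le g c : (forall l, N g l <= c) -> snorm g <= c.
Proof.
move=> h; apply: sup_le_ub.
  by exists (enorm (g *m pu point)), (pu point) => //; exact: enorm_pu.
move=> _ [u u1 <-].
have u2 : u 0 0 ^+ 2 + u 1 0 ^+ 2 = 1.
  have := u1; rewrite /= enormE => /(congr1 (fun x => x ^+ 2)).
  by rewrite sqr_sqrtr ?addr_ge0 ?sqr_ge0// expr1n.
have [|l [k [k0 k1 k2]]] := @exists_line _ (u 0 0) (u 1 0).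
  by rewrite u2 oner_neq0.
rewrite u2 mulr1 in k2.
apply: le_trans (h l); rewrite enormE !mulmx2E /N ler_wsqrtr// /gx /gy k0 k1.
rewrite [leRHS](_ : _ = k ^+ 2 * ((g 0 0 * u 0 0 + g 0 1 * u 1 0) ^+ 2 +
    (g 1 0 * u 0 0 + g 1 1 * u 1 0) ^+ 2)); last by ring.
by rewrite k2 mul1r.
Qed.

Lemma snorm_le_frob g : snorm g <= Num.sqrt (frob g).
Proof. by apply: snorm_le => l; rewrite N_enorm enorm_mul_frob// enorm_pu. Qed.

(** Only monomials of degree two are recorded: they do not depend on the sign chosen by [pu], and
    they determine every quadratic form on the perpendicular line. *)
Lemma exists_perp l : exists m, dP l m = 1 /\ (px m ^+ 2 = py l ^+ 2 /\ py m ^+ 2 = px l ^+ 2 /\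
  px m * py m = - (px l * py l)).
Proof.
have := pxy1 l => e.
have [|m [c [c0 c1 c2]]] := @exists_line _ (- py l) (px l).
  by rewrite sqrrN addrC e oner_neq0.
rewrite sqrrN addrC e mulr1 in c2.
exists m; split; last first.
  by rewrite c0 c1 !exprMn c2 !mul1r sqrrN; do 2?split => //; rewrite mulrACA -expr2 c2; ring.
rewrite dPE /wd c0 c1 [X in `|X|](_ : _ = c); last first.
  by rewrite -[RHS]mulr1 -e; ring.
by apply/eqP; rewrite -(@eqrXn2 _ 2)// -normrX c2 normr1 expr1n.
Qed.

Lemma snorm_gt0 g : 0 < snorm g.
Proof. exact: lt_le_trans (N_gt0 g point) (N_le_snorm _ _). Qed.

(** The images of two perpendicular unit vectors span area 1, so the product of their lengths is at
    least 1; one of the lengths is then replaced by |g|. *)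
Lemma snorm_mulN_ge1 g l : 1 <= snorm g * N g l.
Proof.
have [m [lm _]] := exists_perp l.
rewrite -lm -(dP_act g) mulrC [X in _ <= X]mulrC.
rewrite -mulrA ler_pM2l ?N_gt0// -[leRHS]mulr1 ler_pM ?dP_ge0 ?(ltW (N_gt0 _ _)) ?N_le_snorm ?dP_le1//.
Qed.

Lemma snorm_ge1 g : 1 <= snorm g.
Proof.
have := snorm_mulN_ge1 g point; have := N_le_snorm g point => h1 h2.
rewrite leNgt; apply/negP => h.
suff : snorm g * N g point < 1 by rewrite ltNge h2.
rewrite -(mulr1 1); apply: ltr_pM => //; rewrite ?(ltW (N_gt0 _ _)) ?(ltW (snorm_gt0 _))//.
exact: le_lt_trans h1 h.
Qed.

Lemma N_ge g l : (snorm g)^-1 <= N g l.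
Proof. by rewrite -(ler_pM2l (snorm_gt0 g)) mulfV ?gt_eqF ?snorm_gt0// snorm_mulN_ge1. Qed.

Lemma snorm_mul g h : snorm (sl2_mul g h) <= snorm g * snorm h.
Proof.
apply: snorm_le => l; rewrite N_mul.
by apply: ler_pM; rewrite ?N_le_snorm ?(ltW (N_gt0 _ _)).
Qed.

Lemma snorm1 : snorm (sl2_one R) = 1.
Proof.
by apply/eqP; rewrite eq_le snorm_ge1 andbT; apply: snorm_le => l; rewrite N1.
Qed.

Lemma NV_le_snorm g l : N (sl2_inv g) l <= snorm g.
Proof.
have := NV g l; have := N_ge g (act (sl2_inv g) l) => h1 h2.
have h := N_gt0 g (act (sl2_inv g) l).
rewrite -(ler_pM2l h) h2 mulrC; apply: snorm_mulN_ge1.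
Qed.

Lemma NV_ge g l : (snorm g)^-1 <= N (sl2_inv g) l.
Proof.
have := NV g l; have := N_le_snorm g (act (sl2_inv g) l) => h1 h2.
have h := N_gt0 g (act (sl2_inv g) l).
rewrite -(ler_pM2l h) h2 -[leRHS](mulfV (lt0r_neq0 (snorm_gt0 g))).
by rewrite ler_pM2r ?invr_gt0 ?snorm_gt0.
Qed.

Lemma minkowski2 (a b x y x' y' : R) :
  Num.sqrt ((a * x + b * x') ^+ 2 + (a * y + b * y') ^+ 2) <=
  `|a| * Num.sqrt (x ^+ 2 + y ^+ 2) + `|b| * Num.sqrt (x' ^+ 2 + y' ^+ 2).
Proof.
set s := Num.sqrt (x ^+ 2 + y ^+ 2); set s' := Num.sqrt (x' ^+ 2 + y' ^+ 2).
have s2 : s ^+ 2 = x ^+ 2 + y ^+ 2 by rewrite sqr_sqrtr// addr_ge0 ?sqr_ge0.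
have s2' : s' ^+ 2 = x' ^+ 2 + y' ^+ 2 by rewrite sqr_sqrtr// addr_ge0 ?sqr_ge0.
have s0 : 0 <= s by exact: sqrtr_ge0.
have s0' : 0 <= s' by exact: sqrtr_ge0.
have r0 : 0 <= `|a| * s + `|b| * s' by rewrite addr_ge0// mulr_ge0.
rewrite -(@ler_pXn2r _ 2)// ?nnegrE ?sqrtr_ge0//.
rewrite sqr_sqrtr ?addr_ge0 ?sqr_ge0//.
have cs : `|x * x' + y * y'| <= s * s'.
  rewrite -(@ler_pXn2r _ 2)// ?nnegrE ?mulr_ge0// -normrX ger0_norm ?sqr_ge0//.
  rewrite exprMn s2 s2' -subr_ge0.
  by rewrite [leRHS](_ : _ = (x * y' - y * x') ^+ 2) ?sqr_ge0//; ring.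
have : a * b * (x * x' + y * y') <= `|a| * `|b| * (s * s').
  by apply: le_trans (ler_norm _) _; rewrite normrM -(normrM a b) ler_wpM2l.
have ha : `|a| ^+ 2 = a ^+ 2 by rewrite -normrX ger0_norm ?sqr_ge0.
have hb : `|b| ^+ 2 = b ^+ 2 by rewrite -normrX ger0_norm ?sqr_ge0.
rewrite [X in _ -> _ <= X](_ : _ =
  a ^+ 2 * (x ^+ 2 + y ^+ 2) + b ^+ 2 * (x' ^+ 2 + y' ^+ 2) + 2 * (`|a| * `|b| * (s * s'))); last first.
  by rewrite -ha -hb -s2 -s2'; ring.
rewrite [X in _ -> X <= _](_ : _ =
  a ^+ 2 * (x ^+ 2 + y ^+ 2) + b ^+ 2 * (x' ^+ 2 + y' ^+ 2) + 2 * (a * b * (x * x' + y * y'))); last by ring.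
by move=> h; rewrite lerD2l ler_pM2l.
Qed.

(* Expand an arbitrary unit vector in the basis formed by the two lines. *)
Lemma snorm_dP_le g l m : snorm g * dP l m <= N g l + N g m.
Proof.
have [d0|d0] := eqVneq (dP l m) 0; first by rewrite d0 mulr0 addr_ge0// ltW// N_gt0.
have dgt : 0 < dP l m by rewrite lt_neqAle eq_sym d0 dP_ge0.
rewrite -ler_pdivlMr//; apply: snorm_le => z; rewrite ler_pdivlMr//.
rewrite dPE -[N g z]ger0_norm ?(ltW (N_gt0 _ _))// -normrM.
have -> : `|N g z * wd l m| = Num.sqrt ((wd z m * gx g l + (- wd z l) * gx g m) ^+ 2 +
    (wd z m * gy g l + (- wd z l) * gy g m) ^+ 2).
  have e1 : wd z m * gx g l + (- wd z l) * gx g m = gx g z * wd l m by rewrite /wd /gx; ring.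
  have e2 : wd z m * gy g l + (- wd z l) * gy g m = gy g z * wd l m by rewrite /wd /gy; ring.
  by rewrite e1 e2 !exprMn -mulrDl -Nsq -exprMn sqrtr_sqr.
apply: le_trans (minkowski2 _ _ _ _ _ _) _; rewrite -/(N g l) -/(N g m) -dPE normrN -dPE.
by apply: lerD; rewrite ler_piMl ?dP_le1 ?(ltW (N_gt0 _ _)).
Qed.

(** This separates the rotations, for which [ups] is unconstrained, from the elements with a genuine
    largest singular direction. *)
Lemma frob_gap g : frob g - 2 = (g 0 0 - g 1 1) ^+ 2 + (g 0 1 + g 1 0) ^+ 2.
Proof. by rewrite /frob; have := SL2_det g; lra. Qed.

Lemma N_perp g l m : px m ^+ 2 = py l ^+ 2 -> py m ^+ 2 = px l ^+ 2 ->
  px m * py m = - (px l * py l) -> N g l ^+ 2 + N g m ^+ 2 = frob g.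
Proof.
move=> h1 h2 h3; rewrite !Nsq /frob /gx /gy.
have e (a b x y : R) : (a * x + b * y) ^+ 2 = a ^+ 2 * x ^+ 2 + b ^+ 2 * y ^+ 2 + 2 * a * b * (x * y).
  by ring.
by rewrite !e h1 h2 h3 -[RHS]mulr1 -[X in _ = _ * X](pxy1 l); ring.
Qed.

(** Let p and q be the squared stretch factors of l and of its perpendicular. Then p + q = k^2 +
    k^-2 and p q >= 1, which confines p to [k^-2, k^2]. *)
Lemma N_le_eig g l (k : R) : 0 < k -> k ^+ 2 + k ^- 2 = frob g -> 1 <= k -> N g l <= k.
Proof.
move=> k0 ek k1; have [m [d1 [h1 [h2 h3]]]] := exists_perp l.
have := N_perp g h1 h2 h3.
have := dP_act g l m; rewrite d1.
have := dP_le1 (act g l) (act g m); have := dP_ge0 (act g l) (act g m).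
set d := dP _ _ => d0 d1' e1 e2.
have p0 := N_gt0 g l; have q0 := N_gt0 g m.
rewrite -(@ler_pXn2r _ 2)// ?nnegrE ?(ltW k0) ?(ltW p0)//.
rewrite leNgt; apply/negP => hlt.
have pq1 : 1 <= N g l ^+ 2 * N g m ^+ 2.
  by rewrite -exprMn exprn_ege1// -e1 ler_piMl// mulr_ge0// ltW.
set p := N g l ^+ 2 in e2 hlt pq1; set q := N g m ^+ 2 in e2 pq1.
have k21 : 1 <= k ^+ 2 by rewrite exprn_ege1.
have k2i : k ^+ 2 * k ^- 2 = 1 by rewrite mulfV// expf_neq0// gt_eqF.
set K := k ^+ 2 in k21 k2i hlt ek; set Ki := k ^- 2 in k2i ek.
have qE : q = K + Ki - p by rewrite ek -e2; ring.
have : p * q < 1; last by rewrite ltNge pq1.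
rewrite qE -subr_gt0 -k2i.
have -> : K * Ki - p * (K + Ki - p) = (p - K) * (p - Ki) by ring.
rewrite mulr_gt0// subr_gt0// (le_lt_trans _ hlt)//.
have : Ki <= 1 by rewrite /Ki invf_le1// exprn_gt0.
by move=> /le_trans; apply.
Qed.

(** The two linear equations say that (u0, u1) is an eigenvector of g g^T, a matrix of trace
    [frob g] and determinant 1. Its larger eigenvalue is k^2, so (u0, u1) can be the first column of
    K in g = K D L. *)
Lemma eigen_exists g : 2 < frob g -> exists u0 u1 k : R,
  [/\ u0 ^+ 2 + u1 ^+ 2 = 1, 1 < k, k ^+ 2 + k ^- 2 = frob g,
   (g 0 0 ^+ 2 + g 0 1 ^+ 2) * u0 + (g 0 0 * g 1 0 + g 0 1 * g 1 1) * u1 = k ^+ 2 * u0 &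
   (g 0 0 * g 1 0 + g 0 1 * g 1 1) * u0 + (g 1 0 ^+ 2 + g 1 1 ^+ 2) * u1 = k ^+ 2 * u1].
Proof.
move=> t2; set p := g 0 0 ^+ 2 + _; set q := _ * _ + _; set s := g 1 0 ^+ 2 + _.
have tE : frob g = p + s by rewrite /frob /p /s; ring.
have psq : p * s - q ^+ 2 = 1.
  by rewrite -[RHS](expr1n _ 2) -(SL2_det g) /p /q /s; ring.
rewrite tE in t2 *; set t := p + s in t2 *.
pose D := Num.sqrt (t ^+ 2 - 4).
have D2 : D ^+ 2 = t ^+ 2 - 4 by rewrite sqr_sqrtr//; nra.
have D0 : 0 < D by rewrite sqrtr_gt0; nra.
pose K := (t + D) / 2.
have Kq : K ^+ 2 - t * K + 1 = 0.
  have -> : K ^+ 2 - t * K + 1 = (D ^+ 2 - (t ^+ 2 - 4)) / 4 by rewrite /K; field.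
  by rewrite D2 subrr mul0r.
have K1 : 1 < K by rewrite /K; lra.
pose k := Num.sqrt K.
have k2 : k ^+ 2 = K by rewrite sqr_sqrtr// ltW// (lt_trans _ K1).
have k1 : 1 < k by rewrite -sqrtr1 ltr_sqrt// (lt_trans _ K1).
have kk : K + K^-1 = t.
  have K0 : K != 0 by rewrite gt_eqF// (lt_trans _ K1).
  apply: (mulIf K0); rewrite mulrDl mulVf//; lra.
suff [v0 [v1 [v e1 e2]]] : exists v0 v1 : R, [/\ v0 ^+ 2 + v1 ^+ 2 != 0,
    p * v0 + q * v1 = K * v0 & q * v0 + s * v1 = K * v1].
  have vge : 0 <= v0 ^+ 2 + v1 ^+ 2 by rewrite addr_ge0// sqr_ge0.
  pose r := Num.sqrt (v0 ^+ 2 + v1 ^+ 2).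
  have r2 : r ^+ 2 = v0 ^+ 2 + v1 ^+ 2 by rewrite sqr_sqrtr.
  have r0 : r != 0 by rewrite -sqrf_eq0 r2.
  exists (v0 / r), (v1 / r), k; rewrite k2; split => //.
  - by rewrite !exprMn -mulrDl -r2 -exprMn mulfV// expr1n.
  - by rewrite !mulrA -mulrDl e1.
  - by rewrite !mulrA -mulrDl e2.
have Ks : (K - p) * (K - s) = q ^+ 2 by rewrite /t in Kq; lra.
have [q0|q0] := eqVneq q 0.
  have /orP[/eqP h|/eqP h] : (K - p == 0) || (K - s == 0) by rewrite -mulf_eq0 Ks q0 expr0n.
  - exists 1, 0; rewrite expr1n expr0n addr0 oner_neq0; split => //; first by lra.
    by rewrite q0; ring.
  - exists 0, 1; rewrite expr1n expr0n add0r oner_neq0; split => //; last by lra.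
    by rewrite q0; ring.
exists q, (K - p); split.
- by rewrite gt_eqF// ltr_pwDl ?sqr_ge0// lt_neqAle eq_sym sqrf_eq0 q0 sqr_ge0.
- by ring.
- have -> : q * q + s * (K - p) = K * (K - p) - ((K - p) * (K - s) - q ^+ 2) by ring.
  by rewrite Ks subrr subr0.
Qed.

Definition mat2 (a b c d : R) : 'M[R]_2 :=
  \matrix_(i < 2, j < 2) if i == 0 then (if j == 0 then a else b)
                         else (if j == 0 then c else d).

Lemma mat2E (A : 'M[R]_2) : A = mat2 (A 0 0) (A 0 1) (A 1 0) (A 1 1).
Proof.
apply/matrixP => i j; rewrite !mxE.
by case: i => -[|[|//]] ?; case: j => -[|[|//]] ? //=; congr (A _ _); exact/val_inj.
Qed.

Lemma mulmat2 (a b c d a' b' c' d' : R) : mat2 a b c d *m mat2 a' b' c' d' =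
  mat2 (a * a' + b * c') (a * b' + b * d') (c * a' + d * c') (c * b' + d * d').
Proof. by rewrite [LHS]mat2E !mxE !sum2E !mxE /=. Qed.

Lemma trmat2 (a b c d : R) : (mat2 a b c d)^T = mat2 a c b d.
Proof. by rewrite [LHS]mat2E !mxE. Qed.

Lemma idmat2 : 1%:M = mat2 1 0 0 1.
Proof. by rewrite [LHS]mat2E !mxE. Qed.

Lemma diag2E (k : R) : diag2 k = mat2 k 0 0 k^-1.
Proof. by rewrite [LHS]mat2E !mxE. Qed.

(** With g = K D L, the image of a unit vector has component at most 1/k orthogonally to K e1, and
    |g| <= k. This is the only geometric fact about [ups] used later. *)
Lemma upsP ups g l : is_upsilon_plus ups ->
  dP (ups g) (act g l) * N g l * snorm g <= 1.
Proof.
move=> [_ hups].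
have : 0 <= frob g - 2 by rewrite frob_gap addr_ge0 ?sqr_ge0.
(* If [frob g = 2], then g is a rotation, [ups g] is arbitrary, and the claim only says that a
   distance is at most 1. *)
rewrite subr_ge0 le_eqVlt => /predU1P[f2|f2].
  have : frob g - 2 = 0 by rewrite -f2 subrr.
  rewrite frob_gap => /eqP; rewrite paddr_eq0 ?sqr_ge0// !sqrf_eq0 => /andP[/eqP h1 /eqP h2].
  have N11 m : N g m = 1.
    apply/eqP; rewrite -(@eqrXn2 _ 2)// ?(ltW (N_gt0 _ _))// Nsq /gx /gy.
    have e1 : g 1 1 = g 0 0 by lra.
    have e2 : g 1 0 = - g 0 1 by lra.
    have := SL2_det g; rewrite e1 e2 expr1n => h3; rewrite -[X in _ == X]h3 -[X in _ == X]mulr1 -(pxy1 m).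
    by apply/eqP; ring.
  rewrite N11 mulr1 mulr_ile1 ?dP_ge0 ?dP_le1 ?(ltW (snorm_gt0 _))//.
  by apply: snorm_le => m; rewrite N11.
have [u0 [u1 [k [u k1 kt q1 q2]]]] := eigen_exists f2.
have k0 : 0 < k by rewrite (lt_trans _ k1).
have kn0 : k != 0 by rewrite gt_eqF.
set a := g 0 0 in q1 q2; set b := g 0 1 in q1 q2; set c := g 1 0 in q1 q2; set d := g 1 1 in q1 q2.
have det1 : a * d - b * c = 1 := SL2_det g.
have uMu : (u0 * a + u1 * c) ^+ 2 + (u0 * b + u1 * d) ^+ 2 = k ^+ 2.
  rewrite -[RHS]mulr1 -u mulrDr !expr2 !(mulrA (k * k)) -!expr2 -q1 -q2; ring.
have uMw : (u0 * a + u1 * c) * (- u1 * a + u0 * c) + (u0 * b + u1 * d) * (- u1 * b + u0 * d) = 0.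
  rewrite [LHS](_ : _ = - u1 * ((a ^+ 2 + b ^+ 2) * u0 + (a * c + b * d) * u1) +
    u0 * ((a * c + b * d) * u0 + (c ^+ 2 + d ^+ 2) * u1)); last by ring.
  by rewrite q1 q2; ring.
have sumM : (u0 * a + u1 * c) ^+ 2 + (u0 * b + u1 * d) ^+ 2 +
   ((- u1 * a + u0 * c) ^+ 2 + (- u1 * b + u0 * d) ^+ 2) = frob g.
  by rewrite -[RHS]mulr1 -u /frob -/a -/b -/c -/d; ring.
have wMw : (- u1 * a + u0 * c) ^+ 2 + (- u1 * b + u0 * d) ^+ 2 = k ^- 2.
  by rewrite -kt uMu in sumM; lra.
(* K is the rotation with first column the eigenvector, and L is D^-1 K^T g, orthogonal by [uMu],
   [uMw] and [wMw]. *)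
have hl := hups g (mat2 u0 (- u1) u1 u0)
  (mat2 (k^-1 * (u0 * a + u1 * c)) (k^-1 * (u0 * b + u1 * d))
        (k * (- u1 * a + u0 * c)) (k * (- u1 * b + u0 * d))) k.
have {}hl : line (ups g) = <[mat2 u0 (- u1) u1 u0 *m e1 R]>%VS.
  apply: hl => //.
  - rewrite /orthogonal2 trmat2 mulmat2 idmat2; congr mat2; rewrite -?u; ring.
  - rewrite /orthogonal2 trmat2 mulmat2 idmat2; congr mat2.
    + rewrite -!expr2 !exprMn -mulrDr uMu exprVn mulVf//.
      by rewrite expf_neq0.
    + by rewrite !(mulrACA _ _ k) -mulrDr uMw mulr0.
    + rewrite -!(mulrC (k^-1 * _)) !(mulrACA _ _ k) -mulrDr.
      rewrite [X in _ * X](_ : _ = 0) ?mulr0// -uMw; ring.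
    + by rewrite -!expr2 !exprMn -mulrDr wMw mulfV// expf_neq0.
  - rewrite diag2E !mulmat2 [LHS]mat2E -/a -/b -/c -/d; congr mat2.
    + by rewrite -[a in LHS]mul1r -u; field.
    + by rewrite -[b in LHS]mul1r -u; field.
    + by rewrite -[c in LHS]mul1r -u; field.
    + by rewrite -[d in LHS]mul1r -u; field.
have [||w [h0 h1 h2]] := @line_spanned _ (mat2 u0 (- u1) u1 u0 *m e1 R) (ups g).
- apply/eqP => h; have h0 := congr1 (fun A : 'cV[R]_2 => A 0 0) h.
  have h1 := congr1 (fun A : 'cV[R]_2 => A 1 0) h; move: h0 h1.
  rewrite !mulmx2E !mxE /= !mulr0 !mulr1 !addr0 => h0 h1.
  by move: u => /eqP; rewrite h0 h1 expr0n addr0 eq_sym oner_eq0.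
- by [].
rewrite !mulmx2E !mxE /= !mulr0 !mulr1 !addr0 in h0 h1 h2.
rewrite u mulr1 in h2.
have [t [t0 t1 t2]] := actP g l.
have snk : snorm g <= k by apply: snorm_le => m; apply: N_le_eig => //; exact: ltW.
apply: (@le_trans _ _ (dP (ups g) (act g l) * N g l * k)).
  by rewrite ler_wpM2l// mulr_ge0 ?dP_ge0// ltW// N_gt0.
rewrite -ler_pdivlMr// div1r.
have -> : dP (ups g) (act g l) * N g l = `|u0 * gy g l - u1 * gx g l|.
  rewrite dPE -[RHS]mulr1 -t2 mulrA; congr (_ * _); rewrite -normrM.
  have w1 : `|w| = 1 by apply/eqP; rewrite -(@eqrXn2 _ 2)// -normrX h2 normr1 expr1n.
  rewrite /wd h0 h1 t0 t1 -[RHS]mul1r -w1 -normrM; congr `|_|; ring.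
rewrite -(@ler_pXn2r _ 2)// ?nnegrE ?invr_ge0 ?(ltW k0)// -normrX ger0_norm ?sqr_ge0//.
rewrite exprVn -wMw -[leRHS]mulr1 -(pxy1 l) /gx /gy -/a -/b -/c -/d -subr_ge0.
set x := px l; set y := py l.
rewrite [leRHS](_ : _ = ((- u1 * a + u0 * c) * y - (- u1 * b + u0 * d) * x) ^+ 2) ?sqr_ge0//.
ring.
Qed.

End spectral.

(** * Borel measurability on SL(2, R) and on the projective line *)

Section borel.
Variable R : realType.
Implicit Types (g h : SL2 R) (l m z : projline R).

Lemma measurable_set_le d (T : measurableType d) (f g : T -> R) :
  measurable_fun setT f -> measurable_fun setT g ->
  measurable [set x | f x <= g x].
Proof.
move=> mf mg; have := measurable_fun_ler mf mg measurableT (Y := [set true]) I.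
by rewrite setTI.
Qed.

Lemma measurable_set_lt d (T : measurableType d) (f g : T -> R) :
  measurable_fun setT f -> measurable_fun setT g ->
  measurable [set x | f x < g x].
Proof.
move=> mf mg; have := measurable_fun_ltr mf mg measurableT (Y := [set true]) I.
by rewrite setTI.
Qed.

Lemma continuous_borel (T : ptopologicalType) (f : T -> R) : continuous f ->
  measurable_fun setT (f : g_sigma_algebraType (@open T) -> R).
Proof.
move=> /continuousP cf; apply: (measurability _ (RGenOpens.measurableE R)) => _ [_ [a [b ->] <-]].
by rewrite setTI; apply: sub_sigma_algebra; apply: cf; exact: interval_open.
Qed.

Lemma SL2_entry_continuous i j : continuous (fun g : SL2 R => g i j).
Proof.
move=> g; apply: (@continuous_comp _ _ _ (@sl2mx R) (fun A : 'M[R]_2 => A i j)).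
  exact: initial_continuous.
exact: coord_continuous.
Qed.

Lemma SL2_entry_measurable i j : measurable_fun setT (fun g : SL2 R => g i j).
Proof. exact: (continuous_borel (@SL2_entry_continuous i j)). Qed.

Lemma projline_openE (U : set (projline R)) : open U = dP_open U.
Proof. by []. Qed.

Lemma dP_measurable m : measurable_fun setT (dP m).
Proof.
apply: (measurability _ (RGenOpens.measurableE R)) => _ [_ [a [b ->] <-]].
rewrite setTI; apply: sub_sigma_algebra; rewrite projline_openE.
move=> x /=; rewrite in_itv /= => /andP[ax xb].
exists (Num.min (dP m x - a) (b - dP m x)); first by rewrite lt_min !subr_gt0 ax xb.
move=> y /=; rewrite in_itv /= lt_min => /andP[h1 h2].
have := dP_triangle m x y; have := dP_triangle m y x; rewrite (dP_sym y x).
by move=> h3 h4; apply/andP; split; lra.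
Qed.

(** Rational boxes form a countable base, which lets measurability into [SL2 R] be tested entry by
    entry. *)
Definition SL2_box (c : rat * rat * rat * rat * nat) : set (SL2 R) :=
  let: (q00, q01, q10, q11, n) := c in
  [set g | [/\ `|g 0 0 - ratr q00| < n.+1%:R^-1, `|g 0 1 - ratr q01| < n.+1%:R^-1,
               `|g 1 0 - ratr q10| < n.+1%:R^-1 & `|g 1 1 - ratr q11| < n.+1%:R^-1]].

Lemma rat_approx (x e : R) : 0 < e -> exists q : rat, `|x - ratr q| < e.
Proof.
move=> e0; have /rat_in_itvoo[q] : x - e < x + e by lra.
by rewrite in_itv /= => /andP[h1 h2]; exists q; rewrite ltr_distlC; lra.
Qed.

Lemma inv_nat_lt (e : R) : 0 < e -> exists n : nat, n.+1%:R^-1 < e.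
Proof.
move=> e0; have h : e^-1 < (Num.bound e^-1)%:R by apply: archi_boundP; rewrite invr_ge0 ltW.
by exists (Num.bound e^-1); rewrite invf_plt ?posrE// (lt_trans h)// ltr_nat.
Qed.

Lemma SL2_box_base (U : set (SL2 R)) g : open U -> U g ->
  exists c, SL2_box c g /\ SL2_box c `<=` U.
Proof.
move=> [V oV <-] Vg.
have : nbhs (sl2mx g) V by exact: open_nbhs_nbhs.
rewrite -nbhs_ballE => -[e /= e0 eV].
have [n ne] : exists n : nat, n.+1%:R^-1 < e / 2 by apply: inv_nat_lt; rewrite divr_gt0.
have n0 : (0 : R) < n.+1%:R^-1 by rewrite invr_gt0.
have [q00 h00] := rat_approx (g 0 0) n0; have [q01 h01] := rat_approx (g 0 1) n0.
have [q10 h10] := rat_approx (g 1 0) n0; have [q11 h11] := rat_approx (g 1 1) n0.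
exists (q00, q01, q10, q11, n); split => // h [k00 k01 k10 k11]; apply: eV; split => //.
have H (x y q : R) : `|x - q| < n.+1%:R^-1 -> `|y - q| < n.+1%:R^-1 -> `|x - y| < e.
  move=> h1 h2; rewrite -(subrKA q) (le_lt_trans (ler_normD _ _))//.
  by rewrite (distrC q) (lt_trans (ltrD h1 h2))//; move: ne; rewrite ltr_pdivlMr// mulr_natr mulr2n.
move=> i j; rewrite -ball_normE /=.
by have [->|->] := ord2P i; have [->|->] := ord2P j; [exact: H h00 k00|
  exact: H h01 k01|exact: H h10 k10|exact: H h11 k11].
Qed.

Lemma open_bigcup_box (U : set (SL2 R)) : open U ->
  U = \bigcup_(c in [set c | SL2_box c `<=` U]) SL2_box c.
Proof.
move=> oU; apply/seteqP; split => [g /(SL2_box_base oU)[c [cg cU]]|g [c cU /cU]//].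
by exists c.
Qed.

Lemma measurable_preimage_box d (T : measurableType d) (f : T -> SL2 R) c :
  (forall i j, measurable_fun setT (fun t => f t i j)) -> measurable (f @^-1` SL2_box c).
Proof.
move=> mf; case: c => [[[[q00 q01] q10] q11] n].
have H i j q : measurable [set t | `|f t i j - ratr q| < n.+1%:R^-1 :> R].
  apply: measurable_set_lt => //; apply: measurableT_comp => //.
  by apply: measurable_funB => //; exact: mf.
have -> : f @^-1` SL2_box (q00, q01, q10, q11, n) =
  ([set t | `|f t 0 0 - ratr q00| < n.+1%:R^-1] `&` [set t | `|f t 0 1 - ratr q01| < n.+1%:R^-1]) `&`
  ([set t | `|f t 1 0 - ratr q10| < n.+1%:R^-1] `&` [set t | `|f t 1 1 - ratr q11| < n.+1%:R^-1]).
  apply/seteqP; split => t /=; first by case.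
  by case=> -[? ?] [? ?].
by apply: measurableI; apply: measurableI; exact: H.
Qed.

Lemma SL2_measurable_fun d (T : measurableType d) (f : T -> SL2 R) :
  (forall i j, measurable_fun setT (fun t => f t i j)) -> measurable_fun setT f.
Proof.
move=> mf; apply: (@measurability _ _ _ _ _ _ (@open (SL2 R))) => //.
move=> _ [U oU <-]; rewrite setTI (open_bigcup_box oU) preimage_bigcup.
rewrite bigcup_mkcond; apply: countable_bigcupT_measurable; first exact: countableP.
by move=> c; case: ifPn => // _; exact: measurable_preimage_box.
Qed.

Lemma projline_dense_countable : exists F : rat * rat -> projline R,
  forall l (e : R), 0 < e -> exists q, dP (F q) l < e.
Proof.
have H (q : rat * rat) : exists l : projline R, (ratr q.1 : R) ^+ 2 + (ratr q.2 : R) ^+ 2 != 0 ->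
    exists c, [/\ px l = c * ratr q.1, py l = c * ratr q.2 &
      c ^+ 2 * (ratr q.1 ^+ 2 + ratr q.2 ^+ 2) = 1].
  have [h|h] := eqVneq ((ratr q.1 : R) ^+ 2 + (ratr q.2 : R) ^+ 2) 0.
    by exists point.
  by have [l hl] := exists_line h; exists l.
have [F hF] := choice H; exists F => l e e0.
(* The bound 1/8 keeps the squared norm of the rational vector at least 1/4, so that |c| <= 2; the
   bound e/8 makes the final estimate 4 t less than e. *)
pose t := Num.min (e / 8) (1 / 8).
have t0 : 0 < t by rewrite lt_min !divr_gt0.
have te : t <= e / 8 by rewrite ge_min lexx.
have t1 : t <= 1 / 8 by rewrite ge_min lexx orbT.
have [q1 h1] := rat_approx (px l) t0; have [q2 h2] := rat_approx (py l) t0.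
exists (q1, q2); have := hF (q1, q2) => /=.
set a : R := ratr q1 in h1 *; set b : R := ratr q2 in h2 *.
have xy := pxy1 l.
have x1 : `|px l| <= 1 by apply: (@abs_le1 _ (py l)); rewrite addrC.
have y1 : `|py l| <= 1 by exact: abs_le1 xy.
set x := px l in h1 xy x1 *; set y := py l in h2 xy y1 *.
have ab : 1 / 4 <= a ^+ 2 + b ^+ 2.
  have [k1 k2] : a ^+ 2 >= x ^+ 2 - 1/4 /\ b ^+ 2 >= y ^+ 2 - 1/4.
    have K (u v : R) : `|u| <= 1 -> `|u - v| < t -> u ^+ 2 - 1/4 <= v ^+ 2.
      move=> hu hv; have : `|u * (u - v)| <= 1 * (1 / 8).
        by rewrite normrM; apply: ler_pM => //; rewrite ltW// (lt_le_trans hv).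
      by rewrite ler_norml => /andP[_]; have := sqr_ge0 (u - v); lra.
    by split; exact: K.
  lra.
have ab0 : a ^+ 2 + b ^+ 2 != 0 by rewrite gt_eqF// (lt_le_trans _ ab)// divr_gt0.
move=> /(_ ab0)[c [c0 c1 c2]].
have c4 : `|c| <= 2.
  rewrite -(@ler_pXn2r _ 2)// ?nnegrE// -normrX ger0_norm ?sqr_ge0//.
  by have := sqr_ge0 c; nra.
rewrite dPE /wd c0 c1 -/x -/y -/a -/b.
have -> : c * a * y - c * b * x = c * ((a - x) * y - (b - y) * x) by ring.
rewrite normrM; apply: (@le_lt_trans _ _ (2 * (t + t))); last by lra.
apply: ler_pM => //; apply: le_trans (ler_normB _ _) _; rewrite !normrM.
by apply: lerD; rewrite -[leRHS]mulr1; apply: ler_pM => //; rewrite distrC ltW.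
Qed.

Lemma projline_measurable_fun d (T : measurableType d) (f : T -> projline R) :
  (forall m, measurable_fun setT (fun t => dP m (f t))) -> measurable_fun setT f.
Proof.
move=> mf; have [F hF] := projline_dense_countable.
apply: (@measurability _ _ _ _ _ _ (@open (projline R))) => //.
move=> _ [U + <-]; rewrite setTI projline_openE => oU.
have -> : U = \bigcup_(c in [set c : (rat * rat) * nat |
    [set z | dP (F c.1) z < c.2.+1%:R^-1] `<=` U]) [set z | dP (F c.1) z < c.2.+1%:R^-1].
  apply/seteqP; split => [z /oU [r r0 rU]|z [c cU /cU]//].
  have [n nr] : exists n : nat, n.+1%:R^-1 < r / 2 by apply: inv_nat_lt; rewrite divr_gt0.
  have [q qz] := hF z n.+1%:R^-1 ltac:(by rewrite invr_gt0).
  exists (q, n) => //= y /= qy; apply: rU => /=.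
  rewrite (le_lt_trans (dP_triangle z (F q) y))// (dP_sym z) (lt_trans (ltrD qz qy))//.
  by move: nr; rewrite ltr_pdivlMr// mulr_natr mulr2n.
rewrite preimage_bigcup bigcup_mkcond; apply: countable_bigcupT_measurable; first exact: countableP.
move=> [q n] /=; case: ifPn => // _.
by apply: measurable_set_lt => //; exact: mf.
Qed.

Lemma measurable_sqrt : measurable_fun setT (@Num.sqrt R).
Proof. by apply: continuous_measurable_fun; exact: sqrt_continuous. Qed.

Section compositional.
Context d (T : measurableType d).
Implicit Types (f k : T -> SL2 R) (y w : T -> projline R).

Lemma measurable_entry f i j : measurable_fun setT f -> measurable_fun setT (fun t => f t i j).
Proof. by move=> mf; apply: (measurableT_comp (SL2_entry_measurable i j)). Qed.

(** The sign in [pu] comes from an arbitrary choice, so nothing is known about measurability of [px]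
    and [py]. Their products of degree two can be read off from the distance to a fixed line: an
    axis here, the diagonal for the mixed product. *)
Lemma measurable_py2 y : measurable_fun setT y -> measurable_fun setT (fun t => py (y t) ^+ 2).
Proof.
move=> my; have [|l [c [c0 c1 c2]]] := @exists_line R 1 0.
  by rewrite expr1n expr0n addr0 oner_neq0.
rewrite [X in measurable_fun _ X](_ : _ = fun t => dP l (y t) ^+ 2).
  by apply: measurable_funX; apply: (measurableT_comp (dP_measurable l)).
apply/funext => t; rewrite dPE -normrX ger0_norm ?sqr_ge0// /wd c0 c1.
rewrite expr1n expr0n addr0 mulr1 in c2; rewrite mulr0 mul0r subr0 mulr1 exprMn c2 mul1r//.
Qed.

Lemma measurable_px2 y : measurable_fun setT y -> measurable_fun setT (fun t => px (y t) ^+ 2).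
Proof.
move=> my; rewrite [X in measurable_fun _ X](_ : _ = fun t => 1 - py (y t) ^+ 2).
  by apply: measurable_funB => //; exact: measurable_py2.
by apply/funext => t; have := pxy1 (y t); lra.
Qed.

Lemma measurable_pxy y : measurable_fun setT y -> measurable_fun setT (fun t => px (y t) * py (y t)).
Proof.
move=> my; have [|l [c [c0 c1 c2]]] := @exists_line R 1 1.
  by rewrite expr1n gt_eqF.
rewrite [X in measurable_fun _ X](_ : _ = fun t => 1/2 - dP l (y t) ^+ 2).
  apply: measurable_funB => //.
  by apply: measurable_funX; apply: (measurableT_comp (dP_measurable l)).
apply/funext => t; rewrite dPE -normrX ger0_norm ?sqr_ge0// /wd c0 c1.
rewrite expr1n !mulr1 in c2 *; rewrite -mulrBr exprMn.
have -> : c ^+ 2 = 1 / 2 by lra.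
by have := pxy1 (y t); lra.
Qed.

Lemma measurable_quad (A B : T -> R) y : measurable_fun setT A -> measurable_fun setT B ->
  measurable_fun setT y -> measurable_fun setT (fun t => (A t * px (y t) + B t * py (y t)) ^+ 2).
Proof.
move=> mA mB my.
rewrite [X in measurable_fun _ X](_ : _ = fun t => A t ^+ 2 * px (y t) ^+ 2 +
  B t ^+ 2 * py (y t) ^+ 2 + 2 * (A t * B t * (px (y t) * py (y t)))); last first.
  by apply/funext => t; ring.
apply: measurable_funD; first apply: measurable_funD.
- by apply: measurable_funM; [exact: measurable_funX|exact: measurable_px2].
- by apply: measurable_funM; [exact: measurable_funX|exact: measurable_py2].
- apply: measurable_funM => //; apply: measurable_funM; last exact: measurable_pxy.
  exact: measurable_funM.
Qed.

Lemma measurable_N f y : measurable_fun setT f -> measurable_fun setT y ->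
  measurable_fun setT (fun t => N (f t) (y t)).
Proof.
move=> mf my; apply: (measurableT_comp measurable_sqrt); apply: measurable_funD;
  by apply: measurable_quad => //; exact: measurable_entry.
Qed.

Lemma measurable_dP y w : measurable_fun setT y -> measurable_fun setT w ->
  measurable_fun setT (fun t => dP (y t) (w t)).
Proof.
move=> my mw; rewrite [X in measurable_fun _ X](_ : _ = fun t => Num.sqrt (1 - dt (y t) (w t) ^+ 2)).
  apply: (measurableT_comp measurable_sqrt); apply: measurable_funB => //.
  rewrite [X in measurable_fun _ X](_ : _ = fun t => px (y t) ^+ 2 * px (w t) ^+ 2 +
    py (y t) ^+ 2 * py (w t) ^+ 2 + 2 * ((px (y t) * py (y t)) * (px (w t) * py (w t)))); last first.
    by apply/funext => t; rewrite /dt; ring.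
  apply: measurable_funD; first apply: measurable_funD.
  - by apply: measurable_funM; exact: measurable_px2.
  - by apply: measurable_funM; exact: measurable_py2.
  - by apply: measurable_funM => //; apply: measurable_funM; exact: measurable_pxy.
apply/funext => t; rewrite dPE -sqrtr_sqr; congr Num.sqrt.
by have := dt_wd (y t) (w t); lra.
Qed.

Lemma measurable_act f y : measurable_fun setT f -> measurable_fun setT y ->
  measurable_fun setT (fun t => act (f t) (y t)).
Proof.
move=> mf my; apply: projline_measurable_fun => m.
rewrite [X in measurable_fun _ X](_ : _ = fun t => Num.sqrt
  (((px m * f t 1 0 - py m * f t 0 0) * px (y t) + (px m * f t 1 1 - py m * f t 0 1) * py (y t)) ^+ 2)
  * (N (f t) (y t))^-1).
  apply: measurable_funM; last first.
    under eq_fun do rewrite -(powR_inv1 (ltW (N_gt0 _ _))).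
    by apply: (measurableT_comp (measurable_powR _)); exact: measurable_N.
  apply: (measurableT_comp measurable_sqrt); apply: measurable_quad => //;
    by apply: measurable_funB; apply: measurable_funM => //; exact: measurable_entry.
apply/funext => t; have [c [c0 c1 c2]] := actP (f t) (y t).
rewrite sqrtr_sqr dPE /wd c0 c1; apply: (mulIf (lt0r_neq0 (N_gt0 (f t) (y t)))).
rewrite mulfVK ?gt_eqF ?N_gt0//.
have -> : px m * (c * gy (f t) (y t)) - py m * (c * gx (f t) (y t)) =
  c * ((px m * f t 1 0 - py m * f t 0 0) * px (y t) + (px m * f t 1 1 - py m * f t 0 1) * py (y t)).
  by rewrite /gx /gy; ring.
by rewrite normrM mulrAC c2 mul1r.
Qed.

Lemma measurable_sl2_mul f k : measurable_fun setT f -> measurable_fun setT k ->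
  measurable_fun setT (fun t => sl2_mul (f t) (k t)).
Proof.
move=> mf mk; apply: SL2_measurable_fun => i j.
rewrite [X in measurable_fun _ X](_ : _ = fun t => f t i 0 * k t 0 j + f t i 1 * k t 1 j).
  by apply: measurable_funD; apply: measurable_funM; exact: measurable_entry.
by apply/funext => t; rewrite /= mxE sum2E.
Qed.

Lemma sl2_invE g : sl2mx (sl2_inv g) = mat2 (g 1 1) (- g 0 1) (- g 1 0) (g 0 0).
Proof.
have e : mat2 (g 1 1) (- g 0 1) (- g 1 0) (g 0 0) *m sl2mx g = 1%:M.
  by rewrite [X in _ *m X]mat2E mulmat2 idmat2; have := SL2_det g => e; congr mat2; lra.
by rewrite -[RHS](mulmxK (sl2_unit g)) e mul1mx.
Qed.

Lemma measurable_sl2_inv f : measurable_fun setT f ->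
  measurable_fun setT (fun t => sl2_inv (f t)).
Proof.
move=> mf; apply: SL2_measurable_fun => i j.
under eq_fun do rewrite sl2_invE mxE.
by have [->|->] := ord2P i; have [->|->] := ord2P j => /=;
  rewrite ?(eq_sym 1 0) /=; try (exact: measurable_entry);
  apply: measurableT_comp => //; exact: measurable_entry.
Qed.

End compositional.

Lemma lin_SL2_continuous i (a b : R) : continuous (fun g : SL2 R => g i 0 * a + g i 1 * b).
Proof.
move=> g; have H j c : (fun h : SL2 R => h i j * c) @ g --> g i j * c.
  exact: (cvgM (@SL2_entry_continuous i j g) (cvg_cst c)).
exact: cvgD (H 0 a) (H 1 b).
Qed.

Lemma N_continuous l : continuous (fun g => N g l).
Proof.
move=> g; apply: (@continuous_comp _ _ _ (fun g => gx g l ^+ 2 + gy g l ^+ 2) Num.sqrt); last exact: sqrt_continuous.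
have h0 := @lin_SL2_continuous 0 (px l) (py l) g.
have h1 := @lin_SL2_continuous 1 (px l) (py l) g.
exact: cvgD (cvgM h0 h0) (cvgM h1 h1).
Qed.

(** The norm is an uncountable supremum of continuous functions; it is measurable because its
    superlevel sets are unions of open sets. *)
Lemma snorm_measurable : measurable_fun setT (@snorm R).
Proof.
apply: (measurability _ (RGenOInfty.measurableE R)) => _ [_ [a ->] <-]; rewrite setTI.
have -> : @snorm R @^-1` `]a, +oo[ = \bigcup_l (fun g => N g l) @^-1` `]a, +oo[.
  apply/seteqP; split => [g /=|g [l _] /=]; rewrite !in_itv /= !andbT; last first.
    by move=> /lt_le_trans; apply; exact: N_le_snorm.
  move=> ag; apply: contrapT => h; move: ag; rewrite ltNge => /negP; apply.
  apply: snorm_le => l; rewrite leNgt; apply/negP => al; apply: h; exists l => //=.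
  by rewrite in_itv /= al.
apply: sub_sigma_algebra; apply: bigcup_open => l _.
move: (@N_continuous l) => /continuousP; apply; exact: rray_open.
Qed.

Lemma frob_continuous : continuous (@frob R).
Proof.
move=> g; have H i j := @SL2_entry_continuous i j g.
have -> : @frob R = (fun g : SL2 R =>
  g 0 0 * g 0 0 + g 0 1 * g 0 1 + g 1 0 * g 1 0 + g 1 1 * g 1 1).
  by apply/funext => h; rewrite /frob !expr2.
exact: cvgD (cvgD (cvgD (cvgM (H 0 0) (H 0 0)) (cvgM (H 0 1) (H 0 1))) (cvgM (H 1 0) (H 1 0)))
  (cvgM (H 1 1) (H 1 1)).
Qed.

End borel.

(** * Laws of functions of two independent variables *)

Section product_law.
Local Open Scope ereal_scope.
Context d1 d2 d3 (T1 : measurableType d1) (T2 : measurableType d2)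
  (T3 : measurableType d3) (R : realType).
Variables (P : probability T1 R) (Q : probability T2 R) (phi : T1 -> T2 -> T3).

Definition uncurried (z : T1 * T2) := phi z.1 z.2.

Hypothesis mphi : measurable_fun setT uncurried.

(** The measurability proof is an argument so that the measure structure can be inferred from the
    term [law2 mphi]. *)
Definition law2 of measurable_fun setT uncurried : set T3 -> \bar R :=
  pushforward (P \x Q) uncurried.

HB.instance Definition _ := Measure.copy (law2 mphi)
  (measure_function_pushforward__canonical__measure_function_Measure (P \x Q) mphi).

Let law2_setT : law2 mphi setT = 1.
Proof.
rewrite /law2 /pushforward preimage_setT -setXTT product_measure1E//.
by rewrite [X in _ * X]probability_setT [X in X * _]probability_setT mule1.
Qed.

HB.instance Definition _ := Measure_isProbability.Build _ _ _ (law2 mphi) law2_setT.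

(* [S] is the law of [phi x y] for independent [x] and [y] of laws [P] and [Q]. *)
Definition is_law2 (S : set T3 -> \bar R) :=
  forall A, measurable A -> S A = \int[P]_x Q [set y | A (phi x y)].

Lemma is_law2_law2 : is_law2 (law2 mphi).
Proof.
move=> A mA; rewrite /law2 /pushforward /product_measure1; apply: eq_integral => x _ /=.
by congr (Q _); apply/seteqP; split => y; rewrite /xsection /= inE.
Qed.

Lemma measurable_preimage2 A : measurable A -> measurable (uncurried @^-1` A).
Proof. by move=> mA; rewrite -[X in measurable X]setTI; exact: mphi. Qed.

Lemma measurable_fun_sections (W : set (T1 * T2)) : measurable W ->
  measurable_fun setT (fun x => Q [set y | W (x, y)]).
Proof.
move=> mW; have := measurable_fun_xsection Q mW; congr measurable_fun.
by apply/funext => x; congr (Q _); apply/seteqP; split => y; rewrite /xsection /= inE.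
Qed.

Lemma measurable_section_set (W : set (T1 * T2)) x : measurable W -> measurable [set y | W (x, y)].
Proof.
move=> mW; have : measurable (xsection W x) by exact: measurable_xsection.
congr measurable.
by apply/seteqP; split => y; rewrite /xsection /= inE.
Qed.

Lemma measurable_law_fun A : measurable A ->
  measurable_fun setT (fun x => Q [set y | A (phi x y)]).
Proof. by move=> mA; exact: (measurable_fun_sections (measurable_preimage2 mA)). Qed.

Lemma measurable_law_set A x : measurable A -> measurable [set y | A (phi x y)].
Proof. by move=> mA; exact: (measurable_section_set x (measurable_preimage2 mA)). Qed.

Variable S : probability T3 R.
Hypothesis lawS : is_law2 S.

Let SE A : measurable A -> S A = law2 mphi A.
Proof. by move=> mA; rewrite lawS// is_law2_law2. Qed.

Lemma is_law2_ge0 (f : T3 -> \bar R) : measurable_fun setT f -> (forall z, 0 <= f z) ->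
  \int[S]_z f z = \int[P]_x \int[Q]_y f (phi x y).
Proof.
move=> mf f0; rewrite (eq_measure_integral (law2 mphi)); last first.
  by move=> A mA _; exact: SE.
rewrite ge0_integral_pushforward// preimage_setT fubini_tonelli1//.
  exact: measurableT_comp.
by move=> z /=; exact: f0.
Qed.

Lemma is_law2_integrable (f : T3 -> \bar R) : S.-integrable setT f ->
  (P \x Q).-integrable setT (f \o uncurried).
Proof.
move=> /integrableP[mf fi]; apply/integrableP; split; first exact: measurableT_comp.
move: fi; rewrite (eq_measure_integral (law2 mphi)); last first.
  by move=> A mA _; exact: SE.
rewrite ge0_integral_pushforward// ?preimage_setT//.
exact: measurableT_comp.
Qed.

Lemma is_law2_integral (f : T3 -> \bar R) : S.-integrable setT f ->
  \int[S]_z f z = \int[P]_x \int[Q]_y f (phi x y).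
Proof.
move=> fi; rewrite (eq_measure_integral (law2 mphi)); last first.
  by move=> A mA _; exact: SE.
have mf : measurable_fun setT f by case/integrableP: fi.
rewrite integral_pushforward ?preimage_setT//; last exact: is_law2_integrable.
by rewrite -integral12_prod_meas1//; exact: is_law2_integrable.
Qed.

End product_law.

(** * Convolution powers as probabilities, and iterated stationarity *)

Section random_walk.
Local Open Scope ereal_scope.
Variable R : realType.
Variable mu : probability (SL2 R) R.

Lemma measurable_uncurried_mul : measurable_fun setT (uncurried (@sl2_mul R)).
Proof. exact: measurable_sl2_mul. Qed.

Lemma measurable_uncurried_act : measurable_fun setT (uncurried (@act R)).
Proof. exact: measurable_act. Qed.

(** [conv_pow] is a bare set function; it is replaced, one factor at a time, by a probability that
    agrees with it on measurable sets. *)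
Lemma conv_probability (P Q : probability (SL2 R) R) (q : set (SL2 R) -> \bar R) :
  (forall A, measurable A -> q A = Q A) -> exists S : probability (SL2 R) R,
  (forall A, measurable A -> conv P q A = S A) /\ is_law2 P Q (@sl2_mul R) S.
Proof.
move=> qQ; exists (law2 P Q measurable_uncurried_mul); split; last exact: is_law2_law2.
move=> A mA; rewrite /law2 /conv /pushforward /product_measure1.
apply: eq_integral => x _ /=; apply: qQ; apply: measurable_xsection.
exact: measurable_preimage2 measurable_uncurried_mul _ mA.
Qed.

Lemma conv_pow_probability n : exists S : probability (SL2 R) R,
  forall A, measurable A -> conv_pow mu n A = S A.
Proof.
elim: n => [|n [S HS]]; first by exists (dirac (sl2_one R)).
by have [S' [h _]] := conv_probability mu HS; exists S'.
Qed.

Definition walk n : probability (SL2 R) R := sval (cid (conv_pow_probability n)).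

Lemma walkE n A : measurable A -> conv_pow mu n A = walk n A.
Proof. by rewrite /walk; case: cid => S /= h; exact: h. Qed.

Lemma walk0 A : measurable A -> walk 0 A = dirac (sl2_one R) A.
Proof. by move=> mA; rewrite -walkE. Qed.

Lemma walkS n : is_law2 mu (walk n) (@sl2_mul R) (walk n.+1).
Proof.
move=> A mA; rewrite -walkE//; have [S [h hS]] := conv_probability mu (@walkE n).
by rewrite [LHS]h// hS.
Qed.

Lemma walkD m n : is_law2 (walk m) (walk n) (@sl2_mul R) (walk (m + n)).
Proof.
elim: m => [|m IH] A mA.
  rewrite (eq_measure_integral (dirac (sl2_one R))); last by move=> B mB _; exact: walk0.
  rewrite integral_dirac//; last exact: (measurable_law_fun (walk n) measurable_uncurried_mul).
  rewrite diracT mul1e add0n; congr (walk n _); apply/seteqP; split => g /=;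
    by rewrite sl2_1mul.
rewrite addSn walkS//.
rewrite (is_law2_ge0 measurable_uncurried_mul (@walkS m)) => //; last first.
  exact: (measurable_law_fun (walk n) measurable_uncurried_mul).
apply: eq_integral => g _; rewrite IH.
  apply: eq_integral => h _; congr (walk n _); apply/seteqP; split => k /=; by rewrite sl2_mulA.
exact: (measurable_law_set measurable_uncurried_mul g mA).
Qed.

Lemma walk1 A : measurable A -> walk 1 A = mu A.
Proof.
move=> mA; rewrite walkS// -[A in RHS]setIT -integral_indic//.
apply: eq_integral => g _; rewrite walk0.
  by rewrite diracE/= indicE; congr (_ %:R%:E); congr nat_of_bool; apply/idP/idP; rewrite !inE /= sl2_mul1.
exact: (measurable_law_set measurable_uncurried_mul g mA).
Qed.

Variable nu : probability (projline R) R.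
Hypothesis hnu : furstenberg_measure mu nu.

Lemma walk_stationary n : is_law2 (walk n) nu (@act R) nu.
Proof.
elim: n => [|n IH] A mA.
  rewrite (eq_measure_integral (dirac (sl2_one R))); last by move=> B mB _; exact: walk0.
  rewrite integral_dirac//; last exact: (measurable_law_fun nu measurable_uncurried_act).
  rewrite diracT mul1e; congr (nu _); apply/seteqP; split => g /=; by rewrite act1.
rewrite (is_law2_ge0 measurable_uncurried_mul (@walkS n)) => //; last first.
  exact: (measurable_law_fun nu measurable_uncurried_act).
rewrite -[LHS]hnu// /conv_act /pushforward /product_measure1; apply: eq_integral => g _ /=.
have -> : xsection ((fun gx : SL2 R * projline R => act gx.1 gx.2) @^-1` A) g = [set l | A (act g l)].
  by apply/seteqP; split => l; rewrite /xsection /= inE.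
rewrite IH.
  apply: eq_integral => h _; congr (nu _); apply/seteqP; split => l /=; by rewrite act_mul.
exact: (measurable_law_set measurable_uncurried_act g mA).
Qed.

Lemma mu_stationary : is_law2 mu nu (@act R) nu.
Proof.
move=> A mA; rewrite (walk_stationary 1 mA); apply: eq_measure_integral => B mB _; exact: walk1.
Qed.

End random_walk.

(** * From almost sure properties to the closed semigroup *)

Section support.
Local Open Scope ereal_scope.
Variable R : realType.
Variable mu : probability (SL2 R) R.

Lemma SL2_box_measurable c : measurable (@SL2_box R c).
Proof. by apply: (@measurable_preimage_box _ _ _ id); exact: SL2_entry_measurable. Qed.

Lemma open_SL2_measurable (U : set (SL2 R)) : open U -> measurable U.
Proof. by move=> oU; exact: sub_sigma_algebra. Qed.

Lemma closed_SL2_measurable (U : set (SL2 R)) : closed U -> measurable U.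
Proof.
by move=> cU; rewrite -(setCK U); apply: measurableC; apply: open_SL2_measurable; exact: closed_openC.
Qed.

(** Every point outside the support lies in a rational box of measure 0, and there are only
    countably many boxes. *)
Lemma msupp_negligible : mu.-negligible (~` msupp mu).
Proof.
pose F n : set (SL2 R) := if @unpickle (rat * rat * rat * rat * nat)%type n is Some c then
  (if mu (SL2_box c) == 0 then SL2_box c else set0) else set0.
apply: (@negligibleS _ _ _ _ (\bigcup_n F n)).
  move=> g /= hg; apply: contrapT => ng; apply: hg => U oU Ug.
  have [c [cg cU]] := SL2_box_base oU Ug.
  rewrite lt_neqAle measure_ge0 andbT; apply/negP => /eqP U0; apply: ng.
  exists (pickle c); [exact: I|rewrite /F pickleK; case: ifPn => // /negP[]].
  rewrite eq_le measure_ge0 andbT [leRHS]U0; apply: le_measure => //; rewrite inE.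
    exact: SL2_box_measurable.
  exact: open_SL2_measurable.
apply: negligible_bigcup => n; rewrite /F; case: unpickle => [c|]; last exact: negligible_set0.
case: ifPn => [/eqP c0|_]; last exact: negligible_set0.
exists (SL2_box c); split => //; exact: SL2_box_measurable.
Qed.

(** A closed set of full measure contains the support. Through this lemma, almost sure invariance is
    confronted with irreducibility and with proximality. *)
Lemma Smu_sub (S : set (SL2 R)) : closed S ->
  (forall g h, S g -> S h -> S (sl2_mul g h)) -> mu (~` S) = 0 -> Smu mu `<=` S.
Proof.
move=> cS mS S0 g; apply; split => // h hh; apply: contrapT => nS.
by have := hh (~` S) (closed_openC cS) nS; rewrite S0 ltxx.
Qed.

Lemma snorm_set_measurable d (T : measurableType d) (f : T -> SL2 R) (c : R) :
  measurable_fun setT f -> measurable [set t | (c < snorm (f t))%R].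
Proof.
by move=> mf; apply: measurable_set_lt => //; exact: (measurableT_comp (@snorm_measurable R)).
Qed.

(** Compactness of the support enters the later arguments only through this almost sure bound. *)
Lemma compact_snorm_bounded : compact (msupp mu) -> exists L : R, (0 < L)%R /\
  mu [set g | (expR L < snorm g)%R] = 0.
Proof.
move=> cK; have : compact (@frob R @` msupp mu).
  apply: continuous_compact => //; apply: continuous_subspaceT; exact: frob_continuous.
move=> /compact_bounded/pinfty_ex_gt0[M M0 HM].
have HM' g : msupp mu g -> (snorm g <= Num.sqrt M)%R.
  move=> hg; rewrite (le_trans (snorm_le_frob g))// ler_wsqrtr//.
  by rewrite (le_trans (ler_norm _))// HM//; exists g.
exists (Num.sqrt M + 1)%R; split; first by rewrite ltr_wpDl// sqrtr_ge0.
have mA : measurable [set g : SL2 R | (expR (Num.sqrt M + 1) < snorm g)%R].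
  exact: (snorm_set_measurable _ (@measurable_id _ _ _)).
apply/(negligibleP _ mA); apply: negligibleS msupp_negligible => g /= h1 h2.
move: h1; rewrite ltNge => /negP; apply; rewrite (le_trans (HM' g h2))//.
by rewrite (le_trans _ (expR_ge1Dx _))// addrCA lerDl ler_wpDl.
Qed.

End support.

(** * A stationary measure has no atoms *)

Section no_atoms.
Local Open Scope ereal_scope.
Variable R : realType.

Lemma integral_prob_cst d (T : measurableType d) (P : probability T R) (a : \bar R) :
  \int[P]_x a = a.
Proof. by rewrite integral_cst// [X in (_ * X)%E]probability_setT mule1. Qed.

Lemma integral_eq0_negligible d (T : measurableType d) (P : probability T R) (f : T -> R) :
  measurable_fun setT f -> (forall x, 0 <= f x)%R -> \int[P]_x (f x)%:E = 0 ->
  P [set x | (0 < f x)%R] = 0.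
Proof.
move=> mf f0 h.
have mA : measurable [set x | (0 < f x)%R] by exact: measurable_set_lt.
have : ae_eq P setT (EFin \o f) (cst 0).
  apply/ae_eq_integral_abs => //; first exact/measurable_EFinP.
  by rewrite -[RHS]h; apply: eq_integral => x _ /=; rewrite ger0_norm.
move=> ae; apply/(negligibleP _ mA); apply: negligibleS ae => x /= fx h0.
by have := h0 I => -[] f00; rewrite f00 ltxx in fx.
Qed.

Lemma measurable_dP_ball x (r : R) : measurable (dP_ball x r).
Proof. by apply: measurable_set_le => //; exact: dP_measurable. Qed.

Lemma dP_ball0 (z : projline R) : dP_ball z 0 = [set z].
Proof.
apply/seteqP; split => y /=; rewrite /dP_ball /=.
  by move=> h; apply/esym/dP_eq0/eqP; rewrite eq_le h dP_ge0.
by move=> ->; rewrite dPxx.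
Qed.

Lemma measurable_projline1 (z : projline R) : measurable [set z].
Proof. by rewrite -dP_ball0; exact: measurable_dP_ball. Qed.

Variables (mu : probability (SL2 R) R) (nu : probability (projline R) R).
Hypothesis hirr : strongly_irreducible mu.
Hypothesis hnu : furstenberg_measure mu nu.

Lemma probability_fin (d : measure_display) (T : measurableType d) (P : probability T R) A :
  measurable A -> P A = (fine (P A))%:E.
Proof. by move=> mA; rewrite fineK// fin_num_measure. Qed.

Let atom (z : projline R) := fine (nu [set z]).

Let nu1 z : nu [set z] = (atom z)%:E.
Proof. by rewrite [LHS]probability_fin//; exact: measurable_projline1. Qed.

Let seq_measurable (s : seq (projline R)) : measurable [set z | z \in s].
Proof.
elim: s => [|z s IH]; first by rewrite [X in measurable X](_ : _ = set0); [exact: measurable0|apply/seteqP; split].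
rewrite [X in measurable X](_ : _ = [set z] `|` [set z | z \in s]).
  by apply: measurableU => //; exact: measurable_projline1.
apply/seteqP; split => y /=; rewrite in_cons; first by move=> /orP[/eqP|]; [left|right].
by move=> [->|->]; rewrite ?eqxx ?orbT.
Qed.

Let size_atoms (s : seq (projline R)) a : uniq s -> (forall z, z \in s -> a <= atom z)%R ->
  ((size s)%:R * a <= 1)%R.
Proof.
move=> us hs; rewrite -lee_fin; apply: (@le_trans _ _ (nu [set z | z \in s])); last first.
  exact: probability_le1.
elim: s us hs => [|z s IH] /=; first by move=> _ _; rewrite mul0r measure_ge0.
move=> /andP[zs us] hs.
rewrite [X in nu X](_ : _ = [set z] `|` [set z | z \in s]); last first.
  apply/seteqP; split => y /=; rewrite in_cons; first by move=> /orP[/eqP|]; [left|right].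
  by move=> [->|->]; rewrite ?eqxx ?orbT.
rewrite measureU//; last 2 first.
- exact: measurable_projline1.
- by apply/seteqP; split => // y [/= -> h]; rewrite h in zs.
rewrite -natr1 mulrDl mul1r addrC EFinD leeD//.
  by rewrite [leRHS]nu1 lee_fin hs// mem_head.
by apply: IH => // y ys; apply: hs; rewrite in_cons ys orbT.
Qed.

Let seq_argmax (s : seq (projline R)) : s != [::] ->
  exists z, z \in s /\ forall y, y \in s -> (atom y <= atom z)%R.
Proof.
elim: s => // x s IH _; have [s0|/IH[z [zs hz]]] := eqVneq s [::].
  exists x; rewrite s0 mem_head; split => // y; rewrite mem_seq1 => /eqP -> //.
have [xz|zx] := leP (atom x) (atom z).
  exists z; rewrite in_cons zs orbT; split => // y; rewrite in_cons => /orP[/eqP ->//|]; exact: hz.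
exists x; rewrite mem_head; split => // y; rewrite in_cons => /orP[/eqP ->//|ys].
by rewrite (le_trans (hz y ys))// ltW.
Qed.

(** At most 1 / [atom z0] points are as heavy as z0, so a longest list of such points exists, and it
    contains the heaviest atoms. *)
Let maximal_atoms z0 : (0 < atom z0)%R -> exists (Z : seq (projline R)) a,
  [/\ uniq Z, Z != [::], (forall z, (atom z <= a)%R) & (forall z, (z \in Z) = (atom z == a))].
Proof.
move=> a0; pose Q k := `[< exists s, [/\ uniq s, size s = k & forall z, z \in s -> (atom z0 <= atom z)%R] >].
have Q0 : exists k, Q k by exists 0%N; apply/asboolP; exists [::].
have QM k : Q k -> (k <= Num.bound (atom z0)^-1)%N.
  move=> /asboolP[s [us <- hs]]; have := size_atoms us hs.
  rewrite -ler_pdivlMr// div1r => h; rewrite -(@ler_nat R) (le_trans h)// ltW//.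
  by apply: archi_boundP; rewrite invr_ge0 ltW.
case: (ex_maxnP Q0 QM) => k /asboolP[s [us sk hs]] kmax.
have in_s z : (atom z0 <= atom z)%R -> z \in s.
  move=> hz; apply: contraT => zs.
  have := kmax (size s).+1; rewrite -sk ltnn => -> //.
  apply/asboolP; exists (z :: s); rewrite /= zs us; split => // y.
  by rewrite in_cons => /orP[/eqP ->|/hs].
have z0s : z0 \in s by exact: in_s.
have [|zm [zms hm]] := @seq_argmax s; first by apply: contraTneq z0s => ->.
have am z : (atom z <= atom zm)%R.
  have [/in_s/hm//|/ltW h] := leP (atom z0) (atom z).
  by rewrite (le_trans h)// hm.
exists [seq z <- s | atom z == atom zm], (atom zm); split => //.
- exact: filter_uniq.
- by apply/eqP => h; have := mem_filter (fun z => atom z == atom zm) zm s; rewrite h zms eqxx.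
- by move=> z; rewrite mem_filter; case: eqP => //= e; rewrite in_s// e am.
Qed.

Let act_fiber g (z : projline R) : [set y | [set z] (act g y)] = [set act (sl2_inv g) z].
Proof.
by apply/seteqP; split => y /= => [<-|->]; rewrite ?actVK ?actK.
Qed.

Let measurable_atom_inv z : measurable_fun setT (fun g => atom (act (sl2_inv g) z)).
Proof.
have h := measurable_law_fun nu (@measurable_uncurried_act R) (measurable_projline1 z).
rewrite [X in measurable_fun _ X](_ : _ = fine \o (fun g => nu [set y | [set z] (act g y)])).
  exact: measurableT_comp h.
by apply/funext => g; rewrite /= act_fiber.
Qed.

(** Maximum principle: stationarity makes the maximal mass the average of the masses at g^-1 z, so
    almost all of these are maximal. *)
Let max_atom_invariant z a : (forall y, atom y <= a)%R -> atom z = a ->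
  mu [set g | (0 < a - atom (act (sl2_inv g) z))%R] = 0.
Proof.
move=> am az.
have mf := measurable_atom_inv z.
have f0 g : (0 <= a - atom (act (sl2_inv g) z))%R by rewrite subr_ge0.
apply: integral_eq0_negligible => //; first exact: measurable_funB.
have e1 : \int[mu]_g (atom (act (sl2_inv g) z))%:E = a%:E.
  rewrite -az -nu1 (mu_stationary hnu (measurable_projline1 z)).
  by apply: eq_integral => g _; rewrite act_fiber nu1.
have e2 : \int[mu]_g ((a - atom (act (sl2_inv g) z))%:E + (atom (act (sl2_inv g) z))%:E) = a%:E.
  rewrite (eq_integral (cst a%:E)); last by move=> g _; rewrite -EFinD subrK.
  exact: integral_prob_cst.
rewrite ge0_integralD//= in e2; last 4 first.
- by move=> g _; rewrite lee_fin.
- by apply/measurable_EFinP; exact: measurable_funB.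
- by move=> g _; rewrite lee_fin fine_ge0.
- exact/measurable_EFinP.
by rewrite e1 in e2; rewrite -[LHS](@addeK _ a%:E)// e2 subee.
Qed.

Let closed_act_eq (z w : projline R) : closed [set g | act g z = w].
Proof.
have -> : [set g | act g z = w] = (fun g => px w * gy g z + - py w * gx g z)%R @^-1` [set 0%R].
  apply/seteqP; split => g /= h.
    have [c [c0 c1 c2]] := actP g z; rewrite h in c0 c1.
    have cn0 : c != 0%R by apply: contra_eq_neq c2 => ->; rewrite normr0 mul0r eq_sym oner_neq0.
    by rewrite c0 c1; ring.
  apply/esym/dP_eq0; rewrite dPE /wd; have [c [-> -> _]] := actP g z.
  have -> : (px w * (c * gy g z) - py w * (c * gx g z) = c * (px w * gy g z + - py w * gx g z))%R by ring.
  by rewrite h mulr0 normr0.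
apply: closed_comp; last exact: closed_eq.
move=> g _.
have h0 := @lin_SL2_continuous R 0%R (px z) (py z) g.
have h1 := @lin_SL2_continuous R 1%R (px z) (py z) g.
exact: cvgD (cvgM (cvg_cst (px w)) h1) (cvgM (cvg_cst (- py w)%R) h0).
Qed.

Let closed_act_in (Z : seq (projline R)) z : closed [set g | act g z \in Z].
Proof.
elim: Z => [|w Z IH]; first by rewrite [X in closed X](_ : _ = set0); [exact: closed0|apply/seteqP; split].
rewrite [X in closed X](_ : _ = [set g | act g z = w] `|` [set g | act g z \in Z]).
  exact: closedU.
apply/seteqP; split => g /=; rewrite in_cons; first by move=> /orP[/eqP|]; [left|right].
by move=> [->|->]; rewrite ?eqxx ?orbT.
Qed.

Let closed_preserve (Z s : seq (projline R)) : closed [set g | {in s, forall z, act g z \in Z}].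
Proof.
elim: s => [|w s IH].
  by rewrite [X in closed X](_ : _ = setT) ?closedT//; apply/seteqP; split.
rewrite [X in closed X](_ : _ = [set g | act g w \in Z] `&` [set g | {in s, forall z, act g z \in Z}]).
  exact: closedI.
apply/seteqP; split => g /=.
  by move=> h; split; [exact/h/mem_head|move=> z zs; apply: h; rewrite in_cons zs orbT].
by move=> [h1 h2] z; rewrite in_cons => /orP[/eqP ->//|/h2].
Qed.

(** The finitely many atoms of maximal mass would be permuted by almost every g, hence preserved by
    [Smu mu], against strong irreducibility. *)
Lemma furstenberg_no_atoms z : nu [set z] = 0.
Proof.
apply/eqP; rewrite eq_le measure_ge0 andbT leNgt; apply/negP => hz.
have [Z [a [uZ Z0 am ZE]]] : exists (Z : seq (projline R)) a,
    [/\ uniq Z, Z != [::], (forall z, (atom z <= a)%R) & (forall z, (z \in Z) = (atom z == a))].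
  by apply: (@maximal_atoms z); rewrite -lte_fin -nu1.
pose S := [set g | {in Z, forall z, act g z \in Z}].
have cS : closed S by exact: closed_preserve.
have mS : measurable (~` S) by apply: measurableC; exact: closed_SL2_measurable.
have S0 : mu (~` S) = 0.
  apply/(negligibleP _ mS).
  pose B (s : seq (projline R)) := [set g | ~ {in s, forall z, act (sl2_inv g) z \in Z}].
  have nB s : {subset s <= Z} -> mu.-negligible (B s).
    elim: s => [|w s IH] sZ.
      rewrite (_ : B [::] = set0); first exact: negligible_set0.
      by apply/seteqP; split => g //= h; apply: h.
    have wZ : w \in Z by apply: sZ; rewrite mem_head.
    apply: (@negligibleS _ _ _ _ ([set g | (0 < a - atom (act (sl2_inv g) w))%R] `|` B s)).
      move=> g /= h; apply: contrapT => /not_orP[h1 h2]; apply: h => y.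
      rewrite in_cons => /orP[/eqP ->|]; last by move: y; exact: contrapT h2.
      rewrite ZE; apply/negPn/negP => h3; apply: h1 => /=.
      by rewrite subr_gt0 lt_neqAle h3 am.
    apply: negligibleU.
      have h := @max_atom_invariant w a am.
      have mw : measurable [set g | (0 < a - atom (act (sl2_inv g) w))%R].
        by apply: measurable_set_lt => //; apply: measurable_funB => //; exact: measurable_atom_inv.
      apply/(negligibleP _ mw); apply: h.
      by apply/eqP; rewrite -ZE.
    by apply: IH => y ys; apply: sZ; rewrite in_cons ys orbT.
  apply: negligibleS (nB Z (fun _ => id)) => g /= nS h; apply: nS => y yZ.
  (* Invariance was obtained for g^-1; an injective self-map of a finite set is onto, which gives it
     for g. *)
  have inj : injective (act (sl2_inv g)) by move=> u v /(congr1 (act g)); rewrite !actK.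
  have [] := @uniq_min_size _ [seq act (sl2_inv g) u | u <- Z] Z.
  - by rewrite map_inj_uniq.
  - by move=> u /mapP[v vZ ->]; exact: h.
  - by rewrite size_map.
  move=> _ /(_ y); rewrite yZ => /mapP[u uZ' ->]; rewrite actK//.
apply: hirr; exists [seq line y | y <- Z]; split.
- by move=> /(congr1 size); rewrite size_map => /eqP; rewrite size_eq0 (negbTE Z0).
- move=> V /mapP[y yZ ->]; have dy := eqP (dim_line y); split.
    by apply/eqP => e; rewrite e dimv0 in dy.
  by apply/eqP => e; rewrite e dimvf in dy.
- move=> g V Sg /mapP[y yZ ->]; apply/mapP; exists (act g y) => //.
  have := Smu_sub cS _ S0 Sg; apply => // h k hh hk u uZ'.
  by rewrite act_mul; apply: hh; exact: hk.
Qed.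

End no_atoms.

(** * Uniform smallness of balls *)

Section small_balls.
Local Open Scope ereal_scope.
Variable R : realType.
Variable nu : probability (projline R) R.
Hypothesis nu0 : forall z, nu [set z] = 0.

Lemma dP_ball_sub (x y : projline R) (r s : R) : (dP x y + r <= s)%R -> dP_ball y r `<=` dP_ball x s.
Proof. by move=> h z; rewrite /dP_ball /= => yz; have := dP_triangle x y z; lra. Qed.

Let invn_nincr (m n : nat) : (m <= n)%N -> (n.+1%:R^-1 <= m.+1%:R^-1 :> R)%R.
Proof. by move=> mn; rewrite lef_pV2 ?posrE// ler_nat. Qed.

(* A limsup argument replaces the compactness of the projective line: if balls
   of radius tending to 0 had mass > e, then a point lying in infinitely many of
   them would be an atom. *)
Lemma small_balls (e : R) : (0 < e)%R -> exists2 eta : R, (0 < eta)%R &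
  forall x, nu (dP_ball x eta) <= e%:E.
Proof.
move=> e0; apply: contrapT => h.
have hx0 (k : nat) : exists y, e%:E < nu (dP_ball y k.+1%:R^-1).
  apply: contrapT => hk; apply: h; exists k.+1%:R^-1%R; first by rewrite invr_gt0.
  by move=> y; rewrite leNgt; apply/negP => hy; apply: hk; exists y.
have [x hx] := choice hx0.
pose E m := \bigcup_(k in [set k | (m <= k)%N]) dP_ball (x k) k.+1%:R^-1.
have mE m : measurable (E m) by apply: bigcup_measurable => k _; exact: measurable_dP_ball.
have cE : nu \o E @ \oo --> nu (\bigcap_m E m).
  apply: nonincreasing_cvg_mu => //.
  - by rewrite (le_lt_trans (probability_le1 _ _))// ltry.
  - exact: bigcapT_measurable.
  - by move=> m n mn; apply/subsetPset => y [k /= nk yk]; exists k => //=; exact: leq_trans nk.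
have eE : e%:E <= nu (\bigcap_m E m).
  rewrite -(cvg_lim _ cE)//; apply: lime_ge; first by apply/cvg_ex; eexists; exact: cE.
  apply: nearW => m /=; rewrite (le_trans (ltW (hx m)))// le_measure ?inE//.
    exact: measurable_dP_ball.
  by move=> y ym; exists m => //=.
have [y hy] : \bigcap_m E m !=set0.
  by apply/set0P; apply: contraTneq eE => ->; rewrite measure0 -ltNge lte_fin.
have hk k : e%:E <= nu (dP_ball y k.+1%:R^-1).
  have [j /= kj yj] := hy (2 * k.+1)%N I.
  apply: (le_trans (ltW (hx j))); apply: le_measure; rewrite ?inE; try exact: measurable_dP_ball.
  apply: dP_ball_sub; rewrite dP_sym.
  have h1 : (j.+1%:R^-1 <= (2 * k.+1)%:R^-1 :> R)%R.
    by rewrite lef_pV2 ?posrE// ?ltr0n ?muln_gt0// ler_nat (leq_trans kj).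
  apply: (@le_trans _ _ ((2 * k.+1)%:R^-1 + (2 * k.+1)%:R^-1)%R).
    by apply: lerD => //; exact: le_trans h1.
  by rewrite natrM invfM -mulrDl -[leRHS]mul1r ler_wpM2r ?invr_ge0//; lra.
have c0 : (fun k => nu (dP_ball y k.+1%:R^-1)) @ \oo --> nu (\bigcap_k dP_ball y k.+1%:R^-1).
  apply: (@nonincreasing_cvg_mu _ _ _ nu (fun k => dP_ball y k.+1%:R^-1)).
  - by rewrite (le_lt_trans (probability_le1 _ _)) ?ltry//; exact: measurable_dP_ball.
  - by move=> i; exact: measurable_dP_ball.
  - by apply: bigcapT_measurable => i; exact: measurable_dP_ball.
  - by move=> m n mn; apply/subsetPset; apply: dP_ball_sub; rewrite dPxx add0r invn_nincr.
have : e%:E <= nu (\bigcap_k dP_ball y k.+1%:R^-1).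
  rewrite -(cvg_lim _ c0)//; apply: lime_ge; first by apply/cvg_ex; eexists; exact: c0.
  exact: nearW.
rewrite [X in nu X](_ : _ = [set y]) ?nu0; first by rewrite leNgt lte_fin e0.
apply/seteqP; split => z /=; last by move=> -> k _; rewrite /dP_ball /= dPxx invr_ge0.
move=> hz; apply/esym/dP_eq0/eqP; rewrite eq_le dP_ge0 andbT leNgt; apply/negP => d0.
have [n nd] := inv_nat_lt d0; have := hz n I; rewrite /dP_ball /= leNgt => /negP; exact.
Qed.

End small_balls.

(** * Real-valued expectations and iterated integrals *)

Section expectation.
Context d (T : measurableType d) (R : realType) (P : probability T R).
Implicit Types f g : T -> R.

Lemma integrable_essentially_bounded f (M : R) : measurable_fun setT f ->
  P [set x | M < `|f x|] = 0%E -> P.-integrable setT (EFin \o f).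
Proof.
move=> mf h.
have mA : measurable [set x | M < `|f x|].
  by apply: measurable_set_lt => //; exact: measurableT_comp.
apply/(negligible_integrable mA measurableT _ h); first exact/measurable_EFinP.
apply: measurable_bounded_integrable => //.
- exact: measurableD.
- by rewrite (le_lt_trans (probability_le1 _ _)) ?ltry//; exact: measurableD.
- exact: measurable_funTS.
- exists M; split; first exact: num_real.
  by move=> y My x /= [_ /negP]; rewrite -leNgt => /le_trans -> //; exact: ltW.
Qed.

Lemma integrable_prob_bounded f (M : R) : measurable_fun setT f ->
  (forall x, `|f x| <= M) -> P.-integrable setT (EFin \o f).
Proof.
move=> mf h; apply: (@integrable_essentially_bounded _ M) => //.
rewrite [X in P X](_ : _ = set0) ?measure0//; apply/seteqP; split => x //=.
by rewrite ltNge h.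
Qed.

Lemma EFin_Rintegral f : P.-integrable setT (EFin \o f) ->
  (\int[P]_x f x)%:E = (\int[P]_x (f x)%:E)%E.
Proof. by move=> fi; rewrite /Rintegral fineK//; exact: integrable_fin_num. Qed.

Lemma Rintegral_prob_cst (a : R) : \int[P]_x a = a.
Proof. by rewrite Rintegral_cst// [X in fine X]probability_setT mulr1. Qed.

Lemma Rintegral_norm_le f (M : R) : measurable_fun setT f ->
  (forall x, `|f x| <= M) -> `|\int[P]_x f x| <= M.
Proof.
move=> mf h; have fi := integrable_prob_bounded mf h.
apply: (le_trans (le_normr_Rintegral _ fi)) => //.
rewrite -[leRHS]Rintegral_prob_cst; apply: le_Rintegral => //.
  by apply: (@integrable_prob_bounded _ M); [exact: measurableT_comp|move=> x; rewrite normr_id].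
by apply: (@integrable_prob_bounded _ `|M|).
Qed.

Lemma Rintegral_indic A : measurable A -> \int[P]_x (\1_A x : R) = fine (P A).
Proof. by move=> mA; rewrite /Rintegral integral_indic// setIT. Qed.

End expectation.

Lemma measurable_Rintegral_section d1 d2 (T1 : measurableType d1) (T2 : measurableType d2)
  (R : realType) (Q : probability T2 R) (F : T1 * T2 -> R) :
  measurable_fun setT F -> measurable_fun setT (fun x => \int[Q]_y F (x, y)).
Proof.
move=> mF; rewrite /Rintegral; apply: (measurableT_comp (fine_measurable measurableT)).
rewrite (_ : (fun x => _) = (fun x => \int[Q]_y ((EFin \o F)^\+ (x, y)) - \int[Q]_y ((EFin \o F)^\- (x, y)))%E); last first.
  apply/funext => x; rewrite [LHS]integralE.
  by congr (fun u v => (u - v)%E); apply: eq_integral => y _; rewrite ?funeposE ?funenegE.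
have mE : measurable_fun setT (EFin \o F) by exact/measurable_EFinP.
have H1 : measurable_fun setT (fubini_F Q (EFin \o F)^\+%E).
  by apply: measurable_fun_fubini_tonelli_F => //; exact: measurable_funepos.
have H2 : measurable_fun setT (fubini_F Q (EFin \o F)^\-%E).
  by apply: measurable_fun_fubini_tonelli_F => //; exact: measurable_funeneg.
exact: emeasurable_funB H1 H2.
Qed.

Lemma is_law2_Rintegral d1 d2 d3 (T1 : measurableType d1) (T2 : measurableType d2)
  (T3 : measurableType d3) (R : realType) (P : probability T1 R) (Q : probability T2 R)
  (phi : T1 -> T2 -> T3) (S : probability T3 R) (f : T3 -> R) :
  measurable_fun setT (uncurried phi) -> is_law2 P Q phi S ->
  S.-integrable setT (EFin \o f) ->
  (forall x, Q.-integrable setT (fun y => (f (phi x y))%:E)) ->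
  \int[S]_z f z = \int[P]_x \int[Q]_y f (phi x y).
Proof.
move=> mphi lawS fi gi; apply: EFin_inj; rewrite EFin_Rintegral//.
rewrite (is_law2_integral mphi lawS fi) [RHS]fineK.
  by apply: eq_integral => x _; rewrite EFin_Rintegral//; exact: gi x.
rewrite [X in X \is a fin_num](_ : _ = (\int[P]_x (\int[Q]_y (EFin \o f) (phi x y))))%E.
  rewrite -(is_law2_integral mphi lawS fi); exact: integrable_fin_num.
by apply: eq_integral => x _; rewrite EFin_Rintegral//; exact: gi x.
Qed.

(** * The logarithm of the stretch factor *)

Section log_norm.
Variable R : realType.
Implicit Types (g h : SL2 R) (y : projline R).

Lemma ln_abs_le (x m : R) : 0 < x -> m^-1 <= x -> x <= m -> `|ln x| <= ln m.
Proof.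
move=> x0 h1 h2; have m0 : 0 < m by exact: lt_le_trans h2.
rewrite ler_norml; apply/andP; split; last by rewrite ler_ln.
by rewrite -lnV// ler_ln ?posrE ?invr_gt0.
Qed.

Lemma ln_N_le g y : `|ln (N g y)| <= ln (snorm g).
Proof. by apply: ln_abs_le; rewrite ?N_gt0 ?N_ge ?N_le_snorm. Qed.

Lemma ln_snorm_ge0 g : 0 <= ln (snorm g).
Proof. by rewrite ln_ge0// snorm_ge1. Qed.

Lemma measurable_lnN d (T : measurableType d) (f : T -> SL2 R) (y : T -> projline R) :
  measurable_fun setT f -> measurable_fun setT y -> measurable_fun setT (fun t => ln (N (f t) (y t))).
Proof.
by move=> mf my; apply: (measurableT_comp (@measurable_ln R)); exact: measurable_N.
Qed.

Lemma integrable_lnN (nu : probability (projline R) R) g :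
  nu.-integrable setT (EFin \o (fun y => ln (N g y))).
Proof.
apply: (@integrable_prob_bounded _ _ _ _ _ (ln (snorm g))).
  by apply: measurable_lnN.
by move=> y; exact: ln_N_le.
Qed.

End log_norm.

(** * Unimodular quadratic forms and their logarithmic potential *)

Section quadratic_forms.
Variable R : realType.
Implicit Types (g h : SL2 R) (y z : projline R) (a b c : R).

(* Positive definite forms [a x^2 + 2 b x y + c y^2] of determinant 1, evaluated
   on unit vectors; [pull_a], [pull_b], [pull_c] are the coefficients of the form
   composed with [g]. *)
Definition qf a b c y := a * px y ^+ 2 + b * (px y * py y) *+ 2 + c * py y ^+ 2.
Definition posdef1 a b c := 0 < a /\ a * c - b ^+ 2 = 1.

Lemma posdef1_c a b c : posdef1 a b c -> 0 < c.
Proof.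
move=> [a0 h]; rewrite -(pmulr_rgt0 _ a0).
by have := sqr_ge0 b; lra.
Qed.

Lemma qf_gt0 a b c y : posdef1 a b c -> 0 < qf a b c y.
Proof.
move=> [a0 h]; have e : a * qf a b c y = (a * px y + b * py y) ^+ 2 + py y ^+ 2.
  by rewrite -[X in _ = _ + X]mul1r -h /qf; ring.
rewrite -(pmulr_rgt0 _ a0) e lt_neqAle addr_ge0 ?sqr_ge0// andbT eq_sym.
rewrite paddr_eq0 ?sqr_ge0// !sqrf_eq0; apply/negP => /andP[/eqP h1 /eqP h2].
move: h1; rewrite h2 mulr0 addr0 => /eqP; rewrite mulf_eq0 gt_eqF//= => /eqP h3.
by have := pxy1 y; rewrite h2 h3 expr0n addr0 => /eqP; rewrite eq_sym oner_eq0.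
Qed.

Lemma qf_perp a b c y z : px z ^+ 2 = py y ^+ 2 -> py z ^+ 2 = px y ^+ 2 ->
  px z * py z = - (px y * py y) -> qf a b c y + qf a b c z = a + c.
Proof.
move=> h1 h2 h3; rewrite /qf h1 h2 h3 -[RHS]mulr1 -[X in _ = _ * X](pxy1 y); ring.
Qed.

Lemma qf_le_tr a b c y : posdef1 a b c -> qf a b c y <= a + c.
Proof.
move=> h; have [z [_ [h1 [h2 h3]]]] := exists_perp y.
by rewrite -(qf_perp a b c h1 h2 h3) lerDl ltW// qf_gt0.
Qed.

(** Gram identity: q(y) q(z) minus the square of the polar form is the determinant, here 1, times
    the squared wedge. *)
Lemma qf_mul_wd a b c y z : posdef1 a b c -> dP y z ^+ 2 <= qf a b c y * qf a b c z.
Proof.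
move=> [a0 h]; rewrite dPE -normrX ger0_norm ?sqr_ge0// -subr_ge0.
suff -> : qf a b c y * qf a b c z - wd y z ^+ 2 =
  (a * px y * px z + b * (px y * py z + py y * px z) + c * py y * py z) ^+ 2 by rewrite sqr_ge0.
by rewrite -[X in _ - X]mul1r -[X in _ - X * _]h /qf /wd; ring.
Qed.

Lemma qf_ge_tr a b c y : posdef1 a b c -> (a + c)^-1 <= qf a b c y.
Proof.
move=> h; have [z [d1 _]] := exists_perp y; have := qf_mul_wd y z h; rewrite d1 expr1n => h1.
have t0 : 0 < a + c by rewrite addr_gt0 ?(posdef1_c h)//; case: h.
rewrite -(ler_pM2l t0) mulfV ?gt_eqF// (le_trans h1)// mulrC ler_wpM2r ?qf_le_tr//.
by rewrite ltW// qf_gt0.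
Qed.

Lemma tr_ge2 a b c : posdef1 a b c -> 2 <= a + c.
Proof.
move=> h; have c0 := posdef1_c h; case: h => a0 h.
rewrite -(@ler_pXn2r _ 2)// ?nnegrE ?addr_ge0 ?(ltW a0) ?(ltW c0)//.
by have := sqr_ge0 (a - c); have := sqr_ge0 b; lra.
Qed.

Lemma measurable_qf a b c : measurable_fun setT (qf a b c).
Proof.
have mi := @measurable_id _ (projline R) setT.
apply: measurable_funD; first apply: measurable_funD.
- by apply: measurable_funM => //; exact: (measurable_px2 mi).
- under eq_fun do rewrite mulr2n.
  by apply: measurable_funD; apply: measurable_funM => //; exact: (measurable_pxy mi).
- by apply: measurable_funM => //; exact: (measurable_py2 mi).
Qed.

Lemma ln_qf_le a b c y : posdef1 a b c -> `|ln (qf a b c y)| <= ln (a + c).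
Proof. by move=> h; apply: ln_abs_le; [exact: qf_gt0|exact: qf_ge_tr|exact: qf_le_tr]. Qed.

Variable nu : probability (projline R) R.

Lemma measurable_ln_qf a b c : measurable_fun setT (fun y => ln (qf a b c y)).
Proof. by apply: (measurableT_comp (@measurable_ln R)); exact: measurable_qf. Qed.

Lemma integrable_ln_qf a b c : posdef1 a b c ->
  nu.-integrable setT (EFin \o (fun y => ln (qf a b c y))).
Proof.
move=> h; apply: (@integrable_prob_bounded _ _ _ _ _ (ln (a + c))); first exact: measurable_ln_qf.
by move=> y; exact: ln_qf_le.
Qed.

(** As a function of the form, [ln (qf a b c y)] is up to a factor the Busemann function, at the
    boundary point y, of the hyperbolic plane of unimodular forms. Hence a minimiser of this average
    is a barycentre of nu. *)
Definition qpotential a b c := \int[nu]_y ln (qf a b c y).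

Definition pull_a g a b c := a * g 0 0 ^+ 2 + b * (g 0 0 * g 1 0) *+ 2 + c * g 1 0 ^+ 2.
Definition pull_b g a b c := a * g 0 0 * g 0 1 + b * (g 0 0 * g 1 1 + g 0 1 * g 1 0) + c * g 1 0 * g 1 1.
Definition pull_c g a b c := a * g 0 1 ^+ 2 + b * (g 0 1 * g 1 1) *+ 2 + c * g 1 1 ^+ 2.

Lemma qf_pull g a b c y : qf (pull_a g a b c) (pull_b g a b c) (pull_c g a b c) y =
  qf a b c (act g y) * N g y ^+ 2.
Proof.
have [t [t0 t1 t2]] := actP g y.
have t3 : t ^+ 2 * N g y ^+ 2 = 1.
  by rewrite -[t ^+ 2]ger0_norm ?sqr_ge0// normrX -exprMn t2 expr1n.
transitivity ((a * gx g y ^+ 2 + b * (gx g y * gy g y) *+ 2 + c * gy g y ^+ 2) * (t ^+ 2 * N g y ^+ 2)).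
  by rewrite t3 mulr1 /qf /pull_a /pull_b /pull_c /gx /gy; ring.
by rewrite /qf t0 t1; ring.
Qed.

Lemma posdef1_pull g a b c : posdef1 a b c ->
  posdef1 (pull_a g a b c) (pull_b g a b c) (pull_c g a b c).
Proof.
move=> h; split.
  have [|l [t [t0 t1 t2]]] := @exists_line R 1 0; first by rewrite expr1n expr0n addr0 oner_neq0.
  have := qf_pull g a b c l; rewrite {1}/qf t0 t1 mulr1 mulr0 !mulr0 mul0rn expr0n !mulr0 !addr0.
  rewrite expr1n expr0n addr0 mulr1 in t2; rewrite t2 mulr1 => ->.
  by rewrite mulr_gt0 ?qf_gt0// exprn_gt0// N_gt0.
case: h => _ h; transitivity ((a * c - b ^+ 2) * (g 0 0 * g 1 1 - g 0 1 * g 1 0) ^+ 2).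
  by rewrite /pull_a /pull_b /pull_c; ring.
by rewrite h SL2_det expr1n mulr1.
Qed.

Lemma qpotential_pull g a b c : posdef1 a b c ->
  qpotential (pull_a g a b c) (pull_b g a b c) (pull_c g a b c) =
  \int[nu]_y ln (qf a b c (act g y)) + \int[nu]_y (ln (N g y)) *+ 2.
Proof.
move=> h.
have mq : measurable_fun setT (fun y => ln (qf a b c (act g y))).
  apply: (measurableT_comp (@measurable_ln_qf a b c)); exact: measurable_act.
have mi : nu.-integrable setT (EFin \o (fun y => ln (qf a b c (act g y)))).
  by apply: (@integrable_prob_bounded _ _ _ _ _ (ln (a + c))) => // y; exact: ln_qf_le.
have li := integrable_lnN nu g.
rewrite mulr2n -RintegralD// -RintegralD//; last exact: (integrableD measurableT li li).
apply: eq_Rintegral => y _; rewrite qf_pull lnM ?posrE ?qf_gt0 ?exprn_gt0 ?N_gt0//.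
by rewrite lnXn ?N_gt0// mulr2n addrA.
Qed.

End quadratic_forms.

(** * Eigenlines of proximal elements *)

Section proximality.
Variable R : realType.
Implicit Types (g : SL2 R) (y : projline R).
Local Notation C := (R[i]).

Local Notation rc := (real_complex R).

Lemma horner_char_poly2 g (z : C) :
  (char_poly (map_mx rc g)).[z] = z ^+ 2 - rc (g 0 0 + g 1 1) * z + 1.
Proof.
rewrite /char_poly det2E !mxE /= !mulr1n !mulr0n !sub0r mulrNN.
rewrite !hornerE /= -[X in _ = _ + X](rmorph1 rc) -(SL2_det g).
rewrite rmorphD rmorphB !rmorphM /=; ring.
Qed.

Lemma char_poly2_double g (x : R) : x ^+ 2 = 1 -> x ^+ 2 - (g 0 0 + g 1 1) * x + 1 = 0 ->
  char_poly (map_mx rc g) = ('X - (rc x)%:P) ^+ 2.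
Proof.
move=> x1 h; have t : g 0 0 + g 1 1 = 2 * x.
  have x0 : x != 0 by apply: contra_eq_neq x1 => ->; rewrite expr0n eq_sym oner_neq0.
  by apply: (mulIf x0); rewrite -mulrA -expr2; lra.
have e : g 0 0 * g 1 1 - g 0 1 * g 1 0 = x ^+ 2 by rewrite SL2_det x1.
rewrite /char_poly det2E !mxE /= !mulr1n !mulr0n !sub0r mulrNN.
have -> : rc (g 1 1) = 2 * rc x - rc (g 0 0).
  by rewrite -(rmorph_nat rc) -rmorphM -rmorphB /= -t; congr (_ +i* _)%C; ring.
have h2 : rc (g 0 1) * rc (g 1 0) = rc (g 0 0) * (2 * rc x - rc (g 0 0)) - rc x ^+ 2.
  rewrite -(rmorph_nat rc) -!rmorphM -rmorphXn -!rmorphB -rmorphM -rmorphB /= -t -e.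
  by congr (_ +i* _)%C; ring.
rewrite -polyCM h2 !(polyCB, polyCM, polyC_exp) polyCMn; ring.
Qed.

(** A non-real leading eigenvalue has a conjugate of the same modulus, and since det g = 1 an
    eigenvalue 1 or -1 is a double root. *)
Lemma simple_leading_eigenvalue_real g : simple_leading_eigenvalue g ->
  exists x : R, x ^+ 2 != 1 /\ x ^+ 2 - (g 0 0 + g 1 1) * x + 1 = 0.
Proof.
move=> [l [ml hl]].
have root_l : root (char_poly (map_mx rc g)) l.
  by apply: contraT => /mupNroot; rewrite ml.
have pl : l ^+ 2 - rc (g 0 0 + g 1 1) * l + 1 = 0.
  by move/eqP: root_l; rewrite horner_char_poly2.
have lr : l^* = l.
  apply/eqP/contraT => lc; suff : `|l^*| < `|l| by rewrite norm_conjC ltxx.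
  apply: hl => //; rewrite eigenvalue_root_char /root horner_char_poly2.
  set t := rc _ in pl *.
  have tr : t^* = t by rewrite /t /=; apply/eqP; rewrite eq_complex /= oppr0 !eqxx.
  have := congr1 (fun z : C => z^*) pl; rewrite rmorphD rmorphB rmorphXn rmorphM rmorph1 rmorph0 /= tr.
  by move=> ->.
have [x lx] : exists x, l = rc x.
  case: l lr {ml hl root_l pl} => a b [] /eqP; rewrite eq_sym -addr_eq0 -mulr2n mulrn_eq0 /= => /eqP ->.
  by exists a.
exists x; have h : x ^+ 2 - (g 0 0 + g 1 1) * x + 1 = 0.
  by apply: (fmorph_inj rc); rewrite rmorph0 -pl lx rmorphD rmorphB rmorphXn rmorphM rmorph1.
split => //; apply/negP => /eqP x1.
move: ml; rewrite (char_poly2_double x1 h) lx.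
by rewrite mup_XsubCX eqxx.
Qed.

(** An element preserving a definite form stretches each of its fixed lines by exactly 1, so such a
    line rules out an invariant form. *)
Lemma simple_leading_eigenvalue_fixed_line g : simple_leading_eigenvalue g ->
  exists y, act g y = y /\ N g y != 1.
Proof.
move=> /simple_leading_eigenvalue_real[x [x1 hx]].
have hdet : (g 0 0 - x) * (g 1 1 - x) = g 0 1 * g 1 0 by have := SL2_det g; lra.
suff [v0 [v1 [v e1 e2]]] : exists v0 v1 : R, [/\ v0 ^+ 2 + v1 ^+ 2 != 0,
    g 0 0 * v0 + g 0 1 * v1 = x * v0 & g 1 0 * v0 + g 1 1 * v1 = x * v1].
  have [y [c [c0 c1 c2]]] := exists_line v.
  have gxE : gx g y = x * px y by rewrite /gx c0 c1 (mulrCA _ c) (mulrCA _ c) -mulrDr e1; ring.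
  have gyE : gy g y = x * py y by rewrite /gy c0 c1 (mulrCA _ c) (mulrCA _ c) -mulrDr e2; ring.
  exists y; split.
    apply: dP_eq0; have [k [k0 k1 k2]] := actP g y.
    by rewrite dPE /wd k0 k1 gxE gyE [X in `|X|](_ : _ = 0) ?normr0//; ring.
  apply: contra x1 => /eqP h; have := Nsq g y; rewrite h gxE gyE !exprMn -mulrDr pxy1 mulr1 => <-.
  by rewrite expr1n.
have [b0|b0] := eqVneq (g 0 1) 0.
  have [c0|c0] := eqVneq (g 1 0) 0; last first.
    exists (x - g 1 1), (g 1 0); split.
    - by rewrite gt_eqF// ltr_wpDl ?sqr_ge0// lt_neqAle eq_sym sqrf_eq0 c0 sqr_ge0.
    - by rewrite b0 in hdet *; lra.
    - by ring.
  rewrite b0 c0 mul0r in hdet; have d1 := SL2_det g; rewrite b0 c0 mul0r subr0 in d1.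
  move/eqP: hdet; rewrite mulf_eq0 !subr_eq0 => /orP[/eqP h|/eqP h].
    exists 1, 0; rewrite b0 c0 h; split; [by rewrite expr1n expr0n addr0 oner_neq0|ring|ring].
  exists 0, 1; rewrite b0 c0 h; split; [by rewrite expr1n expr0n add0r oner_neq0|ring|ring].
exists (g 0 1), (x - g 0 0); split.
- by rewrite gt_eqF// ltr_pwDl ?sqr_ge0// lt_neqAle eq_sym sqrf_eq0 b0 sqr_ge0.
- by ring.
- by lra.
Qed.

End proximality.

(** * Existence of a minimising form *)

Section coercive_potential.
Variable R : realType.
Variable nu : probability (projline R) R.
Hypothesis nu0 : forall z, nu [set z] = 0%E.
Implicit Types (a b c : R) (y z : projline R).

Lemma qf_diff a b c a' b' c' y :
  `|qf a b c y - qf a' b' c' y| <= `|a - a'| + `|b - b'| *+ 2 + `|c - c'|.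
Proof.
have xy := pxy1 y.
have x1 : px y ^+ 2 <= 1 by have := sqr_ge0 (py y); lra.
have y1 : py y ^+ 2 <= 1 by have := sqr_ge0 (px y); lra.
have z1 : `|px y * py y| <= 1.
  by rewrite ler_norml; have := sqr_ge0 (px y + py y); have := sqr_ge0 (px y - py y); lra.
have -> : qf a b c y - qf a' b' c' y =
  (a - a') * px y ^+ 2 + (b - b') * (px y * py y) *+ 2 + (c - c') * py y ^+ 2 by rewrite /qf; ring.
apply: (le_trans (ler_normD _ _)); apply: lerD;
  first by apply: (le_trans (ler_normD _ _)); apply: lerD;
    [rewrite normrM ler_piMr// ger0_norm ?sqr_ge0|rewrite normrMn lerMn2r normrM ler_piMr ?orbT].
by rewrite normrM ler_piMr// ger0_norm ?sqr_ge0.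
Qed.

Lemma ln_sub_le (u v : R) : 0 < u -> 0 < v -> ln u - ln v <= (u - v) / v.
Proof.
move=> u0 v0; rewrite -ln_div//.
have -> : u / v = 1 + (u - v) / v by field; rewrite gt_eqF.
apply: le_ln1Dx.
have : 0 < u / v by rewrite divr_gt0.
by rewrite mulrBl mulfV ?gt_eqF//; lra.
Qed.

Lemma measurable_qf_le a b c (m : R) : measurable [set y | qf a b c y <= m].
Proof. by apply: measurable_set_le => //; exact: measurable_qf. Qed.

(** After multiplication by [wd y z], any unit vector is a combination of those of y and z with
    coefficients at most 1. So a form of large trace cannot be small on two lines that are far
    apart. *)
Lemma qf_small_dP a b c y z : posdef1 a b c ->
  (a + c) * dP y z ^+ 2 <= 4 * (qf a b c y + qf a b c z).
Proof.
move=> h.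
have key w : qf a b c w * dP y z ^+ 2 <= 2 * (qf a b c y + qf a b c z).
  rewrite dPE -normrX ger0_norm ?sqr_ge0//.
  have k1 : wd w z ^+ 2 <= 1 by have := sqr_ge0 (dt w z); have := dt_wd w z; lra.
  have k2 : wd w y ^+ 2 <= 1 by have := sqr_ge0 (dt w y); have := dt_wd w y; lra.
  have q1 := qf_gt0 y h; have q2 := qf_gt0 z h.
  apply: (@le_trans _ _ (2 * (wd w z ^+ 2 * qf a b c y + wd w y ^+ 2 * qf a b c z))); last first.
    by rewrite ler_pM2l// lerD// ler_piMl// ltW.
  have e : a * (2 * (wd w z ^+ 2 * qf a b c y + wd w y ^+ 2 * qf a b c z) - qf a b c w * wd y z ^+ 2) =
    (a * (wd w z * px y + wd w y * px z) + b * (wd w z * py y + wd w y * py z)) ^+ 2 +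
    (wd w z * py y + wd w y * py z) ^+ 2.
    case: h => _ h; rewrite -[X in _ = _ + X]mul1r -[X in _ = _ + X * _]h /qf /wd; ring.
  rewrite -subr_ge0; case: h => a0 _.
  by rewrite -(pmulr_rge0 _ a0) e addr_ge0 ?sqr_ge0.
have [z' [_ [h1 [h2 h3]]]] := exists_perp y.
rewrite -(qf_perp a b c h1 h2 h3) mulrDl.
by have := key y; have := key z'; lra.
Qed.

(** The lines on which the form is at most c1 t lie in one ball of mass at most 1/4. There the form
    is still at least 1/t, so the average of its logarithm is at least ln t - |ln c1| - 2 (ln t) /
    4. *)
Lemma qpotential_coercive : exists2 K : R, 0 <= K &
  forall a b c, posdef1 a b c -> ln (a + c) / 2 - K <= qpotential nu a b c.
Proof.
have [eta eta0 hball] := small_balls nu0 (ltac:(by lra) : 0 < 1 / 4 :> R).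
(* By [qf_small_dP], any value with 8 c1 <= eta^2 keeps two such lines within eta of each other. *)
pose c1 := eta ^+ 2 / 16.
have c10 : 0 < c1 by rewrite divr_gt0// exprn_gt0.
exists `|ln c1| => // a b c h.
set t := a + c; have t2 : 2 <= t := tr_ge2 h.
have t0 : 0 < t by lra.
pose G := [set y | qf a b c y <= c1 * t].
have mG : measurable G by exact: measurable_qf_le.
have nG : fine (nu G) <= 1 / 4.
  rewrite -lee_fin fineK ?fin_num_measure//.
  have [[y0 Gy0]|] := pselect (G !=set0); last first.
    by move=> /set0P/negP/negPn/eqP ->; rewrite measure0 lee_fin; lra.
  apply: le_trans (hball y0); apply: le_measure; rewrite ?inE//; first exact: measurable_dP_ball.
  move=> z Gz; rewrite /dP_ball /= -(@ler_pXn2r _ 2) ?nnegrE ?dP_ge0 ?(ltW eta0)//.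
  have := qf_small_dP y0 z h; rewrite -/t => h1.
  have h2 : 4 * (qf a b c y0 + qf a b c z) <= t * (8 * c1).
    by rewrite /G /= in Gy0 Gz; lra.
  have := le_trans h1 h2; rewrite ler_pM2l// => /le_trans; apply.
  by rewrite /c1; have := sqr_ge0 eta; lra.
have lt0 : 0 <= ln t by rewrite ln_ge0//; lra.
apply: (@le_trans _ _ (\int[nu]_y ((ln t - `|ln c1|) - 2 * ln t * \1_G y))).
  have iG : nu.-integrable setT (EFin \o (\1_G : projline R -> R)) by exact: integrable_indic.
  rewrite RintegralB//; last 2 first.
  - exact: finite_measure_integrable_cst.
  - exact: (integrableZl measurableT (2 * ln t) iG).
  rewrite Rintegral_prob_cst RintegralZl// Rintegral_indic//.
  have : 2 * ln t * fine (nu G) <= 2 * ln t * (1 / 4) by rewrite ler_wpM2l// mulr_ge0.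
  lra.
apply: le_Rintegral => //.
- have iG : nu.-integrable setT (EFin \o (\1_G : projline R -> R)) by exact: integrable_indic.
  have iC : nu.-integrable setT (EFin \o cst (ln t - `|ln c1|)) by exact: finite_measure_integrable_cst.
  exact: (integrableB measurableT iC (integrableZl measurableT (2 * ln t) iG)).
- exact: integrable_ln_qf.
move=> y _; rewrite indicE; case: (boolP (y \in G)) => [yG|].
  rewrite mulr1; have := ln_qf_le y h; rewrite -/t ler_norml => /andP[+ _].
  by have := normr_ge0 (ln c1); lra.
rewrite notin_setE /G /= => /negP; rewrite -ltNge mulr0 subr0 => hy.
have : ln (c1 * t) <= ln (qf a b c y).
  by rewrite ler_ln ?posrE ?mulr_gt0 ?qf_gt0// ltW.
rewrite lnM ?posrE//; have := ler_norm (- ln c1); rewrite normrN; lra.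
Qed.

(** Unimodular forms are parametrised by the half plane of pairs (a, b) with a > 0, so that the
    minimum can be sought in a compact box. *)
Let comp_c (p : R * R) := (1 + p.2 ^+ 2) / p.1.

Lemma posdef1_comp (p : R * R) : 0 < p.1 -> posdef1 p.1 p.2 (comp_c p).
Proof. by move=> p0; split => //; rewrite /comp_c; field; rewrite gt_eqF. Qed.

Lemma comp_cE a b c : posdef1 a b c -> c = comp_c (a, b).
Proof.
move=> [a0 h]; rewrite /comp_c /=; apply: (mulfI (lt0r_neq0 a0)).
by rewrite [RHS]mulrC divfK ?gt_eqF//; lra.
Qed.

Lemma qpotential_continuous (p : R * R) : 0 < p.1 ->
  {for p, continuous (fun q : R * R => qpotential nu q.1 q.2 (comp_c q))}.
Proof.
move=> p0; have hp := posdef1_comp p0.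
pose m (q : R * R) := `|q.1 - p.1| + `|q.2 - p.2| *+ 2 + `|comp_c q - comp_c p|.
have fst_c : (fun q : R * R => q.1) @ p --> p.1 by exact: cvg_fst.
have snd_c : (fun q : R * R => q.2) @ p --> p.2 by exact: cvg_snd.
have cm : m q @[q --> p] --> (0 : R).
  have -> : (0 : R) = m p by rewrite /m !subrr normr0 mul0rn !addr0.
  have cc : comp_c q @[q --> p] --> comp_c p.
    apply: cvgM; last by apply: cvgV => //; rewrite gt_eqF.
    apply: cvgD; first exact: cvg_cst.
    exact: (cvgM snd_c snd_c).
  apply: cvgD; first apply: cvgD.
  - by apply: cvg_norm; apply: cvgB => //; exact: cvg_cst.
  - rewrite mulr2n; under eq_fun do rewrite mulr2n.
    by apply: cvgD; apply: cvg_norm; apply: cvgB => //; exact: cvg_cst.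
  - by apply: cvg_norm; apply: cvgB => //; exact: cvg_cst.
set t := p.1 + comp_c p.
have t2 : 2 <= t := tr_ge2 hp.
have t0 : 0 < t by lra.
apply/cvgrPdist_le => e e0.
(* The first bound keeps the nearby forms above 1 / (2 t) on every line, where the logarithm is
   Lipschitz with constant 2 t; the second then yields e. *)
have d0 : 0 < Num.min ((2 * t)^-1) (e / (2 * t)).
  by rewrite lt_min invr_gt0 divr_gt0 ?mulr_gt0.
have near1 : \forall q \near p, 0 < q.1.
  exact: (fst_c _ (lt_nbhsr p0)).
have near2 : \forall q \near p, m q <= Num.min ((2 * t)^-1) (e / (2 * t)).
  move/cvgrPdist_le : cm => /(_ _ d0); apply: filterS => q /=.
  by rewrite sub0r normrN => /(le_trans (ler_norm _)).
near=> q.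
have q0 : 0 < q.1 by near: q.
have hq := posdef1_comp q0.
have mq : m q <= Num.min ((2 * t)^-1) (e / (2 * t)) by near: q.
move: mq; rewrite le_min => /andP[m1 m2].
rewrite -RintegralB//; [|exact: integrable_ln_qf|exact: integrable_ln_qf].
apply: Rintegral_norm_le; first by apply: measurable_funB; exact: measurable_ln_qf.
move=> y; set u := qf _ _ _ y; set v := qf _ _ _ y.
have u0 : 0 < u by exact: qf_gt0.
have v0 : 0 < v by exact: qf_gt0.
have ut : t^-1 <= u by exact: qf_ge_tr.
have uv : `|v - u| <= m q by exact: qf_diff.
have vt : (2 * t)^-1 <= v.
  move: uv; rewrite ler_norml => /andP[h1 _].
  have h2 : t^-1 = 2 * (2 * t)^-1 by rewrite invfM mulrA mulfV ?mul1r// pnatr_eq0.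
  lra.
have bnd (x w : R) : 0 < x -> 0 < w -> (2 * t)^-1 <= w -> `|v - u| = `|x - w| -> ln x - ln w <= e.
  move=> x0 w0 wt xw; apply: (le_trans (ln_sub_le x0 w0)).
  rewrite ler_pdivrMr//; apply: (le_trans (ler_norm _)); rewrite -xw.
  apply: (le_trans uv); apply: (le_trans m2); rewrite ler_wpM2l// ltW//.
have tt : (2 * t)^-1 <= t^-1 by rewrite lef_pV2 ?posrE ?mulr_gt0//; lra.
rewrite ler_norml; apply/andP; split; last by apply: bnd => //; exact: distrC.
by rewrite lerNl opprB; apply: bnd => //; exact: le_trans ut.
Unshelve. all: by end_near. Qed.

Lemma qpotential_min : exists a b c, posdef1 a b c /\
  forall a' b' c', posdef1 a' b' c' -> qpotential nu a b c <= qpotential nu a' b' c'.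
Proof.
have [K K0 hK] := qpotential_coercive.
have id1 : posdef1 1 0 (comp_c (1, 0)) by exact: (@posdef1_comp (1, 0) ltr01).
have c1 : comp_c (1, 0) = 1 by rewrite /comp_c /= expr0n addr0 divr1.
have B1 : qpotential nu 1 0 1 = 0.
  rewrite -[RHS](Rintegral_prob_cst nu); apply: eq_Rintegral => y _.
  by rewrite /qf mul0r mul0rn addr0 !mul1r pxy1 ln1.
(* By coercivity a form of trace above T has positive potential and cannot compete with the identity
   form, whose potential is 0. *)
pose T := expR (2 * K + 1).
have T1 : 1 <= T by rewrite -expR0 ler_expR; lra.
have T0 : 0 < T := expR_gt0 _.
have tT a b c : posdef1 a b c -> qpotential nu a b c <= 0 -> a + c <= T.
  move=> h hB; have := hK _ _ _ h => h1.
  have t2 := tr_ge2 h.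
  rewrite -ler_ln ?posrE//; last by lra.
  by rewrite /T expRK; lra.
pose A := `[T^-1, T] `*` `[- T, T] : set (R * R).
have Abox a b c : posdef1 a b c -> a + c <= T -> A (a, b).
  move=> h ht; have c0 := posdef1_c h; case: h => a0 h.
  have b2 : b ^+ 2 <= T ^+ 2 by nra.
  have : `|b| <= T by rewrite -(@ler_pXn2r _ 2) ?nnegrE ?(ltW T0)// -normrX ger0_norm ?sqr_ge0.
  rewrite ler_norml => /andP[b1 b3].
  have aT : T^-1 <= a.
    rewrite -(ler_pM2l T0) mulfV ?gt_eqF//; have := sqr_ge0 b; nra.
  by split; rewrite /= in_itv /= ?aT ?b1 ?b3//; lra.
have A0 : A !=set0 by exists (1, 0); apply: (Abox _ _ _ id1); rewrite c1; have := tT _ _ _ id1; rewrite c1 B1; apply.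
have cA : compact A by apply: compact_setX; exact: segment_compact.
have Ap q : A q -> 0 < q.1.
  by move=> [/=]; rewrite in_itv /= => /andP[h _] _; rewrite (lt_le_trans _ h)// invr_gt0.
have [p pA hp] := @compact_EVT_min _ R (fun q : R * R => qpotential nu q.1 q.2 (comp_c q)) A A0 cA
  (continuous_in_subspaceT (fun q qA => qpotential_continuous (Ap q (set_mem qA)))).
exists p.1, p.2, (comp_c p); split; first by apply: posdef1_comp; apply: Ap; exact: set_mem.
move=> a b c h; have [hB|/ltW hB] := leP (qpotential nu a b c) 0.
  have := hp (a, b); rewrite /= -(comp_cE h); apply; apply/mem_set.
  by apply: (Abox _ _ _ h); exact: tT hB.
apply: le_trans hB; have := hp (1, 0); rewrite /= c1 B1; apply; apply/mem_set.
by apply: (Abox _ _ _ id1); apply: (tT _ _ _ id1); rewrite c1 B1.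
Qed.

End coercive_potential.

(** * Uniqueness of the minimising form *)

Section furstenberg_positivity.
Variable R : realType.
Variables (mu : probability (SL2 R) R) (nu : probability (projline R) R).
Hypothesis nu0 : forall z, nu [set z] = 0%E.
Implicit Types (a b c : R) (y z : projline R) (g : SL2 R).

Let binary (A B C : R) y := A * px y ^+ 2 + B * (px y * py y) + C * py y ^+ 2.

Lemma measurable_binary A B C : measurable_fun setT (binary A B C).
Proof.
have mi := @measurable_id _ (projline R) setT.
apply: measurable_funD; first apply: measurable_funD; apply: measurable_funM => //.
- exact: (measurable_px2 mi).
- exact: (measurable_pxy mi).
- exact: (measurable_py2 mi).
Qed.

Lemma measurable_binary_zero A B C : measurable [set y | binary A B C y = 0].
Proof.
have mb := measurable_binary A B C; have m0 := @measurable_cst _ _ (projline R) R setT 0.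
rewrite (_ : [set y | _] = [set y | binary A B C y <= 0] `&` [set y | 0 <= binary A B C y]).
  by apply: measurableI; exact: measurable_set_le.
apply/seteqP; split => y /=; first by move=> ->.
by move=> [h1 h2]; apply/eqP; rewrite eq_le h1 h2.
Qed.

(** In the basis given by y0 and y1 only the mixed term F survives, and the third zero kills it. *)
Let binary_three_zeros A B C y0 y1 y2 : y0 <> y1 -> y2 <> y0 -> y2 <> y1 ->
  binary A B C y0 = 0 -> binary A B C y1 = 0 -> binary A B C y2 = 0 ->
  [/\ A = 0, B = 0 & C = 0].
Proof.
move=> h01 h20 h21 z0 z1 z2.
have wd0 (u v : projline R) : u <> v -> wd u v != 0.
  by move=> uv; apply/eqP => h; apply: uv; apply: dP_eq0; rewrite dPE h normr0.
pose F := A * (px y0 * px y1) + B * (px y0 * py y1 + py y0 * px y1) / 2 + C * (py y0 * py y1).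
have e (X Y : R) : wd y0 y1 ^+ 2 * (A * X ^+ 2 + B * (X * Y) + C * Y ^+ 2) =
    (X * py y1 - Y * px y1) ^+ 2 * binary A B C y0
    - 2 * (X * py y1 - Y * px y1) * (X * py y0 - Y * px y0) * F
    + (X * py y0 - Y * px y0) ^+ 2 * binary A B C y1.
  by rewrite /F /binary /wd; field.
have F0 : F = 0.
  have := e (px y2) (py y2); rewrite -/(binary A B C y2) z0 z1 z2 !mulr0 add0r addr0 => /eqP.
  rewrite eq_sym oppr_eq0 !mulf_eq0 pnatr_eq0 /=.
  rewrite -/(wd y2 y1) -/(wd y2 y0) (negbTE (wd0 _ _ h21)) (negbTE (wd0 _ _ h20)) /=.
  by move/eqP.
have e' X Y : A * X ^+ 2 + B * (X * Y) + C * Y ^+ 2 = 0.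
  have := e X Y; rewrite z0 z1 F0 !mulr0 subr0 addr0 => /eqP.
  by rewrite mulf_eq0 sqrf_eq0 (negbTE (wd0 _ _ h01)) /= => /eqP.
have A0 : A = 0 by have := e' 1 0; lra.
have C0 : C = 0 by have := e' 0 1; lra.
by split => //; have := e' 1 1; lra.
Qed.

Lemma binary_zero_negligible A B C : ~ [/\ A = 0, B = 0 & C = 0] ->
  nu [set y | binary A B C y = 0] = 0%E.
Proof.
move=> h; set Z := [set y | _].
have mZ : measurable Z := measurable_binary_zero A B C.
have [y0 [y1 hZ]] : exists y0 y1, Z `<=` [set y0] `|` [set y1].
  have [[y0 Zy0]|nZ] := pselect (Z !=set0); last first.
    by exists point, point => y Zy; case: nZ; exists y.
  have [[y1 [Zy1 h1]]|n1] := pselect (exists y1, Z y1 /\ y1 <> y0); last first.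
    exists y0, y0 => y Zy; left; apply: contrapT => hy; apply: n1; by exists y.
  exists y0, y1 => y Zy; apply: contrapT => /not_orP[k0 k1].
  by apply: h; apply: (@binary_three_zeros _ _ _ y0 y1 y) => // /esym.
apply/eqP; rewrite eq_le measure_ge0 andbT.
have m1 z : measurable [set z] := measurable_projline1 z.
apply: (@le_trans _ _ (nu ([set y0] `|` [set y1]))).
  by apply: le_measure; rewrite ?inE//; exact: measurableU.
apply: (le_trans (measureU2 _ _ _)) => //.
by rewrite [X in (X + _)%E](nu0 y0) [X in (_ + X)%E](nu0 y1) adde0.
Qed.

Variables a0 b0 c0 : R.
Hypothesis h0 : posdef1 a0 b0 c0.
Hypothesis hmin : forall a b c, posdef1 a b c -> qpotential nu a0 b0 c0 <= qpotential nu a b c.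

(* The geodesic midpoint (Q0 + Q1)/sqrt(det(Q0 + Q1)) of two unimodular forms
   has strictly smaller potential, because D q0 q1 - q0^2 - q1^2 is the square
   of the Jacobian form of the pair, where D = det(Q0 + Q1) - 2. *)
Lemma qpotential_min_unique a1 b1 c1 : posdef1 a1 b1 c1 ->
  qpotential nu a1 b1 c1 = qpotential nu a0 b0 c0 -> [/\ a1 = a0, b1 = b0 & c1 = c0].
Proof.
move=> h1 hq; apply: contrapT => hne.
pose D := a0 * c1 + a1 * c0 - 2 * (b0 * b1).
pose A := a0 * b1 - b0 * a1; pose B := a0 * c1 - a1 * c0; pose C := b0 * c1 - c0 * b1.
have ident y : D * (qf a0 b0 c0 y * qf a1 b1 c1 y) - qf a0 b0 c0 y ^+ 2 - qf a1 b1 c1 y ^+ 2 =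
    binary A B C y ^+ 2.
  case: h0 => _ e0; case: h1 => _ e1.
  rewrite -[X in _ - X - _ = _]mul1r -[X in _ - X * _ - _ = _]e1.
  rewrite -[X in _ - _ - X = _]mul1r -[X in _ - _ - X * _ = _]e0.
  by rewrite /binary /qf /A /B /C /D; ring.
have ABC : ~ [/\ A = 0, B = 0 & C = 0].
  move=> [hA hB hC]; apply: hne; case: h0 => a00 e0; case: h1 => a10 e1.
  have e2 : a0 ^+ 2 = a1 ^+ 2.
    transitivity (a0 ^+ 2 * (a1 * c1 - b1 ^+ 2)); first by rewrite e1 mulr1.
    rewrite -[RHS]mulr1 -[X in _ = _ * X]e0.
    have k1 : a0 * b1 = b0 * a1 by apply/eqP; rewrite -subr_eq0 -/A hA.
    have k2 : a0 * c1 = a1 * c0 by apply/eqP; rewrite -subr_eq0 -/B hB.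
    transitivity (a0 * a1 * (a0 * c1) - (a0 * b1) ^+ 2); first by ring.
    by rewrite k1 k2; ring.
  have e3 : a0 = a1.
    by apply/eqP; rewrite -(@eqrXn2 _ 2) ?e2// ltW.
  have e4 : b1 = b0 by apply: (mulfI (lt0r_neq0 a00)); rewrite mulrC; move: hA; rewrite /A -e3; lra.
  split => //.
  by apply: (mulfI (lt0r_neq0 a00)); rewrite e4 -e3 in e1; lra.
have D2 : 0 < 2 + D.
  have q0 := qf_gt0 point h0; have q1 := qf_gt0 point h1; have := ident point.
  set u := qf _ _ _ _ in q0 *; set v := qf _ _ _ _ in q1 *.
  have := sqr_ge0 (binary A B C point) => k1 k2.
  suff : 0 < D * (u * v) by rewrite pmulr_lgt0 ?mulr_gt0//; lra.
  by have := exprn_gt0 2 q0; have := sqr_ge0 v; lra.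
pose s := Num.sqrt (2 + D).
have s0 : 0 < s by rewrite sqrtr_gt0.
have s2 : s ^+ 2 = 2 + D by rewrite sqr_sqrtr// ltW.
have hm : posdef1 ((a0 + a1) / s) ((b0 + b1) / s) ((c0 + c1) / s).
  case: (h0) => a00 e0; case: (h1) => a10 e1; split; first by rewrite divr_gt0// addr_gt0.
  have -> : (a0 + a1) / s * ((c0 + c1) / s) - ((b0 + b1) / s) ^+ 2 =
    ((a0 * c0 - b0 ^+ 2) + (a1 * c1 - b1 ^+ 2) + D) / s ^+ 2.
    by rewrite /D; field; rewrite gt_eqF.
  by rewrite e0 e1 s2 mulfV// gt_eqF.
pose qm := qf ((a0 + a1) / s) ((b0 + b1) / s) ((c0 + c1) / s).
(* f measures the pointwise gain of the midpoint over its endpoints. It is nonnegative, and positive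
   off the zeros of the Jacobian form, while minimality makes its integral at most 0. *)
pose f y := ln (qf a0 b0 c0 y) + ln (qf a1 b1 c1 y) -
  (ln (qm y) + ln (qm y)).
have qmE y : qm y ^+ 2 * s ^+ 2 =
    qf a0 b0 c0 y ^+ 2 + qf a1 b1 c1 y ^+ 2 + 2 * (qf a0 b0 c0 y * qf a1 b1 c1 y).
  by rewrite /qm /qf; field; rewrite gt_eqF.
have fE y : f y = ln (qf a0 b0 c0 y * qf a1 b1 c1 y) -
    ln (qm y ^+ 2).
  by rewrite /f lnM ?posrE ?qf_gt0// lnXn ?qf_gt0// mulr2n.
have le_q y : qm y ^+ 2 * s ^+ 2 + binary A B C y ^+ 2 =
    qf a0 b0 c0 y * qf a1 b1 c1 y * s ^+ 2.
  by rewrite qmE -ident s2; ring.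
have f0 y : 0 <= f y.
  rewrite fE subr_ge0 ler_ln ?posrE ?exprn_gt0 ?mulr_gt0 ?qf_gt0//.
  rewrite -(@ler_pM2r _ (s ^+ 2)) ?exprn_gt0// -le_q lerDl sqr_ge0//.
have fpos y : binary A B C y != 0 -> 0 < f y.
  move=> hy; rewrite fE subr_gt0 ltr_ln ?posrE ?exprn_gt0 ?mulr_gt0 ?qf_gt0//.
  rewrite -(@ltr_pM2r _ (s ^+ 2)) ?exprn_gt0// -le_q ltrDl.
  by rewrite lt_neqAle eq_sym sqrf_eq0 hy sqr_ge0.
have i0 := integrable_ln_qf nu h0; have i1 := integrable_ln_qf nu h1; have im := integrable_ln_qf nu hm.
have i01 := integrableD measurableT i0 i1; have imm := integrableD measurableT im im.
have mf : measurable_fun setT f.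
  by apply: measurable_funB; apply: measurable_funD; exact: measurable_ln_qf.
have fi : nu.-integrable setT (EFin \o f) := integrableB measurableT i01 imm.
have intf : \int[nu]_y f y <= 0.
  rewrite RintegralB// !RintegralD// -/(qpotential nu a0 b0 c0) -/(qpotential nu a1 b1 c1).
  by rewrite hq; have := hmin hm; rewrite /qpotential; lra.
have intf0 : (\int[nu]_y (f y)%:E)%E = 0%E.
  rewrite -EFin_Rintegral//; congr EFin; apply/eqP; rewrite eq_le intf /=.
  by apply: Rintegral_ge0 => y _; exact: f0.
have := integral_eq0_negligible mf f0 intf0 => n1.
have n2 := binary_zero_negligible ABC.
have : (nu setT <= 0)%E.
  have m1 : measurable [set y | 0 < f y] by exact: measurable_set_lt.
  have m2 : measurable (~` [set y | 0 < f y]) by exact: measurableC.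
  rewrite -(setUv [set y | 0 < f y]) (le_trans (measureU2 _ _ _))//.
  rewrite [X in (X + _)%E]n1 add0e -n2; apply: le_measure; rewrite ?inE//; first exact: measurable_binary_zero.
  by move=> y /= ny; apply: contrapT => /eqP hy; apply: ny; exact: fpos.
by rewrite [X in (X <= _)%E]probability_setT lee_fin ler10.
Qed.

End furstenberg_positivity.

(** * Positivity of the Lyapunov exponent *)

Section lyapunov_exponent.
Variable R : realType.
Variables (mu : probability (SL2 R) R) (nu : probability (projline R) R).
Hypothesis nu0 : forall z, nu [set z] = 0%E.
Hypothesis hprox : proximal mu.
Hypothesis hnu : furstenberg_measure mu nu.
Variable L : R.
Hypothesis L0 : 0 < L.
Hypothesis hL : mu [set g | expR L < snorm g] = 0%E.

Definition lyapunov := \int[mu]_g \int[nu]_y ln (N g y).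

Lemma measurable_int_lnN : measurable_fun setT (fun g : SL2 R => \int[nu]_y ln (N g y)).
Proof.
apply: (@measurable_Rintegral_section _ _ _ _ _ nu (fun z => ln (N z.1 z.2))).
exact: measurable_lnN.
Qed.

Lemma int_lnN_le g : `|\int[nu]_y ln (N g y)| <= ln (snorm g).
Proof.
by apply: Rintegral_norm_le; [exact: measurable_lnN|exact: ln_N_le].
Qed.

Lemma ln_snorm_bound (P : probability (SL2 R) R) (M : R) (f : SL2 R -> R) :
  P [set g | expR M < snorm g] = 0%E -> measurable_fun setT f ->
  (forall g, `|f g| <= ln (snorm g)) -> P [set g | M < `|f g|] = 0%E.
Proof.
move=> hP mf hf; apply/eqP; rewrite eq_le measure_ge0 andbT -hP; apply: le_measure; rewrite ?inE.
- by apply: measurable_set_lt => //; exact: measurableT_comp.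
- exact: (snorm_set_measurable _ (@measurable_id _ _ _)).
- move=> g /= /lt_le_trans => /(_ _ (hf g)).
  by rewrite -ltr_expR lnK// posrE snorm_gt0.
Qed.

Lemma integrable_int_lnN : mu.-integrable setT (EFin \o (fun g => \int[nu]_y ln (N g y))).
Proof.
apply: (@integrable_essentially_bounded _ _ _ _ _ L); first exact: measurable_int_lnN.
by apply: ln_snorm_bound => //; [exact: measurable_int_lnN|exact: int_lnN_le].
Qed.

Lemma pull_continuous (a b c : R) : [/\ continuous (fun g => pull_a g a b c),
  continuous (fun g => pull_b g a b c) & continuous (fun g => pull_c g a b c)].
Proof.
have H i j i' j' : continuous (fun g : SL2 R => g i j * g i' j').
  by move=> g; exact: (cvgM (@SL2_entry_continuous R i j g) (@SL2_entry_continuous R i' j' g)).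
have K (x y z : R) (F G E : SL2 R -> R) : continuous F -> continuous G -> continuous E ->
    continuous (fun g => x * F g + y * G g + z * E g).
  move=> cF cG cE g.
  exact: cvgD (cvgD (cvgM (cvg_cst x) (cF g)) (cvgM (cvg_cst y) (cG g))) (cvgM (cvg_cst z) (cE g)).
split.
- have -> : (fun g => pull_a g a b c) = (fun g : SL2 R => a * (g 0 0 * g 0 0) + (b *+ 2) * (g 0 0 * g 1 0) + c * (g 1 0 * g 1 0)).
    by apply/funext => g; rewrite /pull_a; ring.
  exact: K.
- have -> : (fun g => pull_b g a b c) = (fun g : SL2 R => a * (g 0 0 * g 0 1) + b * (g 0 0 * g 1 1 + g 0 1 * g 1 0) + c * (g 1 0 * g 1 1)).
    by apply/funext => g; rewrite /pull_b; ring.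
  apply: K => // g; exact: cvgD (H 0 0 1 1 g) (H 0 1 1 0 g).
- have -> : (fun g => pull_c g a b c) = (fun g : SL2 R => a * (g 0 1 * g 0 1) + (b *+ 2) * (g 0 1 * g 1 1) + c * (g 1 1 * g 1 1)).
    by apply/funext => g; rewrite /pull_c; ring.
  exact: K.
Qed.

Lemma pull_mul g h (a b c : R) :
  [/\ pull_a (sl2_mul g h) a b c = pull_a h (pull_a g a b c) (pull_b g a b c) (pull_c g a b c),
      pull_b (sl2_mul g h) a b c = pull_b h (pull_a g a b c) (pull_b g a b c) (pull_c g a b c) &
      pull_c (sl2_mul g h) a b c = pull_c h (pull_a g a b c) (pull_b g a b c) (pull_c g a b c)].
Proof.
have [m1 m2 m3 m4] := sl2_mulE g h.
by split; rewrite /pull_a /pull_b /pull_c ?m1 ?m2 ?m3 ?m4; ring.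
Qed.

(* The conformal barycentre Q0 of nu minimises the potential; averaging the
   cocycle identity gives E B(g^T Q0 g) = B(Q0) + 2 lyapunov, so lyapunov >= 0
   and equality would make mu-almost every g preserve Q0. *)
Lemma lyapunov_gt0 : 0 < lyapunov.
Proof.
rewrite ltNge; apply/negP => hl.
have [a [b [c [h hmin]]]] := qpotential_min nu0.
pose D g := qpotential nu (pull_a g a b c) (pull_b g a b c) (pull_c g a b c) - qpotential nu a b c.
pose V g := \int[nu]_y ln (qf a b c (act g y)).
have mq : measurable_fun setT (fun z : SL2 R * projline R => ln (qf a b c (act z.1 z.2))).
  apply: (measurableT_comp (@measurable_ln_qf R a b c)); exact: measurable_act.
have mV : measurable_fun setT V by exact: (measurable_Rintegral_section nu mq).
have bV g : `|V g| <= ln (a + c).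
  apply: Rintegral_norm_le => [|y]; last exact: ln_qf_le.
  apply: (measurableT_comp (@measurable_ln_qf R a b c)); exact: measurable_act.
have iV : mu.-integrable setT (EFin \o V) by exact: integrable_prob_bounded mV bV.
have iN := integrable_int_lnN.
have iC : mu.-integrable setT (EFin \o cst (qpotential nu a b c)) by exact: finite_measure_integrable_cst.
have VE : \int[mu]_g V g = qpotential nu a b c.
  rewrite /qpotential (is_law2_Rintegral (@measurable_uncurried_act R) (mu_stationary hnu))//.
    exact: integrable_ln_qf.
  move=> g; apply: (@integrable_prob_bounded _ _ _ nu (fun y => ln (qf a b c (act g y))) (ln (a + c))).
    apply: (measurableT_comp (@measurable_ln_qf R a b c)); exact: measurable_act.
  by move=> y; exact: ln_qf_le.
have DE g : D g = V g + (\int[nu]_y ln (N g y) + \int[nu]_y ln (N g y)) - qpotential nu a b c.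
  by rewrite /D qpotential_pull// mulr2n.
have D0 g : 0 <= D g by rewrite subr_ge0 hmin//; exact: posdef1_pull.
have iNN := integrableD measurableT iN iN.
have iVN := integrableD measurableT iV iNN.
have iD : mu.-integrable setT (EFin \o D).
  have -> : D = (fun g => V g + (\int[nu]_y ln (N g y) + \int[nu]_y ln (N g y)) - qpotential nu a b c).
    exact/funext.
  exact: (integrableB measurableT iVN iC).
have mD : measurable_fun setT D.
  by case/integrableP : iD => /measurable_EFinP.
have intD : \int[mu]_g D g = lyapunov *+ 2.
  under eq_Rintegral do rewrite DE.
  rewrite (RintegralB measurableT iVN iC) (RintegralD measurableT iV iNN) (RintegralD measurableT iN iN) VE Rintegral_prob_cst mulr2n -/lyapunov.
  by rewrite addrAC subrr add0r.
have intD0 : (\int[mu]_g (D g)%:E)%E = 0%E.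
  rewrite -EFin_Rintegral//; congr EFin; apply/eqP; rewrite eq_le intD mulrn_wle0//=.
  by rewrite -intD; apply: Rintegral_ge0 => g _; exact: D0.
have n := integral_eq0_negligible mD D0 intD0.
(* The stabiliser of the barycentre is a closed semigroup of full measure, so it contains the
   proximal element, whose fixed line would then have stretch factor 1. *)
pose S := [set g | pull_a g a b c = a] `&` ([set g | pull_b g a b c = b] `&` [set g | pull_c g a b c = c]).
have [ca cb cc] := pull_continuous a b c.
have cS : closed S.
  apply: closedI; last apply: closedI.
  - by apply: (@closed_comp _ _ (fun g => pull_a g a b c) [set a]); [move=> ? _; exact: ca|exact: closed_eq].
  - by apply: (@closed_comp _ _ (fun g => pull_b g a b c) [set b]); [move=> ? _; exact: cb|exact: closed_eq].
  - by apply: (@closed_comp _ _ (fun g => pull_c g a b c) [set c]); [move=> ? _; exact: cc|exact: closed_eq].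
have [g0 [Sg0 /simple_leading_eigenvalue_fixed_line[y [hy /negP]]]] := hprox; apply.
have : S g0.
  apply: (Smu_sub cS) Sg0.
    move=> g k [e1 [e2 e3]] [e4 [e5 e6]]; have [m1 m2 m3] := pull_mul g k a b c.
    by split; [|split]; rewrite /= ?m1 ?m2 ?m3 e1 e2 e3.
  apply/eqP; rewrite eq_le measure_ge0 andbT -n; apply: le_measure; rewrite ?inE.
  - by apply: measurableC; exact: closed_SL2_measurable.
  - exact: measurable_set_lt.
  - move=> g /= nS; rewrite lt_neqAle D0 andbT; apply/negP => /eqP Dg0; apply: nS.
    have [] := @qpotential_min_unique _ nu nu0 a b c h hmin _ _ _ (posdef1_pull g h).
      by apply/eqP; rewrite -subr_eq0 -/(D g) -Dg0.
    by move=> k1 k2 k3; split; [|split].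
move=> [e1 [e2 e3]]; have := qf_pull g0 a b c y; rewrite e1 e2 e3 hy => e.
apply/eqP/eqP; rewrite -(@eqrXn2 _ 2) ?(ltW (N_gt0 _ _))// expr1n.
by apply/eqP; apply: (mulfI (lt0r_neq0 (qf_gt0 y h))); rewrite -e mulr1.
Qed.

End lyapunov_exponent.

(** * Drift of the inverse walk, uniformly in the starting line *)

Section walk_bounds.
Variable R : realType.
Variables (mu : probability (SL2 R) R) (nu : probability (projline R) R).
Hypothesis nu0 : forall z, nu [set z] = 0%E.
Hypothesis hprox : proximal mu.
Hypothesis hnu : furstenberg_measure mu nu.
Variable L : R.
Hypothesis L0 : 0 < L.
Hypothesis hL : mu [set g | expR L < snorm g] = 0%E.
Implicit Types (g h : SL2 R) (x y z : projline R).

Let mmul := @measurable_uncurried_mul R.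
Let mact := @measurable_uncurried_act R.
Let msn (c : R) : measurable [set g : SL2 R | c < snorm g] := snorm_set_measurable c (@measurable_id _ _ _).

Lemma walk_snorm n : walk mu n [set g | expR (n%:R * L) < snorm g] = 0%E.
Proof.
elim: n => [|n IH].
  rewrite walk0// diracE mul0r expR0.
  by rewrite (_ : (_ \in _) = false)//; apply/negbTE; rewrite notin_setE /= snorm1 ltxx.
rewrite walkS//; apply/eqP; rewrite eq_le; apply/andP; split; last first.
  by apply: integral_ge0 => g _; exact: measure_ge0.
rewrite -hL -[X in (_ <= mu X)%E]setIT -integral_indic//.
apply: ge0_le_integral => //.
- exact: (measurable_law_fun (walk mu n) mmul).
- exact/measurable_EFinP/measurable_indic.
move=> g _; rewrite indicE; case: (boolP (g \in _)) => [_|].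
  by apply: probability_le1; exact: (measurable_law_set mmul g (msn _)).
rewrite notin_setE /= => /negP; rewrite -leNgt => hg; rewrite -[X in (_ <= X)%E]IH.
apply: le_measure; rewrite ?inE//; first exact: (measurable_law_set mmul g (msn _)).
move=> h /= hh; rewrite -(@ltr_pM2l _ (expR L)) ?expR_gt0// -expRD.
rewrite -natr1 mulrDl mul1r addrC in hh; apply: (lt_le_trans hh).
by apply: (le_trans (snorm_mul g h)); rewrite ler_wpM2r// ltW// snorm_gt0.
Qed.

Let Ln n : R := \int[walk mu n]_g \int[nu]_y ln (N g y).

Let integrable_walk_lnN n :
  (walk mu n).-integrable setT (EFin \o (fun g => \int[nu]_y ln (N g y))).
Proof.
apply: (@integrable_essentially_bounded _ _ _ _ _ (n%:R * L)); first exact: measurable_int_lnN.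
by apply: ln_snorm_bound; [exact: walk_snorm|exact: measurable_int_lnN|exact: int_lnN_le].
Qed.

(** The cocycle identity splits the stretch of g h at y into that of g at h y and that of h at y,
    and h y is again nu-distributed. *)
Lemma lyapunov_walk n : Ln n = n%:R * lyapunov mu nu.
Proof.
elim: n => [|n IH].
  rewrite mul0r /Ln /Rintegral.
  rewrite (eq_measure_integral (dirac (sl2_one R))); last by move=> A mA _; exact: walk0.
  rewrite integral_dirac//; last by apply/measurable_EFinP; exact: measurable_int_lnN.
  rewrite diracT mul1e /=.
  rewrite [X in fine X](_ : _ = 0%E)//; apply: integral0_eq => y _.
  by rewrite N1 ln1.
have key g : \int[walk mu n]_h \int[nu]_y ln (N (sl2_mul g h) y) = \int[nu]_y ln (N g y) + Ln n.
  have i1 h : nu.-integrable setT (EFin \o (fun y => ln (N g (act h y)))).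
    apply: (@integrable_prob_bounded _ _ _ _ _ (ln (snorm g))); last by move=> y; exact: ln_N_le.
    by apply: measurable_lnN => //; exact: measurable_act.
  have mF : measurable_fun setT (fun h => \int[nu]_y ln (N g (act h y))).
    have H : measurable_fun setT (fun z : SL2 R * projline R => ln (N g (act z.1 z.2))).
      by apply: measurable_lnN => //; exact: measurable_act.
    exact: (measurable_Rintegral_section nu H).
  have i2 : (walk mu n).-integrable setT (EFin \o (fun h => \int[nu]_y ln (N g (act h y)))).
    apply: (@integrable_prob_bounded _ _ _ _ _ (ln (snorm g))) => //.
    move=> h; apply: Rintegral_norm_le; last by move=> y; exact: ln_N_le.
    by apply: measurable_lnN => //; exact: measurable_act.
  rewrite (is_law2_Rintegral mact (walk_stationary hnu n) (integrable_lnN nu g) i1).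
  transitivity (\int[walk mu n]_h (\int[nu]_y ln (N g (act h y)) + \int[nu]_y ln (N h y))); last first.
    exact: (RintegralD measurableT i2 (integrable_walk_lnN n)).
  apply: eq_Rintegral => h _.
  rewrite -RintegralD//; last exact: integrable_lnN.
  by apply: eq_Rintegral => y _; rewrite N_mul lnM ?posrE ?N_gt0.
rewrite /Ln (is_law2_Rintegral mmul (@walkS _ mu n))//; last first.
  move=> g.
  have mF : measurable_fun setT (fun h => \int[nu]_y ln (N (sl2_mul g h) y)).
    have H : measurable_fun setT (fun z : SL2 R * projline R => ln (N (sl2_mul g z.1) z.2)).
      by apply: measurable_lnN => //; exact: measurable_sl2_mul.
    exact: (measurable_Rintegral_section nu H).
  apply: (@integrable_essentially_bounded _ _ _ _ _ (ln (snorm g) + n%:R * L)) => //.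
  apply/eqP; rewrite eq_le measure_ge0 andbT -(walk_snorm n); apply: le_measure; rewrite ?inE//.
    by apply: measurable_set_lt => //; exact: measurableT_comp.
  move=> h /= /lt_le_trans => /(_ _ (int_lnN_le nu (sl2_mul g h))).
  have : ln (snorm (sl2_mul g h)) <= ln (snorm g) + ln (snorm h).
    by rewrite -lnM ?posrE ?snorm_gt0// ler_ln ?posrE ?mulr_gt0 ?snorm_gt0// snorm_mul.
  by move=> h1 h2; rewrite -ltr_ln ?posrE ?expR_gt0 ?snorm_gt0// expRK; lra.
under eq_Rintegral do rewrite key.
rewrite RintegralD//; [|exact: (integrable_int_lnN nu hL)|exact: finite_measure_integrable_cst].
by rewrite Rintegral_prob_cst IH -/(lyapunov mu nu) -natr1 mulrDl mul1r addrC.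
Qed.

Lemma N_inv_ge g x y : dP x (act g y) * N g y <= N (sl2_inv g) x.
Proof. by rewrite dP_actl ler_piMl ?dP_le1// ltW// N_gt0. Qed.

Lemma ae_le_Rintegral d (T : measurableType d) (P : probability T R) (f k : T -> R) :
  P.-integrable setT (EFin \o f) -> P.-integrable setT (EFin \o k) ->
  P [set t | k t < f t] = 0%E -> \int[P]_t f t <= \int[P]_t k t.
Proof.
move=> fi ki h.
have mf : measurable_fun setT f by case/integrableP : fi => /measurable_EFinP.
have mk : measurable_fun setT k by case/integrableP : ki => /measurable_EFinP.
have mm : measurable_fun setT (fun t => Num.min (f t) (k t)) by exact: measurable_minr.
have mi : P.-integrable setT (EFin \o (fun t => Num.min (f t) (k t))).
  have si := integrableD measurableT (integrable_abse fi) (integrable_abse ki).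
  apply: le_integrable si => //; first exact/measurable_EFinP.
  move=> t _ /=; rewrite lee_fin [leRHS]ger0_norm ?addr_ge0//.
  by rewrite /Num.min; case: ifP => _; rewrite ?lerDl ?lerDr.
have -> : \int[P]_t f t = \int[P]_t Num.min (f t) (k t).
  congr fine; apply: ae_eq_integral => //; try exact/measurable_EFinP.
  exists [set t | k t < f t]; split => //; first exact: measurable_set_lt.
  move=> t /= /not_implyP[_]; apply: contra_notT; rewrite -leNgt => fk.
  by rewrite min_l.
by apply: le_Rintegral => // t _; rewrite ge_min lexx orbT.
Qed.

Definition lnNV g x := ln (N (sl2_inv g) x).

Lemma measurable_lnNV d (T : measurableType d) (f : T -> SL2 R) x :
  measurable_fun setT f -> measurable_fun setT (fun t => lnNV (f t) x).
Proof. by move=> mf; apply: measurable_lnN => //; exact: measurable_sl2_inv. Qed.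

Lemma lnNV_le g x : `|lnNV g x| <= ln (snorm g).
Proof. by apply: ln_abs_le; rewrite ?N_gt0 ?NV_ge ?NV_le_snorm. Qed.

Lemma integrable_lnNV n x : (walk mu n).-integrable setT (EFin \o (fun g => lnNV g x)).
Proof.
have m := measurable_lnNV x (@measurable_id _ (SL2 R) setT).
apply: (@integrable_essentially_bounded _ _ _ _ _ (n%:R * L)) => //.
by apply: ln_snorm_bound => //; [exact: walk_snorm|move=> g; exact: lnNV_le].
Qed.

(* |g^-1 x| >= d(x, g y) |g y| for every y; integrating over y ~ nu bounds the
   drift of the inverse walk by that of the walk minus a logarithmic potential
   of nu, truncated at depth 2nL. *)
Lemma inverse_drift : exists n : nat, exists2 c : R, 0 < c & (0 < n)%N /\
  forall x, c <= \int[walk mu n]_g lnNV g x.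
Proof.
pose lam := lyapunov mu nu.
have lam0 : 0 < lam by exact: (lyapunov_gt0 nu0 hprox hnu hL).
(* Out of the drift n lam, the lines near x cost 2 T lam / (8 L) = n lam / 4 and the others |ln
   eta1| < n lam / 2. What remains is n lam / 4. *)
have [eta eta0 hball] := small_balls nu0 (ltac:(by rewrite divr_gt0// mulr_gt0) : 0 < lam / (8 * L)).
pose eta1 := Num.min eta 1.
have eta10 : 0 < eta1 by rewrite lt_min eta0 ltr01.
have eta11 : eta1 <= 1 by rewrite ge_min lexx orbT.
pose n := (Num.bound (2 * `|ln eta1| / lam)).+1.
have hn : 2 * `|ln eta1| / lam < n%:R.
  apply: (@lt_trans _ _ (Num.bound (2 * `|ln eta1| / lam))%:R); last by rewrite ltr_nat.
  by apply: archi_boundP; rewrite divr_ge0 ?(ltW lam0)// mulr_ge0.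
have n0 : 0 < n%:R :> R by rewrite ltr0n.
exists n; exists (n%:R * lam / 4); first by rewrite !mulr_gt0// invr_gt0.
split => // x.
pose T := n%:R * L.
have T0 : 0 < T by rewrite mulr_gt0.
(* The cutoff is harmless: if |g| <= e^T, then |g^-1 x| >= 1 / |g| >= e^(-2 T) |g|. *)
pose w y := ln (Num.max (dP x y) (expR (- (2 * T)))).
have mw : measurable_fun setT w.
  apply: (measurableT_comp (@measurable_ln R)); apply: measurable_maxr => //; exact: dP_measurable.
have m0 y : 0 < Num.max (dP x y) (expR (- (2 * T))) by rewrite lt_max expR_gt0 orbT.
have w1 y : - (2 * T) <= w y by rewrite -[leLHS]expRK ler_ln ?posrE ?expR_gt0// le_max lexx orbT.
have w2 y : w y <= 0.
  by rewrite -ln1 ler_ln ?posrE// ge_max dP_le1 -expR0 ler_expR oppr_le0 mulr_ge0// ltW.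
have wb y : `|w y| <= 2 * T by rewrite ler_norml w1 (le_trans (w2 y))// mulr_ge0// ltW.
have iw : nu.-integrable setT (EFin \o w) by exact: integrable_prob_bounded mw wb.
have intw : - (`|ln eta1|) - 2 * T * (lam / (8 * L)) <= \int[nu]_y w y.
  pose G := dP_ball x eta1.
  have mG : measurable G by exact: measurable_dP_ball.
  have nG : fine (nu G) <= lam / (8 * L).
    rewrite -lee_fin fineK ?fin_num_measure//; apply: le_trans (hball x).
    apply: le_measure; rewrite ?inE//; first exact: measurable_dP_ball.
    by apply: dP_ball_sub; rewrite dPxx add0r ge_min lexx.
  have iG : nu.-integrable setT (EFin \o (\1_G : projline R -> R)) by exact: integrable_indic.
  have iC : nu.-integrable setT (EFin \o cst (- `|ln eta1|)) by exact: finite_measure_integrable_cst.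
  have iZ := integrableZl measurableT (2 * T) iG.
  apply: (@le_trans _ _ (\int[nu]_y (- `|ln eta1| - 2 * T * \1_G y))).
    rewrite RintegralB// Rintegral_prob_cst RintegralZl// Rintegral_indic//.
    by rewrite lerD2l lerN2 ler_wpM2l// mulr_ge0// ltW.
  apply: le_Rintegral => //; first exact: (integrableB measurableT iC iZ).
  move=> y _; rewrite indicE; case: (boolP (y \in G)) => [_|].
    by rewrite mulr1; have := w1 y; have := normr_ge0 (ln eta1); lra.
  rewrite notin_setE /G /dP_ball /= => /negP; rewrite -ltNge mulr0 subr0 => hy.
  apply: (@le_trans _ _ (ln eta1)); first by rewrite lerNl -normrN ler_norm.
  by rewrite ler_ln ?posrE// le_max (ltW hy).
have iy g : nu.-integrable setT (EFin \o (fun y => w (act g y))).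
  apply: (@integrable_prob_bounded _ _ _ _ _ (2 * T)); last by move=> y; exact: wb.
  by apply: measurableT_comp => //; exact: measurable_act.
have mV : measurable_fun setT (fun g => \int[nu]_y w (act g y)).
  have H : measurable_fun setT (fun z : SL2 R * projline R => w (act z.1 z.2)).
      by apply: measurableT_comp => //; exact: measurable_act.
    exact: (measurable_Rintegral_section nu H).
have iV : (walk mu n).-integrable setT (EFin \o (fun g => \int[nu]_y w (act g y))).
  apply: (@integrable_prob_bounded _ _ _ _ _ (2 * T)) => // g.
  by apply: Rintegral_norm_le => //; apply: measurableT_comp => //; exact: measurable_act.
have e1 : \int[nu]_y w y = \int[walk mu n]_g \int[nu]_y w (act g y).
  exact: (is_law2_Rintegral mact (walk_stationary hnu n) iw iy).
have : n%:R * lam + \int[nu]_y w y <= \int[walk mu n]_g lnNV g x.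
  rewrite -lyapunov_walk e1 /Ln -RintegralD//; last exact: integrable_walk_lnN.
  apply: ae_le_Rintegral; [exact: (integrableD measurableT (integrable_walk_lnN n) iV)|exact: integrable_lnNV|].
  apply/eqP; rewrite eq_le measure_ge0 andbT -(walk_snorm n); apply: le_measure; rewrite ?inE//.
    apply: measurable_set_lt; first exact: measurable_lnNV.
    by apply: measurable_funD => //; exact: measurable_int_lnN.
  move=> g /=; rewrite !ltNge; apply: contra => hg.
  rewrite -RintegralD//; last exact: integrable_lnN.
  rewrite -[leRHS](Rintegral_prob_cst nu); apply: le_Rintegral => //.
  - exact: (integrableD measurableT (integrable_lnN nu g) (iy g)).
  - exact: finite_measure_integrable_cst.
  move=> y _; rewrite -lnM ?posrE ?N_gt0// ler_ln ?posrE ?mulr_gt0 ?N_gt0//.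
  rewrite mulrC maxr_pMl ?(ltW (N_gt0 _ _))// ge_max N_inv_ge /=.
  apply: le_trans (NV_ge g x).
  apply: (@le_trans _ _ (expR (- (2 * T)) * snorm g)).
    by rewrite ler_pM2l ?expR_gt0// N_le_snorm.
  rewrite -(ler_pM2r (snorm_gt0 g)) mulVf ?gt_eqF ?snorm_gt0//.
  rewrite -[leRHS]expR0 -(addNr (2 * T)) expRD -mulrA ler_pM2l ?expR_gt0//.
  rewrite (_ : 2 * T = T + T) ?expRD; last by rewrite mulr2n mulrDl mul1r.
  by apply: ler_pM => //; rewrite ltW// snorm_gt0.
move=> hmain; apply: (le_trans _ hmain).
have h1 : 2 * T * (lam / (8 * L)) = n%:R * lam / 4.
  by rewrite /T; field; rewrite gt_eqF.
rewrite h1 in intw.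
have h2 : `|ln eta1| < n%:R * lam / 2 by rewrite ltr_pdivrMr// in hn; lra.
move: intw h2; generalize (\int[nu]_y w y) => I; generalize (n%:R * lam) => J; lra.
Qed.

End walk_bounds.

(** * Contraction of a negative power of |g^-1 x|, and the tail of |g| *)

Section contraction.
Variable R : realType.
Variables (mu : probability (SL2 R) R) (nu : probability (projline R) R).
Hypothesis nu0 : forall z, nu [set z] = 0%E.
Hypothesis hprox : proximal mu.
Hypothesis hnu : furstenberg_measure mu nu.
Variable L : R.
Hypothesis L0 : 0 < L.
Hypothesis hL : mu [set g | expR L < snorm g] = 0%E.
Implicit Types (g h : SL2 R) (x y z : projline R).

Let mmul := @measurable_uncurried_mul R.
Let mact := @measurable_uncurried_act R.

Lemma lnNV_mul g h x : lnNV (sl2_mul g h) x = lnNV h (act (sl2_inv g) x) + lnNV g x.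
Proof. by rewrite /lnNV sl2_invM N_mul lnM ?posrE ?N_gt0. Qed.

Lemma expR_le_quad (s : R) : s <= 1 / 2 -> expR s <= 1 + s + 2 * s ^+ 2.
Proof.
move=> s1; have h : 1 - s <= expR (- s) by exact: expR_ge1Dx.
have e : expR s * expR (- s) = 1 by rewrite -expRD subrr expR0.
have p0 := expR_gt0 s.
have : expR s * (1 - s) <= 1 by rewrite -[leRHS]e ler_wpM2l// ltW.
have q0 : 0 < 1 - s by lra.
rewrite -ler_pdivlMr// => /le_trans; apply; rewrite ler_pdivrMr//.
have : 0 <= s ^+ 2 * (1 - 2 * s) by rewrite mulr_ge0 ?sqr_ge0//; lra.
lra.
Qed.

(** The weight |g^-1 x|^(-delta). *)
Definition wt (delta : R) g x := expR (- (delta * lnNV g x)).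

Lemma measurable_wt delta x : measurable_fun setT (fun g => wt delta g x).
Proof.
apply: (measurableT_comp (@measurable_expR R)); apply: measurableT_comp => //.
by apply: measurable_funM => //; exact: measurable_lnNV.
Qed.

Definition walk_wt delta m x := (\int[walk mu m]_g (wt delta g x)%:E)%E.

Lemma walk_wt_ae_le delta m x : 0 <= delta -> (walk_wt delta m x <= (expR (delta * (m%:R * L)))%:E)%E.
Proof.
move=> d0; rewrite -[X in (_ <= X)%E](integral_prob_cst (walk mu m)).
apply: ae_ge0_le_integral => //.
- by move=> g _; rewrite lee_fin expR_ge0.
- by apply/measurable_EFinP; exact: measurable_wt.
exists [set g | expR (m%:R * L) < snorm g]; split.
- exact: (snorm_set_measurable _ (@measurable_id _ _ _)).
- exact: walk_snorm.
move=> g /= /not_implyP[_]; apply: contra_notT; rewrite -leNgt => hg.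
rewrite lee_fin /wt ler_expR -mulrN ler_wpM2l//.
have := lnNV_le g x; rewrite ler_norml => /andP[h _].
rewrite lerNl (le_trans _ h)// lerN2.
by rewrite -[leRHS]expRK ler_ln ?posrE ?snorm_gt0 ?expR_gt0.
Qed.

(** Since (g h)^-1 x = h^-1 (g^-1 x), the weight of g h at x is that of g at x times that of h at
    g^-1 x. *)
Lemma walk_wtD delta m n x : forall K : R, (forall z, walk_wt delta n z <= K%:E)%E ->
  (walk_wt delta (m + n) x <= K%:E * walk_wt delta m x)%E.
Proof.
move=> K hK; have K0 : 0 <= K.
  rewrite -lee_fin; apply: le_trans (hK x); apply: integral_ge0 => g _.
  by rewrite lee_fin expR_ge0.
have mwt z : measurable_fun setT (fun g => (wt delta g z)%:E).
  by apply/measurable_EFinP; exact: measurable_wt.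
have wt0 g z : (0 <= (wt delta g z)%:E)%E by rewrite lee_fin expR_ge0.
rewrite /walk_wt (is_law2_ge0 mmul (@walkD _ mu m n))//.
rewrite -ge0_integralZl//.
have e g : (\int[walk mu n]_h (wt delta (sl2_mul g h) x)%:E =
    (wt delta g x)%:E * walk_wt delta n (act (sl2_inv g) x))%E.
  rewrite /walk_wt -ge0_integralZl//.
  apply: eq_integral => h _; rewrite -EFinM /wt -expRD lnNV_mul; congr (expR _)%:E; ring.
rewrite [X in (X <= _)%E](_ : _ = \int[walk mu m]_g ((wt delta g x)%:E * walk_wt delta n (act (sl2_inv g) x)))%E;
  last by apply: eq_integral => g _; exact: e.
have mI : measurable_fun setT (fun g => (wt delta g x)%:E * walk_wt delta n (act (sl2_inv g) x))%E.
  have -> : (fun g => (wt delta g x)%:E * walk_wt delta n (act (sl2_inv g) x))%E =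
      (fun g => \int[walk mu n]_h (wt delta (sl2_mul g h) x)%:E)%E by apply/funext => g; rewrite e.
  have H : measurable_fun setT (fubini_F (walk mu n) (fun z : SL2 R * SL2 R => (wt delta (sl2_mul z.1 z.2) x)%:E)).
    apply: measurable_fun_fubini_tonelli_F => [|z]; last by rewrite lee_fin expR_ge0.
    apply/measurable_EFinP; apply: (measurableT_comp (@measurable_wt delta x)).
    exact: measurable_sl2_mul.
  exact: H.
apply: ge0_le_integral => //.
- move=> g _; apply: mule_ge0; first by rewrite lee_fin expR_ge0.
  by apply: integral_ge0 => h _; rewrite lee_fin expR_ge0.
- apply: measurable_funeM; by apply/measurable_EFinP; exact: measurable_wt.
- by move=> g _; rewrite muleC lee_wpmul2r// lee_fin expR_ge0.
Qed.

(** With X = ln |g^-1 x|, of mean at least c, the weight is 1 - delta X up to a quadratic error, so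
    the drift wins for small delta. *)
Lemma walk_wt_step : exists n, exists2 delta : R, 0 < delta & (0 < n)%N /\
  exists2 K : R, 0 < K < 1 & forall x, (walk_wt delta n x <= K%:E)%E.
Proof.
have [n [c c0 [n0 hc]]] := inverse_drift nu0 hprox hnu L0 hL.
pose T := n%:R * L.
have T0 : 0 < T by rewrite mulr_gt0// ltr0n.
(* The three bounds give |delta X| <= 1/2, as the expansion requires, a quadratic error of at most
   delta c / 2, and K = 1 - delta c / 2 > 0. *)
pose delta := Num.min ((2 * T)^-1) (Num.min (c / (4 * T ^+ 2)) c^-1).
have d0 : 0 < delta.
  rewrite !lt_min !invr_gt0 c0 andbT; apply/andP; split; first by rewrite mulr_gt0.
  by rewrite divr_gt0// mulr_gt0// exprn_gt0.
have d1 : delta * T <= 1 / 2.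
  have h : delta <= (2 * T)^-1 by rewrite ge_min lexx.
  apply: (le_trans (ler_wpM2r (ltW T0) h)).
  by rewrite invfM -mulrA mulVf ?gt_eqF//; lra.
have d2 : 2 * (delta * T) ^+ 2 <= delta * c / 2.
  have h : delta <= c / (4 * T ^+ 2) by rewrite !ge_min lexx orbT.
  have T2 : 0 < 4 * T ^+ 2 by rewrite mulr_gt0// exprn_gt0.
  rewrite ler_pdivlMr// in h.
  have := ler_wpM2l (ltW d0) h; lra.
have d3 : delta * c <= 1.
  have h : delta <= c^-1 by rewrite !ge_min lexx !orbT.
  by have := ler_wpM2r (ltW c0) h; rewrite mulVf// gt_eqF.
exists n, delta => //; split => //.
exists (1 - delta * c / 2); first by have := mulr_gt0 d0 c0; lra.
move=> x.
have iN := integrable_lnNV hL n x.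
have iC : (walk mu n).-integrable setT (EFin \o cst (1 + delta * c / 2)) by exact: finite_measure_integrable_cst.
have iZ := integrableZl measurableT delta iN.
have iB := integrableB measurableT iC iZ.
have mw := @measurable_wt delta x.
have b1 g : snorm g <= expR T -> `|delta * lnNV g x| <= delta * T.
  move=> hg; rewrite normrM gtr0_norm// ler_wpM2l// ?(ltW d0)//.
  apply: (le_trans (lnNV_le g x)).
  by rewrite -[leRHS]expRK ler_ln ?posrE ?snorm_gt0 ?expR_gt0.
have iw : (walk mu n).-integrable setT (EFin \o (fun g => wt delta g x)).
  apply: (@integrable_essentially_bounded _ _ _ _ _ (expR (delta * T))) => //.
  apply/eqP; rewrite eq_le measure_ge0 andbT -(walk_snorm hL n); apply: le_measure; rewrite ?inE.
  - by apply: measurable_set_lt => //; exact: measurableT_comp.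
  - exact: (snorm_set_measurable _ (@measurable_id _ _ _)).
  move=> g /=; rewrite !ltNge; apply: contra => /b1; rewrite ler_norml => /andP[h _].
  by rewrite ger0_norm ?expR_ge0// ler_expR lerNl.
rewrite /walk_wt -EFin_Rintegral// lee_fin.
apply: (@le_trans _ _ (\int[walk mu n]_g (1 + delta * c / 2 - delta * lnNV g x))).
  apply: ae_le_Rintegral => //.
  apply/eqP; rewrite eq_le measure_ge0 andbT -(walk_snorm hL n); apply: le_measure; rewrite ?inE.
  - apply: measurable_set_lt => //; apply: measurable_funB => //; apply: measurable_funM => //.
    exact: measurable_lnNV.
  - exact: (snorm_set_measurable _ (@measurable_id _ _ _)).
  move=> g /=; rewrite !ltNge; apply: contra => /b1 hb.
  have hs : - (delta * lnNV g x) <= 1 / 2.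
    by rewrite (le_trans _ d1)// (le_trans _ hb)// -normrN ler_norm.
  apply: (le_trans (expR_le_quad hs)).
  have : (- (delta * lnNV g x)) ^+ 2 <= (delta * T) ^+ 2.
    rewrite sqrrN -[leLHS]ger0_norm ?sqr_ge0// normrX.
    by rewrite ler_pXn2r// ?nnegrE// mulr_ge0// ltW.
  move: d2; generalize (delta * lnNV g x) => u; generalize (delta * c) => v; lra.
rewrite RintegralB// Rintegral_prob_cst RintegralZl//.
have h := ler_wpM2l (ltW d0) (hc x).
apply: (@le_trans _ _ (1 + delta * c / 2 - delta * c)); first by rewrite lerD2l lerN2.
by generalize (delta * c) => u; lra.
Qed.

Lemma walk_contraction : exists delta C gamma : R, [/\ 0 < delta, 0 < C, 0 < gamma &
  forall m x, (walk_wt delta m x <= (C * expR (- (gamma * m%:R)))%:E)%E].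
Proof.
have [n [delta d0 [n0 [K /andP[K0 K1] hK]]]] := walk_wt_step.
have n0' : 0 < n%:R :> R by rewrite ltr0n.
pose gamma := - ln K / n%:R.
have g0 : 0 < gamma by rewrite divr_gt0// oppr_gt0 ln_lt0// K0.
(* C absorbs the trivial bound e^(delta m L) for the fewer than n steps left over after division by
   n. *)
pose C := expR ((delta * L + gamma) * n%:R).
exists delta, C, gamma; split => //; first exact: expR_gt0.
elim/ltn_ind => m IH x.
have [mn|nm] := ltnP m n.
  apply: (le_trans (walk_wt_ae_le m x (ltW d0))).
  rewrite lee_fin /C -expRD ler_expR -subr_ge0.
  rewrite [leRHS](_ : _ = (delta * L + gamma) * (n%:R - m%:R)); last by ring.
  apply: mulr_ge0; last by rewrite subr_ge0 ler_nat ltnW.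
  by rewrite addr_ge0 ?(ltW g0)// mulr_ge0 ?(ltW d0) ?(ltW L0).
rewrite -(subnK nm); apply: (le_trans (walk_wtD _ _ hK)).
apply: (@le_trans _ _ (K%:E * (C * expR (- (gamma * (m - n)%:R)))%:E)%E).
  apply: lee_wpmul2l; first by rewrite lee_fin ltW.
  by apply: IH; rewrite ltn_subrL n0 (leq_trans n0).
rewrite -EFinM lee_fin mulrCA ler_pM2l ?expR_gt0//.
rewrite -[K in leLHS]lnK ?posrE// -expRD ler_expR natrD.
have -> : ln K = - (gamma * n%:R) by rewrite /gamma mulfVK ?opprK// gt_eqF.
lra.
Qed.

(** Markov's inequality: where |g| <= e^(c m) the weight is at least e^(-delta c m), and c = gamma /
    (2 delta) spends half of the decay rate. *)
Lemma snorm_tail : exists c C gamma : R, [/\ 0 < c, 0 < C, 0 < gamma &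
  forall m, (walk mu m [set g | (snorm g <= expR (c * m%:R))%R] <= (C * expR (- (gamma * m%:R)))%:E)%E].
Proof.
have [delta [C [gamma [d0 C0 g0 h]]]] := walk_contraction.
pose c := gamma / (2 * delta).
exists c, C, (gamma / 2); split => //; [by rewrite divr_gt0// mulr_gt0|by rewrite divr_gt0|move=> m].
set A := [set g | _].
have mA : measurable A by apply: measurable_set_le => //; exact: snorm_measurable.
have := h m point; set k := expR (- (delta * (c * m%:R))) => hm.
have k0 : 0 < k by exact: expR_gt0.
have : (k%:E * walk mu m A <= (C * expR (- (gamma * m%:R)))%:E)%E.
  apply: le_trans hm; rewrite -[A in walk mu m A]setIT -integral_indic// -ge0_integralZl//; last 2 first.
  - exact/measurable_EFinP/measurable_indic.
  - by rewrite lee_fin ltW.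
  apply: ge0_le_integral => //.
  - by move=> g _; rewrite -EFinM lee_fin mulr_ge0// ltW.
  - by apply: measurable_funeM; exact/measurable_EFinP/measurable_indic.
  - by apply/measurable_EFinP; exact: measurable_wt.
  move=> g _; rewrite -EFinM lee_fin indicE; case: (boolP (g \in A)) => [|_]; last by rewrite mulr0 expR_ge0.
  rewrite inE /A /= => hg; rewrite mulr1 ler_expR lerN2 ler_wpM2l ?(ltW d0)//.
  apply: (le_trans (ler_norm _)); apply: (le_trans (lnNV_le _ _)).
  by rewrite -[leRHS]expRK ler_ln ?posrE ?snorm_gt0 ?expR_gt0.
have -> : walk mu m A = (fine (walk mu m A))%:E by rewrite fineK// fin_num_measure.
rewrite -EFinM !lee_fin.
move=> hA; rewrite -(ler_pM2l k0); apply: (le_trans hA).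
rewrite mulrCA ler_pM2l// -expRD ler_expR /c.
have -> : delta * (gamma / (2 * delta) * m%:R) = gamma / 2 * m%:R by field; rewrite gt_eqF.
by generalize (m%:R : R) => u; lra.
Qed.

End contraction.

(** * Hoelder regularity of the stationary measure *)

Section hoelder_regularity.
Variable R : realType.
Implicit Types (g h : SL2 R) (x y z w : projline R).

Lemma N_dP_le h x w (K : R) : (forall z, N h z <= K) -> N h x <= N h w + dP x w * K.
Proof.
move=> hK.
have [|m [c [c0 c1 c2]]] := @exists_line R (- py w) (px w).
  by rewrite sqrrN addrC pxy1 oner_neq0.
rewrite sqrrN addrC pxy1 mulr1 in c2.
have e0 : px x = dt x w * px w + wd w x * (- py w).
  by rewrite -[LHS]mulr1 -(pxy1 w) /dt /wd; ring.
have e1 : py x = dt x w * py w + wd w x * px w.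
  by rewrite -[LHS]mulr1 -(pxy1 w) /dt /wd; ring.
have ex : gx h x = dt x w * gx h w + wd w x * (h 0 0 * (- py w) + h 0 1 * px w).
  by rewrite /gx {1}e0 {1}e1; ring.
have ey : gy h x = dt x w * gy h w + wd w x * (h 1 0 * (- py w) + h 1 1 * px w).
  by rewrite /gy {1}e0 {1}e1; ring.
rewrite {1}/N ex ey; apply: (le_trans (minkowski2 _ _ _ _ _ _)).
rewrite -/(N h w) -dPE (dP_sym w) -subr_ge0.
have -> : Num.sqrt ((h 0 0 * - py w + h 0 1 * px w) ^+ 2 + (h 1 0 * - py w + h 1 1 * px w) ^+ 2) = N h m.
  rewrite /N /gx /gy c0 c1; congr Num.sqrt; rewrite -[LHS]mul1r -c2; ring.
rewrite subr_ge0; apply: lerD; first by rewrite ler_piMl ?dt_le1// ltW// N_gt0.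
by rewrite ler_wpM2l ?dP_ge0.
Qed.

(** While r |g|^2 <= 1/2, the stretch of g^-1 at any point of B(x, r) is at least half of its
    stretch at x. *)
Lemma dP_ball_pull g x y (r : R) : dP x (act g y) <= r -> r * snorm g ^+ 2 <= 1 / 2 ->
  dP (act (sl2_inv g) x) y <= 2 * r * N (sl2_inv g) x ^- 2.
Proof.
move=> hr rg.
set n1 := N (sl2_inv g) x; set n2 := N (sl2_inv g) (act g y).
have n10 : 0 < n1 := N_gt0 _ _.
have n20 : 0 < n2 := N_gt0 _ _.
have sg : 0 < snorm g := snorm_gt0 g.
have h1 : n1 <= n2 + r * snorm g.
  apply: (le_trans (N_dP_le x (act g y) (@NV_le_snorm _ g))).
  by rewrite lerD2l ler_wpM2r// ltW.
have h2 : r * snorm g <= n1 / 2.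
  have := NV_ge g x; rewrite -/n1 -(ler_pM2l sg) mulfV ?gt_eqF// => h3.
  rewrite -(ler_pM2l sg); rewrite expr2 in rg; lra.
have n12 : n1 <= 2 * n2 by lra.
have r0 : 0 <= r by exact: le_trans (dP_ge0 _ _) hr.
have := dP_act (sl2_inv g) x (act g y); rewrite actVK -/n1 -/n2 => e.
rewrite -(ler_pM2r (mulr_gt0 n10 n20)) e; apply: (le_trans hr).
have -> : 2 * r * n1 ^- 2 * (n1 * n2) = r * (2 * n2 / n1) by field; rewrite gt_eqF.
by rewrite ler_peMr// ler_pdivlMr// mul1r.
Qed.

Variables (mu : probability (SL2 R) R) (nu : probability (projline R) R).
Hypothesis nu0 : forall z, nu [set z] = 0%E.
Hypothesis hprox : proximal mu.
Hypothesis hnu : furstenberg_measure mu nu.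
Variable L : R.
Hypothesis L0 : 0 < L.
Hypothesis hL : mu [set g | expR L < snorm g] = 0%E.

Let mact := @measurable_uncurried_act R.

(** Pulling the ball back by m steps multiplies A by the mean of 2^s |g^-1 x|^(-2 s), at most 1/2,
    and leaves the additive e unchanged. For radii above r0 the second entry of the maximum makes
    the bound at least 1. *)
Let bound_step (s r0 : R) m : 0 < s -> 0 < r0 -> r0 * expR (m%:R * L) ^+ 2 <= 1 / 2 ->
  (forall x, (2 `^ s)%R%:E * walk_wt mu (2 * s) m x <= (1 / 2)%:E)%E ->
  forall A e : R, 0 <= A -> 0 <= e ->
  (forall x r, 0 < r -> (nu (dP_ball x r) <= (A * r `^ s + e)%:E)%E) ->
  forall x r, 0 < r -> (nu (dP_ball x r) <= (Num.max (A / 2) (r0 `^ (- s)) * r `^ s + e)%:E)%E.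
Proof.
move=> s0 r00 hr0 hw A e A0 e0 hA x r r_gt0.
have [rr|rr] := leP r r0; last first.
  apply: (le_trans (probability_le1 _ (measurable_dP_ball _ _))); rewrite lee_fin.
  have h1 : 1 <= r0 `^ (- s) * r `^ s.
    rewrite powRN mulrC ler_pdivlMr ?powR_gt0// mul1r.
    by apply: ge0_ler_powR; rewrite ?nnegrE ltW.
  apply: (le_trans h1); apply: (@le_trans _ _ (Num.max (A / 2) (r0 `^ (- s)) * r `^ s)); last by rewrite lerDl.
  by rewrite ler_wpM2r ?powR_ge0// le_max lexx orbT.
rewrite (walk_stationary hnu m (measurable_dP_ball x r)).
have mw : measurable_fun setT (fun g => (wt (2 * s) g x)%:E).
  by apply/measurable_EFinP; exact: measurable_wt.
have w0 g : (0 <= (wt (2 * s) g x)%:E)%E by rewrite lee_fin expR_ge0.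
apply: (@le_trans _ _ (\int[walk mu m]_g ((A * 2 `^ s * r `^ s)%:E * (wt (2 * s) g x)%:E + e%:E))%E).
  apply: ae_ge0_le_integral => //.
  - by apply: (measurable_law_fun nu mact); exact: measurable_dP_ball.
  - by move=> g _; rewrite adde_ge0// mule_ge0// lee_fin !mulr_ge0// powR_ge0.
  - by apply: emeasurable_funD => //; exact: measurable_funeM.
  exists [set g | expR (m%:R * L) < snorm g]; split.
  - exact: (snorm_set_measurable _ (@measurable_id _ _ _)).
  - exact: walk_snorm.
  move=> g /= /not_implyP[_]; apply: contra_notT; rewrite -leNgt => hg.
  set rho := 2 * r * N (sl2_inv g) x ^- 2.
  have rho0 : 0 < rho by rewrite !mulr_gt0// invr_gt0 exprn_gt0// N_gt0.
  apply: (@le_trans _ _ (nu (dP_ball (act (sl2_inv g) x) rho))).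
    apply: le_measure; rewrite ?inE; [|exact: measurable_dP_ball|].
      by apply: (measurable_law_set mact g); exact: measurable_dP_ball.
    move=> y hy; apply: dP_ball_pull => //.
    apply: le_trans hr0; apply: ler_pM => //; rewrite ?(ltW r_gt0) ?exprn_ge0 ?(ltW (snorm_gt0 _))//.
    by rewrite ler_pXn2r// ?nnegrE ?expR_ge0 ?(ltW (snorm_gt0 _)).
  apply: (le_trans (hA _ _ rho0)); rewrite -EFinM -EFinD lee_fin lerD2r -!mulrA ler_wpM2l//.
  rewrite /rho !powRM ?invr_ge0 ?exprn_ge0 ?(ltW (N_gt0 _ _)) ?(ltW r_gt0)//; last first.
    by rewrite mulr_ge0// ltW.
  rewrite -mulrA ler_wpM2l ?powR_ge0// ler_wpM2l ?powR_ge0//.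
  rewrite /wt /lnNV /powR gt_eqF ?invr_gt0 ?exprn_gt0 ?N_gt0// ler_expR.
  by rewrite lnV ?posrE ?exprn_gt0 ?N_gt0// lnXn ?N_gt0// mulrN -mulr_natl; lra.
rewrite ge0_integralD//; last 2 first.
- by move=> g _; rewrite mule_ge0// lee_fin !mulr_ge0// powR_ge0.
- exact: measurable_funeM.
rewrite integral_prob_cst ge0_integralZl//; last by rewrite lee_fin !mulr_ge0// powR_ge0.
rewrite EFinD leeD2r//.
apply: (@le_trans _ _ ((A * r `^ s)%:E * (1 / 2)%:E)%E); last first.
  rewrite -EFinM lee_fin mulrAC mul1r ler_wpM2r ?powR_ge0// le_max lexx//.
rewrite [X in (X%:E * _)%E](_ : _ = A * r `^ s * 2 `^ s); last by ring.
rewrite EFinM -muleA lee_wpmul2l//; first by rewrite lee_fin mulr_ge0// powR_ge0.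
exact: hw.
Qed.

Lemma furstenberg_hoelder : exists A s : R, [/\ 0 < A, 0 < s &
  forall x r, 0 < r -> (nu (dP_ball x r) <= (A * r `^ s)%:E)%E].
Proof.
have [delta [C [gamma [d0 C0 g0 hw]]]] := walk_contraction nu0 hprox hnu L0 hL.
(* The pulled-back radius carries |g^-1 x|^-2, so exponent s calls for the weight of power 2 s =
   delta. *)
pose s := delta / 2.
have s0 : 0 < s by rewrite divr_gt0.
have [m hm] : exists m : nat, 2 `^ s * (C * expR (- (gamma * m%:R))) <= 1 / 2.
  pose K := 2 `^ s * C; have K0 : 0 < K by rewrite mulr_gt0// powR_gt0.
  exists (Num.bound (`|ln (2 * K)| / gamma)); set m := (Num.bound _)%:R.
  have hm : `|ln (2 * K)| / gamma < m by apply: archi_boundP; rewrite divr_ge0// ltW.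
  rewrite ltr_pdivrMr// in hm.
  rewrite mulrA -/K ler_pdivlMr// -mulrA mulrC -mulrA -[leRHS]expR0 -(addNr (gamma * m)) expRD.
  rewrite ler_pM2l ?expR_gt0// -[X in X <= _]lnK ?posrE ?mulr_gt0// ler_expR.
  by apply: (le_trans (ler_norm _)); rewrite (mulrC gamma) ltW.
pose r0 := (2 * expR (m%:R * L) ^+ 2)^-1.
have r00 : 0 < r0 by rewrite invr_gt0 mulr_gt0// exprn_gt0// expR_gt0.
have hr0 : r0 * expR (m%:R * L) ^+ 2 <= 1 / 2.
  by rewrite /r0 invfM -mulrA mulVf ?mulr1 ?mul1r// gt_eqF// exprn_gt0// expR_gt0.
have step := @bound_step s r0 m s0 r00 hr0.
have {}step : forall A e : R, 0 <= A -> 0 <= e ->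
  (forall x r, 0 < r -> (nu (dP_ball x r) <= (A * r `^ s + e)%:E)%E) ->
  forall x r, 0 < r -> (nu (dP_ball x r) <= (Num.max (A / 2) (r0 `^ (- s)) * r `^ s + e)%:E)%E.
  apply: step => x; have -> : 2 * s = delta by rewrite /s; lra.
  apply: (le_trans (lee_wpmul2l _ (hw m x))); first by rewrite lee_fin powR_ge0.
  by rewrite -EFinM lee_fin.
exists (r0 `^ (- s)), s; split => //; first exact: powR_gt0.
(* There is no power bound to start from, but [small_balls] gives A0 r^s + e for each e. Halving A0
   repeatedly reaches a constant independent of e, and e is arbitrary. *)
move=> x r r_gt0; apply/lee_addgt0Pr => e e0.
have [eta eta0 hball] := small_balls nu0 e0.
pose A0 := eta `^ (- s).
have A00 : 0 < A0 by exact: powR_gt0.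
have base : forall x r, 0 < r -> (nu (dP_ball x r) <= (A0 * r `^ s + e)%:E)%E.
  move=> y t t0; have [te|te] := leP t eta.
    apply: (@le_trans _ _ e%:E); last by rewrite lee_fin lerDr mulr_ge0 ?powR_ge0.
    apply: le_trans (hball y); apply: le_measure; rewrite ?inE; try exact: measurable_dP_ball.
    by apply: dP_ball_sub; rewrite dPxx add0r.
  apply: (le_trans (probability_le1 _ (measurable_dP_ball _ _))); rewrite lee_fin.
  apply: (@le_trans _ _ (A0 * t `^ s)); last by rewrite lerDl ltW.
  rewrite /A0 powRN mulrC ler_pdivlMr ?powR_gt0// mul1r.
  by apply: ge0_ler_powR; rewrite ?nnegrE ltW.
have iter k : forall x r, 0 < r ->
    (nu (dP_ball x r) <= (Num.max (A0 / 2 ^+ k) (r0 `^ (- s)) * r `^ s + e)%:E)%E.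
  elim: k => [|k IH] y t t0.
    apply: (le_trans (base y t t0)); rewrite lee_fin lerD2r expr0 divr1.
    by rewrite ler_wpM2r ?powR_ge0// le_max lexx.
  apply: (le_trans (step _ _ _ (ltW e0) IH y t t0)).
    by rewrite le_max powR_ge0 orbT.
  rewrite lee_fin lerD2r ler_wpM2r ?powR_ge0// ge_max; apply/andP; split; last first.
    by rewrite le_max lexx orbT.
  rewrite ler_pdivrMr// ge_max; apply/andP; split.
    apply: (@le_trans _ _ (A0 / 2 ^+ k.+1 * 2)); last by rewrite ler_wpM2r// le_max lexx.
    by rewrite [leRHS](_ : _ = A0 / 2 ^+ k)// exprS; field; rewrite expf_neq0.
  apply: (@le_trans _ _ (r0 `^ (- s) * 2)); last by rewrite ler_wpM2r// le_max lexx orbT.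
  by rewrite ler_peMr ?powR_ge0// ler1n.
have [k hk] : exists k : nat, A0 / 2 ^+ k <= r0 `^ (- s).
  exists (Num.bound (A0 / r0 `^ (- s))).
  have h : A0 / r0 `^ (- s) < (Num.bound (A0 / r0 `^ (- s)))%:R.
    by apply: archi_boundP; rewrite divr_ge0// ?powR_ge0// ltW.
  rewrite ler_pdivrMr ?exprn_gt0// mulrC -ler_pdivrMr ?powR_gt0//.
  by apply: (le_trans (ltW h)); rewrite -natrX ler_nat ltnW// ltn_expl.
apply: (le_trans (iter k x r r_gt0)).
by rewrite -EFinD lee_fin lerD2r max_r.
Qed.

End hoelder_regularity.

(** * Mass of a ball through the crossing of a level S *)

Section crossing.
Variable R : realType.
Implicit Types (g h : SL2 R) (x y z b : projline R).
Variables (mu : probability (SL2 R) R) (nu : probability (projline R) R).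
Hypothesis nu0 : forall z, nu [set z] = 0%E.
Hypothesis hnu : furstenberg_measure mu nu.
Variable ups : SL2 R -> projline R.
Hypothesis hups : is_upsilon_plus ups.

Let mmul := @measurable_uncurried_mul R.
Let mact := @measurable_uncurried_act R.
Let mid := @measurable_id _ (SL2 R) setT.

Lemma measurable_N_le g (t : R) : measurable [set y | N g y <= t].
Proof. by apply: measurable_set_le => //; exact: measurable_N. Qed.

(** By [snorm_dP_le], two lines stretched by at most t |g| are within 2 t of each other. *)
Lemma sublevel_mass g (t e : R) : 0 <= e ->
  (forall x, (nu (dP_ball x (2 * t)) <= e%:E)%E) ->
  (nu [set y | (N g y <= t * snorm g)%R] <= e%:E)%E.
Proof.
move=> e0 he; set S := [set y | _].
have [[y0 Sy0]|nS] := pselect (S !=set0); last first.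
  by rewrite (_ : S = set0) ?measure0//; apply/seteqP; split => // y Sy; apply: nS; exists y.
apply: le_trans (he y0); apply: le_measure; rewrite ?inE.
- exact: measurable_N_le.
- exact: measurable_dP_ball.
move=> y Sy; rewrite /dP_ball /= -(ler_pM2l (snorm_gt0 g)).
by apply: (le_trans (snorm_dP_le g y0 y)); rewrite /S /= in Sy0 Sy; lra.
Qed.

Lemma half_mass : exists2 c : R, 0 < c & forall g, (nu [set y | (N g y <= c * snorm g)%R] <= (1 / 2)%:E)%E.
Proof.
have [eta eta0 h] := small_balls nu0 (ltac:(by lra) : 0 < 1 / 2 :> R).
exists (eta / 2); first by rewrite divr_gt0.
by move=> g; apply: sublevel_mass; [lra|move=> x; rewrite mulrC divfK// pnatr_eq0].
Qed.

Lemma dP_ups_act g b (t : R) : 0 < t -> t <= N g b -> dP (ups g) (act g b) <= (t * snorm g)^-1.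
Proof.
move=> t0 ht; have := upsP g b hups => h.
rewrite -(ler_pM2r (mulr_gt0 t0 (snorm_gt0 g))) mulVf ?gt_eqF ?mulr_gt0 ?snorm_gt0//.
apply: le_trans h; rewrite mulrA ler_wpM2r ?(ltW (snorm_gt0 _))//.
by rewrite ler_wpM2l ?dP_ge0.
Qed.

(** It serves twice: to bound the rate function by a Frostman exponent, and in the recursion, to
    trade the probability that [ups h] is near x for the mass of a ball of comparable radius. *)
Lemma ball_lower (c : R) : 0 < c ->
  (forall g, (nu [set y | (N g y <= c * snorm g)%R] <= (1 / 2)%:E)%E) ->
  forall n x (t1 t2 : R) (H : set (SL2 R)), measurable H ->
  (forall h, H h -> dP x (ups h) <= t1 /\ snorm h ^- 2 <= t2) ->
  ((walk mu n H) <= 2%:E * nu (dP_ball x (t1 + t2 / c)))%E.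
Proof.
move=> c0 hc n x t1 t2 H mH hH; set B := dP_ball x _.
have mB : measurable B by exact: measurable_dP_ball.
have half : ((1 / 2)%:E * walk mu n H <= nu B)%E.
  rewrite (walk_stationary hnu n mB) -[H in walk mu n H]setIT -integral_indic// -ge0_integralZl//; last first.
    exact/measurable_EFinP/measurable_indic.
  apply: ge0_le_integral => //.
  - by apply: measurable_funeM; exact/measurable_EFinP/measurable_indic.
  - exact: (measurable_law_fun nu mact).
  move=> h _; rewrite indicE; case: (boolP (h \in H)) => [|_]; last by rewrite mule0 measure_ge0.
  rewrite inE => Hh; have [h1 h2] := hH h Hh; rewrite mule1.
  have mS := measurable_N_le h (c * snorm h).
  apply: (@le_trans _ _ (nu (~` [set y | N h y <= c * snorm h]))).
    rewrite probability_setC//; have := hc h; rewrite probability_fin// -EFinB !lee_fin; lra.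
  apply: le_measure; rewrite ?inE; [exact: measurableC|exact: (measurable_law_set mact h)|].
  move=> y /= /negP; rewrite -ltNge => /ltW hy; rewrite /B /dP_ball /=.
  apply: (le_trans (dP_triangle x (ups h) _)); apply: lerD => //.
  have s0 := snorm_gt0 h.
  apply: (le_trans (dP_ups_act (mulr_gt0 c0 s0) hy)).
  rewrite -mulrA -expr2 invfM mulrC ler_wpM2r// invr_ge0 ltW//.
have := lee_wpmul2l (ltac:(by rewrite lee_fin) : (0 <= 2%:E :> \bar R)%E) half; rewrite muleA -EFinM.
by rewrite (_ : 2 * (1 / 2) = 1 :> R) ?mul1e//; lra.
Qed.

Variable L : R.
Hypothesis L0 : 0 < L.
Hypothesis hL : mu [set g | expR L < snorm g] = 0%E.

Section fixed_ball.
Variables (x : projline R) (r S : R).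
Hypothesis S1 : 1 < S.

(* A nu-random point is h_n b_n for every n, where h_n = g_1 ... g_n and
   b_n = g_(n+1) b_(n+1) is nu-random and independent of h_n. The events follow
   the first time at which N h_n b_n reaches S: one step multiplies this factor
   by at most e^L. *)
Let before := [set z : SL2 R * projline R | dP x (act z.1 z.2) <= r /\ N z.1 z.2 < S].
Let cross := [set z : SL2 R * projline R | dP x (act z.1 z.2) <= r /\ (S <= N z.1 z.2 /\ N z.1 z.2 <= expR L * S)].

Let mdPact : measurable_fun setT (fun z : SL2 R * projline R => dP x (act z.1 z.2)).
Proof. by apply: measurable_dP => //; exact: measurable_act. Qed.

Let mN : measurable_fun setT (fun z : SL2 R * projline R => N z.1 z.2).
Proof. exact: measurable_N. Qed.

Let mbefore : measurable before.
Proof. by apply: measurableI; [exact: measurable_set_le|exact: measurable_set_lt]. Qed.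

Let mcross : measurable cross.
Proof.
by apply: measurableI; [exact: measurable_set_le|apply: measurableI; exact: measurable_set_le].
Qed.

Definition before_mass n := (\int[walk mu n]_h nu [set b | before (h, b)])%E.
Definition cross_mass n := (\int[walk mu n]_h nu [set b | cross (h, b)])%E.

Let mbf := measurable_fun_sections nu mbefore.
Let mcf := measurable_fun_sections nu mcross.

Lemma before_mass0 : before_mass 0 = nu (dP_ball x r).
Proof.
rewrite /before_mass (eq_measure_integral (dirac (sl2_one R))); last by move=> A mA _; exact: walk0.
rewrite integral_dirac// diracT mul1e; congr (nu _); apply/seteqP.
by split => b; rewrite /before /dP_ball /= act1 N1; [case|].
Qed.

(** Writing b = g b' by stationarity leaves the point h b = (h g) b' unchanged, so only the stretch
    factor has to be followed. *)
Lemma before_massS n : (before_mass n <= before_mass n.+1 + cross_mass n.+1)%E.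
Proof.
have lawS : is_law2 (walk mu n) (walk mu 1) (@sl2_mul R) (walk mu n.+1).
  by have := @walkD _ mu n 1; rewrite addn1.
rewrite /before_mass /cross_mass -ge0_integralD//.
have mF : measurable_fun setT (fun h => nu [set b | before (h, b)] + nu [set b | cross (h, b)])%E.
  exact: emeasurable_funD.
rewrite (is_law2_ge0 mmul lawS mF); last by move=> h; exact: adde_ge0.
have mF1 h : measurable_fun setT (fun g => nu [set b | before (sl2_mul h g, b)] + nu [set b | cross (sl2_mul h g, b)])%E.
  have mh : measurable_fun setT (fun g => sl2_mul h g) by exact: measurable_sl2_mul.
  exact: (measurableT_comp mF mh).
apply: ge0_le_integral => //.
- have H : measurable_fun setT (fubini_F (walk mu 1) (fun z : SL2 R * SL2 R =>
      nu [set b | before (sl2_mul z.1 z.2, b)] + nu [set b | cross (sl2_mul z.1 z.2, b)]))%E.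
    apply: measurable_fun_fubini_tonelli_F => [|z]; last exact: adde_ge0.
    exact: (measurableT_comp mF mmul).
  exact: H.
move=> h _.
rewrite (walk_stationary hnu 1 (measurable_section_set h mbefore)).
have mbh : measurable [set b | before (h, b)] := measurable_section_set h mbefore.
apply: ae_ge0_le_integral => //; [exact: (measurable_law_fun nu mact)|by move=> g _; exact: adde_ge0|].
exists [set g | expR L < snorm g]; split.
- exact: (snorm_set_measurable _ mid).
- by apply: (eq_trans (walk1 mu _) hL); exact: (snorm_set_measurable _ mid).
move=> g /= /not_implyP[_]; apply: contra_notT; rewrite -leNgt => hg.
apply: (@le_trans _ _ (nu ([set b | before (sl2_mul h g, b)] `|` [set b | cross (sl2_mul h g, b)]))).
  apply: le_measure; rewrite ?inE.
  - exact: (measurable_law_set mact g mbh).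
  - by apply: measurableU; exact: measurable_section_set.
  move=> b; rewrite /before /cross /= act_mul N_mul => -[h1 h2].
  have [h3|h3] := ltP (N h (act g b) * N g b) S; [left|right]; split => //; split => //.
  rewrite mulrC; apply: ler_pM; rewrite ?(ltW (N_gt0 _ _)) ?(ltW h2)//.
  exact: le_trans (N_le_snorm _ _) hg.
by apply: measureU2; exact: measurable_section_set.
Qed.

Lemma ball_crossing n : (nu (dP_ball x r) <= \sum_(1 <= k < n.+1) cross_mass k + before_mass n)%E.
Proof.
elim: n => [|n IH]; first by rewrite big_nil add0e before_mass0.
apply: (le_trans IH); rewrite [in leRHS]big_nat_recr//= -addeA; apply: leeD => //.
by rewrite addeC; exact: before_massS.
Qed.

(* If |h b| >= S >= r^(-1/2), then h b is within r of ups h, so ups h falls in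
   the ball of radius 2r; and |h| > S' forces b into a set of nu-mass gap. *)
Lemma cross_mass_le n (S' gap : R) : S ^- 2 <= r -> 0 <= gap ->
  (forall h, S' < snorm h -> (nu [set b | (N h b <= expR L * S)%R] <= gap%:E)%E) ->
  (cross_mass n <= walk mu n [set h | [/\ S <= snorm h, snorm h <= S' & dP x (ups h) <= 2 * r]%R]
    + gap%:E * walk mu n [set h | (S <= snorm h)%R /\ (dP x (ups h) <= 2 * r)%R])%E.
Proof.
move=> Sr gap0 hgap.
set H1 := [set h | [/\ _, _ & _]]; set H2 := [set h | _ /\ _].
have ms := @snorm_measurable R.
have mu' : measurable_fun setT (fun h => dP x (ups h)).
  by apply: measurable_dP => //; case: hups.
have mH2 : measurable H2 by apply: measurableI; exact: measurable_set_le.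
have mH1 : measurable H1.
  rewrite (_ : H1 = H2 `&` [set h | snorm h <= S']).
    by apply: measurableI => //; exact: measurable_set_le.
  by apply/seteqP; split => h; [move=> [? ? ?]|move=> [[? ?] ?]].
have indicE' H : measurable H -> walk mu n H = (\int[walk mu n]_h (\1_H h : R)%:E)%E.
  by move=> mH; rewrite integral_indic// setIT.
rewrite /cross_mass (indicE' _ mH1) (indicE' _ mH2).
have m1 : measurable_fun setT (fun h : SL2 R => (\1_H1 h : R)%:E) by exact/measurable_EFinP/measurable_indic.
have m2 : measurable_fun setT (fun h : SL2 R => (\1_H2 h : R)%:E) by exact/measurable_EFinP/measurable_indic.
rewrite -ge0_integralZl// -ge0_integralD//; last 2 first.
- by move=> h _; rewrite mule_ge0.
- exact: measurable_funeM.
apply: ge0_le_integral => //.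
- by apply: emeasurable_funD => //; exact: measurable_funeM.
move=> h _; have mc := measurable_section_set h mcross.
have [Hh|nH] := pselect (H2 h); last first.
  rewrite [X in nu X](_ : _ = set0) ?measure0.
    by apply: adde_ge0 => //; rewrite mule_ge0.
  apply/seteqP; split => b //; rewrite /cross /= => -[h1 [h2 h3]]; apply: nH.
  have hs : S <= snorm h by exact: le_trans (N_le_snorm _ b).
  split => //; apply: (le_trans (dP_triangle x (act h b) _)); rewrite mulr_natl mulr2n lerD// dP_sym.
  have S0 : 0 < S by exact: lt_trans ltr01 S1.
  apply: (le_trans (dP_ups_act S0 h2)); apply: le_trans Sr.
  by rewrite lef_pV2 ?posrE ?mulr_gt0 ?exprn_gt0 ?snorm_gt0// expr2 ler_wpM2l// ltW.
have e2 : \1_H2 h = 1 :> R by rewrite indicE mem_set.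
have [hS|hS] := leP (snorm h) S'.
  have e1 : \1_H1 h = 1 :> R by rewrite indicE mem_set//; case: Hh.
  rewrite e1 e2 mule1; apply: (le_trans (probability_le1 nu mc)).
  by rewrite -EFinD lee_fin lerDl.
rewrite e2 mule1; apply: (le_trans _ (leeDr _ _)); last by rewrite lee_fin.
apply: le_trans (hgap h hS); apply: le_measure; rewrite ?inE//; first exact: measurable_N_le.
by move=> b; rewrite /cross /= => -[_ []].
Qed.

Lemma before_mass_le n (s e : R) : 0 <= e ->
  (forall h, s < snorm h -> (nu [set b | (N h b <= S)%R] <= e%:E)%E) ->
  (before_mass n <= walk mu n [set h | (snorm h <= s)%R] + e%:E)%E.
Proof.
move=> e0 he; set H := [set h | _].
have mH : measurable H by apply: measurable_set_le => //; exact: snorm_measurable.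
have indicE' : walk mu n H = (\int[walk mu n]_h (\1_H h : R)%:E)%E.
  by rewrite integral_indic// setIT.
rewrite /before_mass indicE' -[X in (_ + X)%E](integral_prob_cst (walk mu n)).
have m1 : measurable_fun setT (fun h : SL2 R => (\1_H h : R)%:E) by exact/measurable_EFinP/measurable_indic.
rewrite -ge0_integralD//.
apply: ge0_le_integral => //.
- exact: emeasurable_funD.
move=> h _; have mc := measurable_section_set h mbefore.
have [hs|hs] := leP (snorm h) s.
  rewrite indicE mem_set//; apply: (le_trans (probability_le1 nu mc)).
  by rewrite -EFinD lee_fin lerDl.
apply: (le_trans _ (leeDr _ _)); last by rewrite lee_fin.
apply: le_trans (he h hs); apply: le_measure; rewrite ?inE//; first exact: measurable_N_le.
by move=> b; rewrite /before /= => -[_ /ltW].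
Qed.

End fixed_ball.
End crossing.

(** * Exponential rates and their limits in eps *)

Section exponential_rates.
Local Open Scope ereal_scope.
Variable R : realType.

Lemma limn_esup_ltP (u : (\bar R)^nat) (y : \bar R) : limn_esup u < y ->
  exists n0, forall n, (n0 <= n)%N -> u n < y.
Proof.
move=> /ereal_inf_lt[_ [V [n0 _ hV] <-] hy]; exists n0 => n n0n.
by apply: le_lt_trans hy; apply: ereal_sup_ubound; exists n => //; exact: hV.
Qed.

Lemma limn_esup_le (u : (\bar R)^nat) (y : \bar R) n0 :
  (forall n, (n0 <= n)%N -> u n <= y) -> limn_esup u <= y.
Proof.
move=> h; apply: ge_ereal_inf; exists (ereal_sup (u @` [set n | (n0 <= n)%N])).
  by exists [set n | (n0 <= n)%N] => //; exists n0.
by apply: ge_ereal_sup => _ [n /= hn <-]; exact: h.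
Qed.

Lemma le_limn_esup (u v : (\bar R)^nat) : (forall n, u n <= v n) -> limn_esup u <= limn_esup v.
Proof.
move=> h; apply: le_ereal_inf_tmp => _ [V hV <-]; apply: ge_ereal_inf.
exists (ereal_sup (u @` V)); first by exists V.
by apply: ge_ereal_sup => _ [n Vn <-]; apply: (le_trans (h n)); apply: ereal_sup_ubound; exists n.
Qed.

Lemma lim_at_right_inf (F : R -> \bar R) :
  (forall e e', (0 < e)%R -> (e <= e')%R -> F e <= F e') ->
  lim (F e @[e --> 0%R^'+]) = ereal_inf [set F e | e in [set e : R | (0 < e)%R]].
Proof.
move=> hF; have h := @nondecreasing_at_right_cvge _ F 0%R +oo%O.
rewrite (cvg_lim _ (h _ _))//; last first.
  by move=> e e'; rewrite in_itv /= andbT => e0 _ ee'; exact: hF.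
by congr (ereal_inf (F @` _)); apply/seteqP; split => e /=; rewrite in_itv /= andbT.
Qed.

Lemma lim_at_right_le (F : R -> \bar R) (e : R) :
  (forall e e', (0 < e)%R -> (e <= e')%R -> F e <= F e') -> (0 < e)%R ->
  lim (F e @[e --> 0%R^'+]) <= F e.
Proof. by move=> hF e0; rewrite lim_at_right_inf//; apply: ereal_inf_lbound; exists e. Qed.

Lemma lim_at_right_lt (F : R -> \bar R) y :
  (forall e e', (0 < e)%R -> (e <= e')%R -> F e <= F e') ->
  lim (F e @[e --> 0%R^'+]) < y -> exists2 e : R, (0 < e)%R & F e < y.
Proof. by move=> hF; rewrite lim_at_right_inf// => /ereal_inf_lt[_ [e /= e0 <-] ?]; exists e. Qed.

Definition rate (n : nat) (X : \bar R) := (n%:R^-1)%:E * lne X.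

Lemma rate_mono n X Y : 0 <= X -> X <= Y -> rate n X <= rate n Y.
Proof.
move=> X0 XY; apply: lee_wpmul2l; first by rewrite lee_fin invr_ge0.
by rewrite lee_lne// in_itv /= leey ?X0// (le_trans X0).
Qed.

Lemma rate_expR n (t : R) : (0 < n)%N -> rate n (expR (n%:R * t))%:E = t%:E.
Proof.
move=> n0; rewrite /rate lne_EFin ?expR_gt0// expRK -EFinM mulrA mulVf ?mul1r//.
by rewrite pnatr_eq0 -lt0n.
Qed.

Lemma rate_le n X (t : R) : (0 < n)%N -> 0 <= X -> X <= (expR (n%:R * t))%:E -> rate n X <= t%:E.
Proof. by move=> n0 X0 hX; rewrite -(rate_expR t n0); exact: rate_mono. Qed.

Lemma rate_lt n X (t : R) : (0 < n)%N -> 0 <= X -> rate n X < t%:E -> X <= (expR (n%:R * t))%:E.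
Proof.
move=> n0 X0; rewrite -(rate_expR t n0); apply: contraTT; rewrite -leNgt -ltNge => /ltW h.
by apply: rate_mono => //; rewrite lee_fin expR_ge0.
Qed.

Lemma rate0 n : (0 < n)%N -> rate n 0 = -oo.
Proof.
by move=> n0; rewrite /rate /= lexx gt0_muleNy// lte_fin invr_gt0 ltr0n.
Qed.

Lemma exists_nat_mul_ge (a b : R) : (0 < a)%R -> exists n0 : nat, forall n, (n0 <= n)%N -> (b <= n%:R * a)%R.
Proof.
move=> a0; exists (Num.bound (`|b| / a)) => n hn.
have h : (`|b| / a < (Num.bound (`|b| / a))%:R)%R by apply: archi_boundP; rewrite divr_ge0// ltW.
rewrite (le_trans (ler_norm b))// -ler_pdivrMr// (le_trans (ltW h))// ler_nat//.
Qed.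

End exponential_rates.

(** * Bounds on the rate functions *)

Section rate_functions.
Local Open Scope ereal_scope.
Variable R : realType.
Implicit Types (g h : SL2 R) (x y z : projline R) (alpha eps : R).
Variables (mu : probability (SL2 R) R) (nu : probability (projline R) R).
Variable ups : SL2 R -> projline R.
Hypothesis hups : is_upsilon_plus ups.

Lemma Eset_measurable alpha eps n : measurable (@Eset R alpha eps n).
Proof.
apply: measurable_set_le => //; apply: measurableT_comp => //; apply: measurable_funB => //.
apply: measurable_funM => //; apply: (measurableT_comp (@measurable_ln R)).
exact: snorm_measurable.
Qed.

Lemma starE2_measurable alpha eps n x : measurable (starE2 ups alpha eps n x).
Proof.
apply: measurableI; first exact: Eset_measurable.
by apply: measurable_set_le => //; apply: measurable_dP => //; case: hups.
Qed.

Lemma EsetP alpha eps n g : (0 < n)%N -> Eset alpha eps n g <->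
  (n%:R * (alpha - eps) <= ln (snorm g) <= n%:R * (alpha + eps))%R.
Proof.
move=> n0; have n0' : (0 < n%:R :> R)%R by rewrite ltr0n.
rewrite /Eset /= -/(snorm g) ler_norml -(ler_pM2l n0') -(ler_pM2l n0' (_ - _)%R).
by rewrite mulrBr mulrA mulfV ?gt_eqF// mul1r !mulrBr mulrDr mulrN; split => /andP[h1 h2]; apply/andP; split; lra.
Qed.

Lemma Eset_le alpha eps eps' n : (eps <= eps')%R -> Eset alpha eps n `<=` @Eset R alpha eps' n.
Proof. by move=> h g /= /le_trans; apply. Qed.

(** For alpha >= 0 the radius e^(-n (2 - eps) alpha) grows with eps. This monotonicity turns the
    limit defining [starI2] into an infimum. *)
Lemma starE2_le alpha eps eps' n x : (0 <= alpha)%R -> (eps <= eps')%R ->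
  starE2 ups alpha eps n x `<=` starE2 ups alpha eps' n x.
Proof.
move=> a0 h g [h1 h2]; split; first exact: Eset_le h1.
apply: (le_trans h2); rewrite ler_expR lerN2 ler_wpM2r// ler_wpM2l//; lra.
Qed.

Let Erate alpha eps := limn_esup (fun n => rate n (conv_pow mu n (Eset alpha eps n))).
Let Srate alpha eps := limn_esup (fun n =>
  rate n (ereal_sup (range (fun x => conv_pow mu n (starE2 ups alpha eps n x))))).

Let sup_ge0 alpha eps n : 0 <= ereal_sup (range (fun x => conv_pow mu n (starE2 ups alpha eps n x))).
Proof.
apply: (@le_trans _ _ (conv_pow mu n (starE2 ups alpha eps n point))).
  by rewrite walkE ?measure_ge0//; exact: starE2_measurable.
by apply: ereal_sup_ubound; exists point.
Qed.

Let Erate_mono alpha e e' : (0 < e)%R -> (e <= e')%R -> Erate alpha e <= Erate alpha e'.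
Proof.
move=> _ ee'; apply: le_limn_esup => n; have m1 := Eset_measurable alpha e n.
have m2 := Eset_measurable alpha e' n; apply: rate_mono; rewrite !walkE//.
by apply: le_measure; rewrite ?inE//; exact: Eset_le.
Qed.

Let Srate_mono alpha e e' : (0 <= alpha)%R -> (0 < e)%R -> (e <= e')%R -> Srate alpha e <= Srate alpha e'.
Proof.
move=> a0 _ ee'; apply: le_limn_esup => n; apply: rate_mono; first exact: sup_ge0.
apply: ge_ereal_sup => _ [x _ <-]; apply: (@le_trans _ _ (conv_pow mu n (starE2 ups alpha e' n x))); last first.
  by apply: ereal_sup_ubound; exists x.
have m1 := starE2_measurable alpha e n x; have m2 := starE2_measurable alpha e' n x.
by rewrite !walkE//; apply: le_measure; rewrite ?inE//; exact: starE2_le.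
Qed.

Lemma AsetE alpha : Aset mu alpha = (-oo < lim (Erate alpha e @[e --> 0%R^'+])).
Proof. by []. Qed.

Lemma starI2E alpha : starI2 ups mu alpha = lim (Srate alpha e @[e --> 0%R^'+]).
Proof. by []. Qed.

Lemma starI2_le_rate alpha (eps t : R) n0 : (0 <= alpha)%R -> (0 < eps)%R ->
  (forall n x, (n0 <= n)%N -> walk mu n (starE2 ups alpha eps n x) <= (expR (n%:R * t))%:E) ->
  starI2 ups mu alpha <= t%:E.
Proof.
move=> a0 e0 h; rewrite starI2E.
apply: le_trans (lim_at_right_le (fun e e' => @Srate_mono alpha e e' a0) e0) _.
(* Starting at n0 + 1 excludes n = 0, where the factor 1/n is 0 by convention. *)
apply: (@limn_esup_le _ _ _ n0.+1) => n hn; apply: rate_le; [exact: leq_trans hn|exact: sup_ge0|].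
apply: ge_ereal_sup => _ [x _ <-]; rewrite walkE; last exact: starE2_measurable.
by apply: h; exact: ltnW.
Qed.

Lemma Aset_null alpha (eps : R) : (0 < eps)%R ->
  (forall n, (0 < n)%N -> walk mu n (Eset alpha eps n) = 0) -> ~ Aset mu alpha.
Proof.
move=> e0 h; rewrite AsetE; apply/negP; rewrite -leNgt.
apply: le_trans (lim_at_right_le (@Erate_mono alpha) e0) _.
apply: (@limn_esup_le _ _ _ 1) => n n0; rewrite walkE; last exact: Eset_measurable.
by rewrite h// rate0.
Qed.

Variable L : R.
Hypothesis L0 : (0 < L)%R.
Hypothesis hL : mu [set g | (expR L < snorm g)%R] = 0.

Lemma Aset_range alpha : Aset mu alpha -> (0 <= alpha <= L)%R.
Proof.
move=> ha; apply/andP; split; rewrite leNgt; apply/negP => hlt; move: ha.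
  apply: (@Aset_null _ (- alpha / 2)); first by rewrite divr_gt0// oppr_gt0.
  move=> n n0; rewrite (_ : Eset _ _ _ = set0) ?measure0//; apply/seteqP; split => g //.
  move=> /(EsetP _ _ _ n0)/andP[_]; rewrite leNgt => /negP; apply.
  apply: lt_le_trans (ln_snorm_ge0 g); rewrite pmulr_rlt0 ?ltr0n//; lra.
apply: (@Aset_null _ ((alpha - L) / 2)); first by rewrite divr_gt0// subr_gt0.
move=> n n0; apply/eqP; rewrite eq_le measure_ge0 andbT -(walk_snorm hL n).
apply: le_measure; rewrite ?inE; [exact: Eset_measurable|exact: (snorm_set_measurable _ (@measurable_id _ _ _))|].
move=> g /(EsetP _ _ _ n0)/andP[h _] /=.
rewrite -ltr_ln ?posrE ?expR_gt0 ?snorm_gt0// expRK; apply: lt_le_trans h.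
by rewrite ltr_pM2l ?ltr0n//; lra.
Qed.

Hypothesis nu0 : forall z, nu [set z] = 0.
Hypothesis hnu : furstenberg_measure mu nu.

Lemma frostman_starI2 (C s alpha : R) : (0 < C)%R -> (0 <= s)%R ->
  (forall (r : R) x, (0 < r)%R -> nu (dP_ball x r) <= (C * r `^ s)%:E) ->
  (0 <= alpha)%R -> starI2 ups mu alpha <= (- (2 * s * alpha))%:E.
Proof.
move=> C0 s0 hC a0; have [c c0 hc] := half_mass nu0.
pose K := (1 + c^-1)%R; have K0 : (0 < K)%R by rewrite addr_gt0 ?invr_gt0.
apply/lee_addgt0Pr => e e0.
(* The total loss is eps q = e: eps (2 + alpha) s in the exponent, and one more eps to absorb the
   constant 2 C K^s. *)
pose q := ((2 + alpha) * s + 1)%R.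
have q0 : (0 < q)%R by rewrite ltr_wpDl// mulr_ge0// addr_ge0.
pose eps := (e / q)%R; have eps0 : (0 < eps)%R by rewrite divr_gt0.
have [n0 hn0] := exists_nat_mul_ge (ln (2 * C * K `^ s)) eps0.
rewrite -EFinD; apply: (@starI2_le_rate _ eps _ n0.+1) => // n x hn.
have n_gt0 : (0 < n)%N by exact: leq_trans hn.
(* A common lower bound for the exponents n (2 - eps) alpha, from the distance to [ups], and 2 n
   (alpha - eps), from |g|^-2. *)
pose b := (n%:R * (2 * alpha - eps * (2 + alpha)))%R.
pose t1 := expR (- (n%:R * (2 - eps) * alpha)).
pose t2 := expR (- (2 * (n%:R * (alpha - eps)))).
have t1b : (t1 <= expR (- b))%R.
  rewrite ler_expR lerN2 /b -mulrA ler_wpM2l//; nra.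
have t2b : (t2 <= expR (- b))%R.
  rewrite ler_expR lerN2 /b mulrCA ler_wpM2l//; nra.
have -> : (- (2 * s * alpha) + e = - (2 * alpha - eps * (2 + alpha)) * s + eps)%R.
  have : (eps * q = e)%R by rewrite /eps divfK// gt_eqF.
  by rewrite /q; lra.
apply: (le_trans (ball_lower hnu hups c0 hc n (x := x) (t1 := t1) (t2 := t2)
   (starE2_measurable alpha eps n x) _)).
  move=> g [/(EsetP _ _ _ n_gt0)/andP[h _] hd]; split => //.
  have -> : (snorm g ^- 2 = expR (- (2 * ln (snorm g))))%R.
    by rewrite expRN expRM_natl lnK// posrE snorm_gt0.
  by rewrite ler_expR lerN2 ler_pM2l.
apply: (@le_trans _ _ (2%:E * nu (dP_ball x (K * expR (- b))))).
  apply: lee_wpmul2l; first by rewrite lee_fin.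
  apply: le_measure; rewrite ?inE; try exact: measurable_dP_ball.
  apply: dP_ball_sub; rewrite dPxx add0r /K mulrDl mul1r lerD//.
  by rewrite mulrC ler_wpM2l// invr_ge0 ltW.
have Kb0 : (0 < K * expR (- b))%R by rewrite mulr_gt0// expR_gt0.
apply: (le_trans (lee_wpmul2l _ (hC _ _ Kb0))); first by rewrite lee_fin.
rewrite -EFinM lee_fin powRM ?expR_ge0 ?(ltW K0)//.
have -> : (expR (- b) `^ s = expR (- b * s))%R by rewrite /powR gt_eqF ?expR_gt0// expRK mulrC.
have -> : (2 * (C * (K `^ s * expR (- b * s))) = 2 * C * K `^ s * expR (- b * s))%R by ring.
have k0 : (0 < 2 * C * K `^ s)%R by rewrite !mulr_gt0// powR_gt0.
rewrite -[X in (X * _ <= _)%R]lnK ?posrE// -expRD ler_expR.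
have := hn0 n (ltnW hn); rewrite /b; lra.
Qed.

(** The bound -2 s alpha from a Frostman exponent degenerates as alpha tends to 0; there the tail of
    |g| keeps the rate away from 0. *)
Lemma starI2_small (c C gamma : R) : (0 < c)%R -> (0 < C)%R -> (0 < gamma)%R ->
  (forall m, walk mu m [set g | (snorm g <= expR (c * m%:R))%R] <= (C * expR (- (gamma * m%:R)))%:E) ->
  forall alpha, (0 <= alpha <= c / 2)%R -> starI2 ups mu alpha <= (- (gamma / 2))%:E.
Proof.
move=> c0 C0 g0 h alpha /andP[a0 ac].
have [n0 hn0] := exists_nat_mul_ge (ln C) (ltac:(by rewrite divr_gt0) : 0 < gamma / 2)%R.
apply: (@starI2_le_rate _ (c / 2) _ n0.+1) => //; first by rewrite divr_gt0.
move=> n x hn; have n_gt0 : (0 < n)%N by exact: leq_trans hn.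
apply: (@le_trans _ _ (walk mu n [set g | (snorm g <= expR (c * n%:R))%R])).
  apply: le_measure; rewrite ?inE; first exact: starE2_measurable.
    by apply: measurable_set_le => //; exact: snorm_measurable.
  move=> g [/(EsetP _ _ _ n_gt0)/andP[_ h1] _] /=.
  rewrite -[X in (X <= _)%R]lnK ?posrE ?snorm_gt0// ler_expR (le_trans h1)//.
  by rewrite mulrC ler_wpM2r//; lra.
apply: (le_trans (h n)); rewrite lee_fin -[X in (X * _ <= _)%R]lnK ?posrE// -expRD ler_expR.
by have := hn0 n (ltnW hn); lra.
Qed.

(** Outside [Aset mu], [Eset] alone decays at any prescribed exponential rate once eps is small, so
    the bound extends to all alpha >= 0, as compactness requires. Half of c pays for a strict
    inequality. *)
Lemma starE2_decay (s c : R) : (0 < c)%R ->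
  (forall alpha, Aset mu alpha -> starI2 ups mu alpha + (2 * s * alpha)%:E <= (- c)%:E) ->
  forall alpha, (0 <= alpha)%R -> exists eps, exists2 n0, (0 < eps)%R & forall n x, (n0 <= n)%N ->
    walk mu n (starE2 ups alpha eps n x) <= (expR (- (n%:R * (2 * s * alpha + c / 2))))%:E.
Proof.
move=> c0 h alpha a0; set t := (2 * s * alpha + c / 2)%R.
have [ha|ha] := pselect (Aset mu alpha).
  have h1 : starI2 ups mu alpha < (- t)%:E.
    have := h alpha ha; rewrite -leeBrDr// => /le_lt_trans; apply.
    by rewrite -EFinB lte_fin /t; lra.
  rewrite starI2E in h1.
  have [eps e0 he] := lim_at_right_lt (fun e e' => @Srate_mono alpha e e' a0) h1.
  have [n0 hn0] := limn_esup_ltP he; exists eps, n0.+1 => // n x hn.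
  have n_gt0 : (0 < n)%N by exact: leq_trans hn.
  rewrite -mulrN; apply: le_trans (rate_lt n_gt0 (sup_ge0 _ _ _) (hn0 n (ltnW hn))).
  rewrite -walkE; last exact: starE2_measurable.
  by apply: ereal_sup_ubound; exists x.
have h1 : lim (Erate alpha e @[e --> 0%R^'+]) < (- t)%:E.
  by apply: (@le_lt_trans _ _ -oo); [rewrite leNgt; apply/negP|rewrite ltNyr].
have [eps e0 he] := lim_at_right_lt (@Erate_mono alpha) h1.
have [n0 hn0] := limn_esup_ltP he; exists eps, n0.+1 => // n x hn.
have n_gt0 : (0 < n)%N by exact: leq_trans hn.
have mE := Eset_measurable alpha eps n.
have := hn0 n (ltnW hn); rewrite walkE// => /(rate_lt n_gt0) -/(_ (measure_ge0 _ _)).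
rewrite -mulrN; apply: le_trans; apply: le_measure; rewrite ?inE//; first exact: starE2_measurable.
by move=> g [].
Qed.

End rate_functions.

(** * Uniform decay over a compact range of speeds *)

Section frostman_from_decay.
Variable R : realType.
Implicit Types (g h : SL2 R) (x y z b : projline R).
Variables (mu : probability (SL2 R) R) (nu : probability (projline R) R).
Variable ups : SL2 R -> projline R.
Hypothesis hups : is_upsilon_plus ups.
Variables s c : R.
Hypothesis s0 : 0 <= s.
Hypothesis c0 : 0 < c.
Hypothesis decay : forall alpha, 0 <= alpha -> exists eps, exists2 n0, 0 < eps &
  forall n x, (n0 <= n)%N ->
    (walk mu n (starE2 ups alpha eps n x) <= (expR (- (n%:R * (2 * s * alpha + c))))%:E)%E.

(** The event left by a crossing of S = e^rho, with r = e^(-2 rho), when |h| is not much larger than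
    S. *)
Definition annulus (rho theta : R) x := [set h | [/\ expR rho <= snorm h,
  snorm h <= expR (rho * (1 + theta)) & dP x (ups h) <= 2 * expR (- (2 * rho))]].

Lemma annulus_measurable rho theta x : measurable (annulus rho theta x).
Proof.
have ms := @snorm_measurable R.
have mu' : measurable_fun setT (fun h => dP x (ups h)).
  by apply: measurable_dP => //; case: hups.
rewrite (_ : annulus _ _ _ = ([set h | expR rho <= snorm h] `&` [set h | snorm h <= expR (rho * (1 + theta))]) `&`
    [set h | dP x (ups h) <= 2 * expR (- (2 * rho))]).
  by apply: measurableI; [apply: measurableI|]; exact: measurable_set_le.
by apply/seteqP; split => h; [move=> [? ? ?]|move=> [[? ?] ?]].
Qed.

Let annulus_local (alpha : R) : 0 < alpha -> exists2 delta : R, 0 < delta & exists m0 : nat,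
  forall (alpha' : R) m, `|alpha - alpha'| < delta -> (m0 <= m)%N ->
  forall (rho : R) (k : nat) x, m%:R <= rho -> (0 < k)%N -> rho = k%:R * alpha' ->
  (walk mu k (annulus rho m.+1%:R^-1 x) <= (expR (- (2 * s * rho + k%:R * (c / 2))))%:E)%E.
Proof.
move=> a0; have s0' := s0; have c0' := c0; have [eps [n0 e0 hn0]] := decay (ltW a0).
(* For |alpha' - alpha|: alpha / 2 keeps alpha' comparable to alpha, eps / 2 leaves room for theta
   in the window for |h|, eps alpha / 4 leaves room for the factor 2 in the radius, and the last
   bound costs at most c / 2 in the rate. *)
pose delta := Num.min (Num.min (alpha / 2) (eps / 2)) (Num.min (eps * alpha / 4) (c / (4 * (s + 1)))).
have d1 : delta <= alpha / 2 by rewrite !ge_min lexx.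
have d2 : delta <= eps / 2 by rewrite !ge_min lexx orbT.
have d3 : delta <= eps * alpha / 4 by rewrite !ge_min lexx !orbT.
have s1 : 0 < 4 * (s + 1) by lra.
have d4 : 2 * s * delta <= c / 2.
  have : delta <= c / (4 * (s + 1)) by rewrite !ge_min lexx !orbT.
  rewrite ler_pdivlMr// => h; have : 0 < delta by rewrite !lt_min !divr_gt0// mulr_gt0.
  by lra.
have delta0 : 0 < delta by rewrite !lt_min !divr_gt0// mulr_gt0.
exists delta => //.
have ea : 0 < eps / (4 * alpha) by rewrite divr_gt0// mulr_gt0.
have e4 : 0 < eps / 4 by rewrite divr_gt0.
have a2 : 0 < (2 * alpha)^-1 by rewrite invr_gt0 mulr_gt0.
have [m1 hm1] := exists_nat_mul_ge (1 : R) ea.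
have [m2 hm2] := exists_nat_mul_ge (1 : R) e4.
have [m3 hm3] := exists_nat_mul_ge (n0%:R : R) a2.
exists (maxn m1 (maxn m2 m3)) => alpha' m haa; rewrite !geq_max => /and3P[mm1 mm2 mm3].
move=> rho k x mrho k0 rhoE.
have k0' : 0 < k%:R :> R by rewrite ltr0n.
move: haa; rewrite ltr_norml => /andP[h1 h2].
have a'1 : alpha' < 2 * alpha by lra.
have a'0 : 0 < alpha' by lra.
have km : m%:R * (2 * alpha)^-1 <= k%:R.
  rewrite ler_pdivrMr ?mulr_gt0//; apply: (le_trans mrho); rewrite rhoE.
  by rewrite ler_pM2l// ltW.
have n0k : (n0 <= k)%N by rewrite -(@ler_nat R) (le_trans (hm3 m mm3)).
have keps : 1 <= k%:R * (eps * alpha / 2).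
  have h3 := hm2 m mm2.
  have := ler_wpM2r (ltW (mulr_gt0 e0 a0)) km.
  have -> : m%:R * (2 * alpha)^-1 * (eps * alpha) = 2 * (m%:R * (eps / 4)) by field; rewrite gt_eqF.
  lra.
have theta : m.+1%:R^-1 * (2 * alpha) <= eps / 2.
  have h3 := hm1 m mm1; have m10 : 0 < m.+1%:R :> R by rewrite ltr0n.
  rewrite mulrC ler_pdivrMr//.
  have h4 : m%:R * (eps / (4 * alpha)) * (2 * alpha) = m%:R * (eps / 2) by field; rewrite gt_eqF.
  have h5 := ler_wpM2r (ltW (mulr_gt0 (ltr0n R 2) a0)) h3; rewrite h4 mul1r in h5.
  apply: (le_trans h5); rewrite mulrC ler_wpM2l ?ltW ?divr_gt0//.
  by rewrite ltr_nat.
apply: (@le_trans _ _ (walk mu k (starE2 ups alpha eps k x))).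
  apply: le_measure; rewrite ?inE; [exact: annulus_measurable|exact: starE2_measurable|].
  move=> h [g1 g2 g3]; split.
    apply/(EsetP _ _ _ k0).
    move: g1 g2; rewrite -[snorm h]lnK ?posrE ?snorm_gt0// !ler_expR expRK => g1 g2.
    apply/andP; split.
      apply: le_trans g1; rewrite rhoE ler_pM2l//; lra.
    apply: (le_trans g2); rewrite rhoE -mulrA ler_pM2l// mulrDr mulr1.
    have : alpha' * m.+1%:R^-1 <= eps / 2.
      apply: le_trans theta; rewrite mulrC ler_wpM2l ?invr_ge0// ltW//.
    by move: (alpha' * m.+1%:R^-1) => u hu; lra.
  apply: (le_trans g3).
  apply: (@le_trans _ _ (expR 1 * expR (- (2 * rho)))).
    rewrite ler_pM2r ?expR_gt0//; apply: le_trans (expR_ge1Dx _); lra.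
  rewrite -expRD ler_expR rhoE -subr_ge0.
  have h6 : k%:R * (alpha - alpha') <= k%:R * (eps * alpha / 4) by rewrite ler_wpM2l// ?(ltW k0')//; lra.
  lra.
apply: (le_trans (hn0 k x n0k)); rewrite lee_fin ler_expR lerN2 rhoE -subr_ge0.
have h7 : 2 * s * (alpha' - alpha) <= c / 2.
  apply: le_trans d4; rewrite ler_wpM2l ?mulr_ge0//; lra.
have := ler_wpM2l (ltW k0') h7; lra.
Qed.

(** Each speed rho / k has a neighbourhood with its own eps and threshold, made uniform by
    compactness of [a1, a2]. The single integer m is both the threshold for rho and the source of
    theta = 1 / (m + 1). *)
Lemma annulus_decay (a1 a2 : R) : 0 < a1 -> exists m : nat, forall (rho : R) (k : nat) x,
  m%:R <= rho -> (0 < k)%N -> k%:R * a1 <= rho <= k%:R * a2 ->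
  (walk mu k (annulus rho m.+1%:R^-1 x) <= (expR (- (2 * s * rho + k%:R * (c / 2))))%:E)%E.
Proof.
move=> a10; pose P (m : nat) (alpha : R) := forall (rho : R) (k : nat) x,
  m%:R <= rho -> (0 < k)%N -> rho = k%:R * alpha ->
  (walk mu k (annulus rho m.+1%:R^-1 x) <= (expR (- (2 * s * rho + k%:R * (c / 2))))%:E)%E.
have cK : compact `[a1, a2] by exact: segment_compact.
have /compact_near_coveringP/(_ nat \oo P _) := cK.
have hP : forall a : R, `[a1, a2]%classic a -> \forall a' \near a & i \near \oo, P i a'.
  move=> alpha /=; rewrite in_itv /= => /andP[ha _].
  have a0 : 0 < alpha by exact: lt_le_trans ha.
  have [delta d0 [m0 h]] := annulus_local a0.
  exists ([set a' | `|alpha - a'| < delta], [set m | (m0 <= m)%N]).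
    by split; [exact: nbhsx_ballx|exists m0].
  by move=> [a' m] /= [h1 h2]; exact: h.
move=> /(_ hP)[m _ hm]; exists m => rho k x mrho k0 /andP[k1 k2].
have k0' : 0 < k%:R :> R by rewrite ltr0n.
apply: (hm m (leqnn m) (rho / k%:R)) => //.
  by rewrite /= in_itv /= ler_pdivlMr// ler_pdivrMr// mulrC k1 mulrC.
by rewrite mulrC divfK// gt_eqF.
Qed.

End frostman_from_decay.

(** * Solving the recursion for a power bound *)

Section power_recursion.
Variable R : realType.

Lemma linear_expR_small (a eps : R) : 0 < a -> 0 < eps ->
  exists2 rho1, 0 < rho1 & forall rho, rho1 <= rho -> rho * expR (- (a * rho)) <= eps.
Proof.
(* The threshold comes from e^(a rho) >= (a rho / 2)^2. *)
move=> a0 e0; exists (4 / (a ^+ 2 * eps)); first by rewrite divr_gt0// mulr_gt0// exprn_gt0.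
move=> rho; rewrite ler_pdivrMr ?mulr_gt0 ?exprn_gt0// => hr.
have r0 : 0 < rho.
  rewrite ltNge; apply/negP => r0; move: hr; apply/negP; rewrite -ltNge.
  by apply: (@le_lt_trans _ _ 0) => //; rewrite mulr_le0_ge0// mulr_ge0 ?exprn_ge0// ltW.
rewrite expRN ler_pdivrMr ?expR_gt0//.
have h : (a * rho / 2) ^+ 2 <= expR (a * rho).
  have -> : a * rho = a * rho / 2 + a * rho / 2 by lra.
  have u0 : 0 < a * rho / 2 by rewrite divr_gt0// mulr_gt0.
  have -> : (a * rho / 2 + a * rho / 2) / 2 = a * rho / 2 by lra.
  rewrite expRD expr2; have h1 := expR_ge1Dx (a * rho / 2).
  by apply: ler_pM; rewrite ?(ltW u0)//; lra.
apply: le_trans (ler_wpM2l (ltW e0) h).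
have : 0 <= rho * (rho * (a ^+ 2 * eps) - 4) by rewrite mulr_ge0 ?(ltW r0)//; lra.
nra.
Qed.

(* Unrolling the recursion j times multiplies the contribution of the
   error term by (1/2)^j, so the solution inherits the power r^s. *)
Lemma power_recursion (F : R -> R) (s C1 D r1 : R) : 0 <= s -> 0 < C1 -> 2 <= D -> 0 < r1 ->
  (forall r, 0 < r -> F r <= 1) ->
  (forall r, 0 < r < r1 -> F r <= C1 * r `^ s + F (D * r) / (2 * D `^ s)) ->
  forall r, 0 < r -> F r <= Num.max (2 * C1) (r1 `^ s)^-1 * r `^ s.
Proof.
move=> s0 C10 D2 r10 F1 hF; set A := Num.max _ _.
have D0 : 0 < D by lra.
have A0 : 0 <= A by rewrite le_max ltW// mulr_gt0.
have hlarge r : r1 <= r -> F r <= A * r `^ s.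
  move=> h; have r0 : 0 < r by exact: lt_le_trans h.
  apply: (le_trans (F1 r r0)).
  apply: (@le_trans _ _ (A * r1 `^ s)).
    by rewrite -ler_pdivrMr ?powR_gt0// mul1r le_max lexx orbT.
  by rewrite ler_wpM2l// ge0_ler_powR// nnegrE ltW.
have hj (j : nat) : forall r, 0 < r -> r1 <= r * D ^+ j -> F r <= A * r `^ s.
  elim: j => [|j IH] r r0 hr; first by apply: hlarge; rewrite expr0 mulr1 in hr.
  have [h|h] := leP r1 r; first exact: hlarge.
  have hD := IH (D * r) (mulr_gt0 D0 r0).
  have -> := le_trans (hF r _); rewrite ?r0//.
  have Dr : r1 <= D * r * D ^+ j by rewrite mulrAC -exprS mulrC.
  have p0 : 0 < D `^ s by rewrite powR_gt0.
  have rp : 0 <= r `^ s by rewrite powR_ge0.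
  move: (hD Dr); rewrite powRM ?(ltW D0) ?(ltW r0)// => h3.
  have h4 : F (D * r) / (2 * D `^ s) <= A / 2 * r `^ s.
    rewrite ler_pdivrMr ?mulr_gt0//; apply: (le_trans h3).
    by rewrite (_ : A / 2 * r `^ s * (2 * D `^ s) = A * (D `^ s * r `^ s))//; field.
  have h5 : C1 * r `^ s <= A / 2 * r `^ s.
    rewrite ler_wpM2r// ler_pdivlMr// mulrC; by rewrite le_max lexx.
  lra.
move=> r r0; have [n0 hn] := exists_nat_mul_ge r1 r0.
apply: (hj n0) => //; apply: (le_trans (hn n0 (leqnn _))); rewrite mulrC ler_wpM2l ?(ltW r0)//.
elim: n0 {hn} => [|n IH]; first by rewrite expr0.
rewrite exprS -natr1; have : 1 <= D ^+ n by rewrite exprn_ege1//; lra.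
have := IH; nra.
Qed.

Lemma geometric_sum_le (q : R) n : 0 <= q < 1 -> \sum_(1 <= k < n.+1) q ^+ k <= (1 - q)^-1.
Proof.
move=> /andP[q0 q1]; rewrite -[leRHS]mul1r ler_pdivlMr ?subr_gt0//.
have -> : (\sum_(1 <= k < n.+1) q ^+ k) * (1 - q) = q - q ^+ n.+1.
  elim: n => [|n IH]; first by rewrite big_nil mul0r expr1 subrr.
  by rewrite big_nat_recr//= mulrDl IH (exprS q n.+1); ring.
by have : 0 <= q ^+ n.+1 by [rewrite exprn_ge0|]; lra.
Qed.

End power_recursion.

(** * The Frostman bound from the decay of the rate functions *)

Section frostman_bootstrap.
Variable R : realType.
Implicit Types (g h : SL2 R) (x y z b : projline R).
Variables (mu : probability (SL2 R) R) (nu : probability (projline R) R).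
Hypothesis nu0 : forall z, nu [set z] = 0%E.
Hypothesis hprox : proximal mu.
Hypothesis hnu : furstenberg_measure mu nu.
Variable L : R.
Hypothesis L0 : 0 < L.
Hypothesis hL : mu [set g | expR L < snorm g] = 0%E.
Variable ups : SL2 R -> projline R.
Hypothesis hups : is_upsilon_plus ups.
Variables s c : R.
Hypothesis s0 : 0 <= s.
Hypothesis c0 : 0 < c.
Hypothesis decay : forall alpha, 0 <= alpha -> exists eps, exists2 n0, 0 < eps &
  forall n x, (n0 <= n)%N ->
    (walk mu n (starE2 ups alpha eps n x) <= (expR (- (n%:R * (2 * s * alpha + c))))%:E)%E.

Let sublevel_power (A0 t0 : R) : 0 < A0 ->
  (forall x r, 0 < r -> (nu (dP_ball x r) <= (A0 * r `^ t0)%:E)%E) ->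
  forall h (u v : R), expR v < snorm h ->
  (nu [set b | (N h b <= expR u)%R] <= (A0 * 2 `^ t0 * expR (t0 * (u - v)))%:E)%E.
Proof.
move=> A00 hA h u v hv.
have S0 : [set b | N h b <= expR u] `<=` [set b | N h b <= expR (u - v) * snorm h].
  move=> b /= hb; apply: (le_trans hb); rewrite expRB -mulrA ler_peMr ?expR_ge0//.
  by rewrite mulrC ler_pdivlMr ?expR_gt0// mul1r ltW.
apply: (@le_trans _ _ (nu [set b | N h b <= expR (u - v) * snorm h])).
  by apply: le_measure; rewrite ?inE//; exact: measurable_N_le.
apply: sublevel_mass => [|x]; first by rewrite !mulr_ge0 ?powR_ge0 ?expR_ge0// ltW.
apply: (le_trans (hA x _ _)); first by rewrite mulr_gt0 ?expR_gt0.
rewrite lee_fin powRM ?expR_ge0// mulrA /powR [X in _ * X]ifF ?expRK//.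
by apply/negbTE; rewrite gt_eqF ?expR_gt0.
Qed.

(* Take S = e^rho and let [n] be a large multiple of [rho], so that the walk has
   crossed before time [n]. At each crossing time [k] either |h| <= e^(rho (1 +
   theta)), where the decay hypothesis applies, or |h| is much larger than
   |h b|, which Hoelder regularity makes exponentially unlikely given the ball
   of radius D r. *)
Lemma ball_recursion : exists C1 D rho1 : R, [/\ 0 < C1, 2 <= D, 0 < rho1 &
  forall rho x, rho1 <= rho -> (nu (dP_ball x (expR (- (2 * rho)))) <=
    (C1 * expR (- (2 * s * rho)))%:E + ((2 * D `^ s)^-1)%:E * nu (dP_ball x (D * expR (- (2 * rho)))))%E].
Proof.
have s0' := s0; have c0' := c0; have L0' := L0.
have [A0 [t0 [A00 t00 hA]]] := furstenberg_hoelder nu0 hprox hnu L0 hL.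
have [ct [Ct [gamma [ct0 Ct0 gamma0 htail]]]] := snorm_tail nu0 hprox hnu L0 hL.
have [cc cc0 hcc] := half_mass nu0.
(* The horizon n is about M rho. The first entry brings the tail e^(-gamma n), the second the
   Hoelder bound e^(t0 (rho - ct n)), below e^(-2 s rho). *)
pose M := Num.max (2 * s / gamma) ((2 * s / t0 + 1) / ct).
have M0 : 0 <= M by rewrite le_max divr_ge0// ?mulr_ge0// ltW.
(* For k <= n <= (M + 1) rho the speed rho / k is at least 1 / (M + 1); speeds above L have
   probability 0. *)
have a10 : 0 < (M + 1)^-1 by rewrite invr_gt0; lra.
have [m hm] := annulus_decay hups s0 c0 decay L a10.
pose theta : R := m.+1%:R^-1.
have th0 : 0 < theta by rewrite invr_gt0 ltr0n.
pose q := expR (- (c / 2)).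
have q01 : 0 <= q < 1 by rewrite expR_ge0 -expR0 ltr_expR; lra.
(* From [dP x (ups h) <= 2 * r] and |h|^-2 <= r, [ball_lower] produces the radius 2 r + r / cc = D
   r. *)
pose D := 2 + cc^-1.
have D2 : 2 <= D by rewrite lerDl invr_ge0 ltW.
have Ds : 0 < D `^ s by rewrite powR_gt0; lra.
pose K := A0 * 2 `^ t0.
have K0 : 0 < K by rewrite mulr_gt0 ?powR_gt0.
(* K2 rho e^(-t0 theta rho) bounds the n terms 2 gap together; from rho1 on it is at most 1 / (2
   D^s), as [power_recursion] demands. *)
pose K2 := 2 * (M + 1) * (K * expR (t0 * L)).
have K20 : 0 < K2 by rewrite !mulr_gt0 ?expR_gt0//; lra.
have eps0 : 0 < (K2 * (2 * D `^ s))^-1 by rewrite invr_gt0; apply: mulr_gt0 K20 _; apply: mulr_gt0.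
have [rho1 rho10 hrho1] := linear_expR_small (mulr_gt0 t00 th0) eps0.
exists ((1 - q)^-1 + Ct + K), D, (Num.max rho1 (Num.max 1 m%:R)).
have q1 : 0 < (1 - q)^-1 by case/andP: q01 => _; rewrite invr_gt0; lra.
split => //.
- by rewrite !addr_gt0.
- by rewrite lt_max rho10.
move=> rho x; rewrite !ge_max => /and3P[r1 r2 r3].
pose n := (Num.truncn (M * rho)).+1.
have Mr0 : 0 <= M * rho by rewrite mulr_ge0//; lra.
have nM : M * rho <= n%:R by apply: ltW; exact: truncnS_gt.
have nM1 : n%:R <= (M + 1) * rho.
  have : (Num.truncn (M * rho))%:R <= M * rho by rewrite truncn_le.
  by rewrite /n -natr1; lra.
set r := expR (- (2 * rho)); set B := nu (dP_ball x (D * r)).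
have rE : expR rho ^- 2 = r by rewrite -expRM_natl -expRN.
have S1 : 1 < expR rho by rewrite -expR0 ltr_expR; lra.
pose gap := K * expR (t0 * (L + rho - rho * (1 + theta))).
have gap0 : 0 < gap by rewrite mulr_gt0 ?expR_gt0.
have Bf : (0 <= B)%E by exact: measure_ge0.
have [Br BE] : exists Br : R, B = Br%:E.
  by exists (fine B); exact: (probability_fin nu (measurable_dP_ball x (D * r))).
have B0 : 0 <= Br by rewrite -lee_fin -BE.
have cross k : (1 <= k < n.+1)%N -> (cross_mass mu nu L x r (expR rho) k <=
    (q ^+ k * expR (- (2 * s * rho)) + 2 * gap * Br)%:E)%E.
  move=> /andP[k0 kn].
  apply: (le_trans (cross_mass_le mu hups x S1 k (S' := expR (rho * (1 + theta))) (gap := gap) _ (ltW gap0) _)).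
  - by rewrite rE.
  - move=> h hh; rewrite -expRD; apply: (sublevel_power A00 hA _ hh).
  rewrite EFinD; apply: leeD.
    have [kr|kr] := leP rho (k%:R * L).
      have -> : q ^+ k * expR (- (2 * s * rho)) = expR (- (2 * s * rho + k%:R * (c / 2))).
        by rewrite /q -expRM_natl -expRD; congr expR; ring.
      apply: (hm rho k x r3 k0); rewrite kr andbT.
      rewrite ler_pdivrMr; last by lra.
      by rewrite mulrC; apply: le_trans nM1; rewrite ler_nat.
    rewrite (@le_trans _ _ 0%E)// ?lee_fin ?mulr_ge0 ?exprn_ge0 ?expR_ge0//.
    rewrite -(walk_snorm hL k); apply: le_measure; rewrite ?inE.
    - exact: annulus_measurable.
    - by apply: measurable_set_lt => //; exact: snorm_measurable.
    by move=> h [h1 _ _] /=; apply: lt_le_trans h1; rewrite ltr_expR.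
  have -> : 2 * gap * Br = gap * (2 * Br) by ring.
  rewrite (EFinM gap) lee_pmul2l//.
  rewrite EFinM -BE.
  rewrite /B (_ : D * r = 2 * r + r / cc); last by rewrite /D; ring.
  apply: (ball_lower hnu hups cc0 hcc).
    apply: measurableI; apply: measurable_set_le => //; first exact: snorm_measurable.
    by apply: measurable_dP => //; case: hups.
  move=> h [h1 h2]; split => //; rewrite -rE lef_pV2 ?posrE ?exprn_gt0 ?snorm_gt0 ?expR_gt0//.
  by rewrite ler_pXn2r// nnegrE ?expR_ge0// ltW// snorm_gt0.
apply: (le_trans (ball_crossing hnu hL x r S1 n)).
have before : (before_mass mu nu x r (expR rho) n <= ((Ct + K) * expR (- (2 * s * rho)))%:E)%E.
  pose e := K * expR (t0 * (rho - ct * n%:R)).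
  apply: (le_trans (before_mass_le mu x r n (s := expR (ct * n%:R)) (e := e) _ _)).
  - by rewrite mulr_ge0 ?expR_ge0// ltW.
  - by move=> h hh; exact: (sublevel_power A00 hA _ hh).
  rewrite mulrDl EFinD; apply: leeD.
    apply: (le_trans (htail n)); rewrite lee_fin ler_pM2l// ler_expR lerN2.
    have : 2 * s / gamma <= M by rewrite le_max lexx.
    rewrite ler_pdivrMr// => h1.
    have h2 := ler_wpM2r (ltW gamma0) nM.
    have rho0 : 0 <= rho by lra.
    have := ler_wpM2r rho0 h1; lra.
  rewrite lee_fin ler_pM2l// ler_expR.
  have : (2 * s / t0 + 1) / ct <= M by rewrite le_max lexx orbT.
  rewrite ler_pdivrMr// => h1.
  have h2 := ler_wpM2r (ltW ct0) nM.
  have rho0 : 0 <= rho by lra.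
  have h3 := ler_wpM2r rho0 h1.
  have h4 : (2 * s / t0 + 1) * rho <= ct * n%:R by lra.
  have := ler_wpM2l (ltW t00) h4.
  have -> : t0 * ((2 * s / t0 + 1) * rho) = 2 * s * rho + t0 * rho by field; rewrite gt_eqF.
  lra.
have gapn : n%:R * (2 * gap) <= (2 * D `^ s)^-1.
  have gapE : gap = K * expR (t0 * L) * expR (- (t0 * theta * rho)).
    by rewrite -mulrA -expRD /gap; congr (_ * expR _); ring.
  have : n%:R * (2 * gap) <= K2 * (rho * expR (- (t0 * theta * rho))).
    rewrite (_ : K2 * _ = (M + 1) * rho * (2 * gap)); first by rewrite ler_wpM2r// mulr_ge0// ltW.
    by rewrite gapE /K2; ring.
  move=> /le_trans; apply; have := ler_wpM2l (ltW K20) (hrho1 rho r1).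
  by rewrite invfM mulVKf// gt_eqF.
rewrite big_nat; apply: (le_trans (leeD (lee_sum _ cross) before)).
rewrite -big_nat sumEFin BE -EFinM -!EFinD lee_fin big_split/= sumr_const_nat subn1/=.
rewrite -mulr_suml -[(_ * Br) *+ n]mulr_natl.
have h1 := geometric_sum_le n q01.
have h2 := ler_wpM2r (expR_ge0 (- (2 * s * rho))) h1.
have h3 := ler_wpM2r B0 gapn.
lra.
Qed.

Lemma decay_frostman : exists2 C : R, 0 < C & forall r x, 0 < r -> (nu (dP_ball x r) <= (C * r `^ s)%:E)%E.
Proof.
have [C1 [D [rho1 [C10 D2 rho10 h]]]] := ball_recursion.
pose r1 := expR (- (2 * rho1)).
exists (Num.max (2 * C1) (r1 `^ s)^-1); first by rewrite lt_max mulr_gt0.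
move=> r x r0; have Ff t : nu (dP_ball x t) = (fine (nu (dP_ball x t)))%:E.
  exact: (probability_fin nu (measurable_dP_ball x t)).
rewrite Ff lee_fin.
apply: (power_recursion (F := fun t => fine (nu (dP_ball x t))) s0 C10 D2 (expR_gt0 _)) => // t.
  by move=> _; rewrite -lee_fin -Ff probability_le1//; exact: measurable_dP_ball.
move=> /andP[t0 tr]; pose rho := - ln t / 2.
have tE : t = expR (- (2 * rho)).
  rewrite -[LHS]lnK ?posrE//; congr expR; rewrite /rho; lra.
have hr : rho1 <= rho.
  by move: tr; rewrite tE ltr_expR; lra.
have := h rho x hr; rewrite -tE [X in (X <= _)%E]Ff (Ff (D * t)) -EFinM -EFinD lee_fin.
have -> : t `^ s = expR (- (2 * s * rho)) by rewrite /powR gt_eqF//; congr expR; rewrite /rho; field.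
by rewrite [X in _ -> _ <= _ + X]mulrC.
Qed.

End frostman_bootstrap.

(** * The largest exponent as the zero of the supremum *)

Section zero_of_supremum.
Variable R : realType.
Variables (A P : set R) (I : R -> \bar R) (L s0 kappa : R).
Hypothesis A_range : forall alpha, A alpha -> 0 <= alpha <= L.
Hypothesis P_s0 : P s0.
Hypothesis s00 : 0 < s0.
Hypothesis P_le1 : forall s, P s -> s <= 1.
Hypothesis P_I : forall s alpha, P s -> A alpha -> (I alpha <= (- (2 * s * alpha))%:E)%E.
Hypothesis I_P : forall s c, 0 <= s -> 0 < c ->
  (forall alpha, A alpha -> (I alpha + (2 * s * alpha)%:E <= (- c)%:E)%E) -> P s.
Hypothesis kappa0 : 0 < kappa.
Hypothesis I_kappa : forall alpha, A alpha -> (I alpha <= (- kappa)%:E)%E.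

Let f z := ereal_sup [set (I alpha + (2 * z * alpha)%:E)%E | alpha in A].

Let f_le z (a : R) : (forall alpha, A alpha -> (I alpha + (2 * z * alpha)%:E <= a%:E)%E) -> (f z <= a%:E)%E.
Proof. by move=> h; apply: ge_ereal_sup => _ [alpha Aa <-]; exact: h. Qed.

Let le_f z alpha : A alpha -> (I alpha + (2 * z * alpha)%:E <= f z)%E.
Proof. by move=> Aa; apply: ereal_sup_ubound; exists alpha. Qed.

Let P_sup s : P s -> s <= sup P.
Proof. by move=> Ps; apply: ub_le_sup => //; exists 1 => t; exact: P_le1. Qed.

Let I_real alpha : A alpha -> I alpha = -oo%E \/ exists a, I alpha = a%:E.
Proof.
move=> /I_kappa; case: (I alpha) => [a _|h|_]; [by right; exists a| |by left].
by have := lt_le_trans (ltry (- kappa)) h; rewrite ltxx.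
Qed.

(** With q = max(z, 0) / w, I + 2 z alpha is at most the convex combination (1 - q) I + q (I + 2 w
    alpha), and I <= -kappa makes this negative uniformly in alpha. *)
Let f_strict z w : z < w -> 0 < w -> (f w <= 0)%E -> (f z < 0)%E.
Proof.
move=> zw w0 fw; pose q := Num.max z 0 / w.
have q0 : 0 <= q by rewrite divr_ge0// ?(ltW w0)// le_max lexx orbT.
have q1 : 0 < 1 - q by rewrite subr_gt0 ltr_pdivrMr// mul1r gt_max zw.
have qw : z <= q * w by rewrite divfK ?gt_eqF// le_max lexx.
have k0 := kappa0.
apply: (@le_lt_trans _ _ (- ((1 - q) * kappa))%:E); last by rewrite lte_fin oppr_lt0 mulr_gt0.
apply: f_le => alpha Aa; have /andP[a0 _] := A_range Aa.
have := le_trans (le_f w Aa) fw; have := I_kappa Aa.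
have [->|[a ->]] := I_real Aa; first by move=> *; rewrite addNye leNye.
rewrite -!EFinD !lee_fin => h1 h2.
have h3 := ler_wpM2r a0 qw; have h4 := ler_wpM2l (ltW q1) h1; have h5 := ler_wpM2l q0 h2.
lra.
Qed.

Let zeta_gt0 : 0 < sup P.
Proof. exact: lt_le_trans s00 (P_sup P_s0). Qed.

(** The inequalities [P_I] pass to the supremum of the exponents. If the value there were negative,
    boundedness of A would allow an exponent beyond [sup P]. *)
Let f_zeta : f (sup P) = 0%E.
Proof.
apply/eqP; rewrite eq_le; apply/andP; split.
  apply: f_le => alpha Aa; have /andP[] := A_range Aa.
  rewrite le_eqVlt => /predU1P[a0 _|a0 _].
    by have := P_I P_s0 Aa; rewrite -a0 !mulr0 oppr0 adde0.
  have [->|[a Ia]] := I_real Aa; first by rewrite addNye leNye.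
  rewrite Ia -EFinD lee_fin; have : sup P <= - a / (2 * alpha).
    apply: ge_sup; first by exists s0.
    move=> s Ps; rewrite ler_pdivlMr ?mulr_gt0//; have := P_I Ps Aa; rewrite Ia lee_fin; lra.
  rewrite ler_pdivlMr ?mulr_gt0//; lra.
rewrite leNgt; apply/negP => hlt.
(* The value may be -oo, as for an empty supremum; then c = 1 serves. *)
have [c c0 hc] : exists2 c : R, 0 < c & (f (sup P) <= (- c)%:E)%E.
  move: hlt; case: (f (sup P)) => [a| |] //; last by exists 1 => //; rewrite leNye.
  by rewrite lte_fin => a0; exists (- a); rewrite ?oppr_gt0// opprK.
(* Since alpha <= L, raising the exponent by t adds at most 2 t L <= c / 2. *)
pose t := c / (4 * (`|L| + 1)).
have L1 : 0 < 4 * (`|L| + 1) by have := normr_ge0 L; lra.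
have t0 : 0 < t by rewrite divr_gt0.
have : sup P + t <= sup P.
  apply/P_sup/(@I_P _ (c / 2)); first by have := zeta_gt0; lra.
    by rewrite divr_gt0.
  move=> alpha Aa; have /andP[a0 aL] := A_range Aa.
  have := le_trans (le_f (sup P) Aa) hc.
  have [->|[a ->]] := I_real Aa; first by move=> *; rewrite addNye leNye.
  rewrite -!EFinD !lee_fin.
  have : t * (4 * (`|L| + 1)) = c by rewrite divfK// gt_eqF.
  have := ler_wpM2l (ltW t0) (le_trans aL (ler_norm L)); lra.
by lra.
Qed.

Lemma zero_of_supremum : [/\ 0 < sup P <= 1, unique (fun z => f z = 0%E) (sup P) &
  ereal_sup [set s%:E | s in P] = (sup P)%:E].
Proof.
split.
- by rewrite zeta_gt0; apply: ge_sup => //; exists s0.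
- split=> // z fz; apply: contrapT => /eqP; rewrite neq_lt => /orP[h|h].
    have : (f (sup P) < 0)%E by apply: (f_strict h (lt_trans zeta_gt0 h)); rewrite fz.
    by rewrite f_zeta ltxx.
  have : (f z < 0)%E by apply: (f_strict h zeta_gt0); rewrite f_zeta.
  by rewrite fz ltxx.
by apply: ereal_sup_EFin; [exists 1 => t; exact: P_le1|exists s0].
Qed.

End zero_of_supremum.

(** * Frostman exponents on the projective line are at most 1 *)

Section frostman_exponent_bound.
Variable R : realType.
Implicit Types x y : projline R.

Let exists_slope (a b : R) : a ^+ 2 + b ^+ 2 != 0 -> 1 <= a ^+ 2 + b ^+ 2 ->
  exists x, forall y, dP x y <= `|a * py y - b * px y|.
Proof.
move=> ab0 ab1; have [x [c [h1 h2 h3]]] := exists_line ab0.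
exists x => y; rewrite dPE /wd h1 h2.
have -> : c * a * py y - c * b * px y = c * (a * py y - b * px y) by ring.
rewrite normrM ler_piMl//; apply: (@abs_le1 _ (Num.sqrt (1 - c ^+ 2)) c).
rewrite sqr_sqrtr ?subrK// subr_ge0.
have := sqr_ge0 c; nra.
Qed.

Let grid_point (u v : R) n : (0 < n)%N -> `|u| <= `|v| ->
  u ^+ 2 + v ^+ 2 = 1 -> exists2 k, (k < n.*2.+1)%N & `|u - (k%:R / n%:R - 1) * v| <= n%:R^-1.
Proof.
move=> n0 uv uv1; have n0' : 0 < n%:R :> R by rewrite ltr0n.
have v0 : 0 < `|v|.
  rewrite normr_gt0; apply/eqP => v0; move: uv uv1; rewrite v0 normr0 normr_le0 => /eqP ->.
  by rewrite expr0n addr0 => /eqP; rewrite eq_sym oner_eq0.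
pose t := u / v; have ut : u = t * v by rewrite divfK// -normr_gt0.
have : `|t| <= 1 by rewrite normrM normfV ler_pdivrMr// mul1r.
rewrite ler_norml => /andP[t1 t2].
have w0 : 0 <= (t + 1) * n%:R by rewrite mulr_ge0//; lra.
have /andP[k1 k2] := truncn_itv w0; set k := Num.truncn _ in k1 k2.
exists k.
  rewrite ltnS -(@ler_nat R) (le_trans k1)// -muln2 natrM mulrC ler_wpM2l//; lra.
rewrite {1}ut -mulrBl normrM.
have v1 : `|v| <= 1 by exact: abs_le1 uv1.
rewrite -[leRHS]mulr1; apply: ler_pM => //.
move: k2; rewrite -natr1 => k2.
have e : (t - (k%:R / n%:R - 1)) = ((t + 1) * n%:R - k%:R) / n%:R by field; rewrite gt_eqF.
rewrite e normrM normfV (ger0_norm (ltW n0')) -[leRHS]mul1r ler_wpM2r ?invr_ge0 ?(ltW n0')//.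
by rewrite ler_norml; apply/andP; split; lra.
Qed.

(** [X] runs through the slopes k / n - 1 and reaches the lines nearer to the first axis; [Y] does
    the same with the coordinates exchanged. *)
Lemma projline_cover n : (0 < n)%N -> exists X Y : nat -> projline R, forall y,
  exists2 k, (k < n.*2.+1)%N & dP (X k) y <= n%:R^-1 \/ dP (Y k) y <= n%:R^-1.
Proof.
move=> n0.
have hX (k : nat) : exists x, forall y, dP x y <= `|py y - (k%:R / n%:R - 1) * px y|.
  have h : 1 <= 1 ^+ 2 + (k%:R / n%:R - 1) ^+ 2 :> R by rewrite expr1n lerDl sqr_ge0.
  have [x hx] := exists_slope (lt0r_neq0 (lt_le_trans ltr01 h)) h.
  by exists x => y; have := hx y; rewrite mul1r.
have hY (k : nat) : exists x, forall y, dP x y <= `|px y - (k%:R / n%:R - 1) * py y|.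
  have h : 1 <= (k%:R / n%:R - 1) ^+ 2 + 1 ^+ 2 :> R by rewrite expr1n lerDr sqr_ge0.
  have [x hx] := exists_slope (lt0r_neq0 (lt_le_trans ltr01 h)) h.
  by exists x => y; have := hx y; rewrite mul1r distrC.
have [X XP] := choice hX; have [Y YP] := choice hY.
exists X, Y => y; have e := pxy1 y.
have [h|h] := leP `|py y| `|px y|.
  have [k kn hk] := grid_point n0 h (ltac:(by rewrite addrC)).
  by exists k => //; left; apply: (le_trans (XP k y)).
have [k kn hk] := grid_point n0 (ltW h) e.
by exists k => //; right; apply: (le_trans (YP k y)).
Qed.

(** The 2 (2 n + 1) covering balls of radius 1 / n have total mass at most 6 n C n^(-s), which is
    below 1 for large n if s > 1. *)
Lemma frostman_exponent_le1 (nu : probability (projline R) R) (s C : R) :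
  (forall r x, 0 < r -> (nu (dP_ball x r) <= (C * r `^ s)%:E)%E) -> s <= 1.
Proof.
move=> h; rewrite leNgt; apply/negP => s1.
have C0 : 0 <= C.
  have := le_trans (measure_ge0 nu _) (h 1 point ltr01).
  by rewrite powR1 mulr1 lee_fin.
pose n := (Num.truncn (expR (6 * C / (s - 1)))).+1.
have n0' : 0 < n%:R :> R by rewrite ltr0n.
have nl : 6 * C < n%:R `^ (s - 1).
  have hn : expR (6 * C / (s - 1)) <= n%:R by apply: ltW; exact: truncnS_gt.
  have : 6 * C / (s - 1) <= ln n%:R by rewrite -[leLHS]expRK ler_ln ?posrE ?expR_gt0.
  rewrite ler_pdivrMr ?subr_gt0// => h1.
  rewrite /powR gt_eqF//; apply: lt_le_trans (expR_ge1Dx _); rewrite mulrC in h1; lra.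
have [X [Y hXY]] := projline_cover (ltn0Sn _ : (0 < n)%N).
pose B k := dP_ball (X k) n%:R^-1 `|` dP_ball (Y k) n%:R^-1.
have mB k : measurable (B k) by apply: measurableU; exact: measurable_dP_ball.
have hB k : (nu (B k) <= (2 * (C * n%:R^-1 `^ s))%:E)%E.
  apply: (le_trans (measureU2 nu (measurable_dP_ball _ _) (measurable_dP_ball _ _))).
  by rewrite mulr_natl mulr2n EFinD leeD// h// invr_gt0.
have : (nu setT <= (\sum_(i < n.*2.+1) 2 * (C * n%:R^-1 `^ s))%:E)%E.
  rewrite (_ : setT = \big[setU/set0]_(i < n.*2.+1) B i).
    apply: (le_trans (Boole_inequality _ _)) => //.
    by rewrite -sumEFin; apply: lee_sum => i _; exact: hB.
  apply/seteqP; split => // y _; have [k kn hk] := hXY y.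
  by rewrite -bigcup_mkord; exists k.
have nE : n.*2.+1%:R = 2 * n%:R + 1 :> R by rewrite -natr1 -mul2n natrM.
rewrite probability_setT lee_fin sumr_const card_ord -[X in _ <= X]mulr_natl nE.
rewrite -[n%:R^-1]powR_inv1 ?ler0n// -powRrM mulN1r.
have -> : n%:R `^ (- s) = (n%:R `^ (s - 1))^-1 * n%:R^-1 :> R.
  rewrite -powRN -powR_inv1// -powRD; last by apply/implyP => _; rewrite gt_eqF.
  by congr (_ `^ _); ring.
apply/negP; rewrite -ltNge.
have p0 : 0 < n%:R `^ (s - 1) :> R by rewrite powR_gt0.
rewrite (_ : _ * _ = (2 * n%:R + 1) * 2 * C / (n%:R * n%:R `^ (s - 1))); last first.
  by field; rewrite !gt_eqF.
rewrite ltr_pdivrMr ?mulr_gt0// mul1r.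
have n1 : 1 <= n%:R :> R by rewrite ler1n.
apply: (@le_lt_trans _ _ (n%:R * (6 * C))); last by rewrite ltr_pM2l.
have := ler_wpM2r C0 n1; lra.
Qed.

End frostman_exponent_bound.

Theorem corollary1p8 (R : realType) (mu : probability (SL2 R) R)
    (ups : SL2 R -> projline R) (nuF : probability (projline R) R)
    (hcompact : compact (msupp mu))
    (hirr : strongly_irreducible mu)
    (hprox : proximal mu)
    (hups : is_upsilon_plus ups)
    (hnuF : furstenberg_measure mu nuF) :
  exists zeta : R,
    [/\ 0 < zeta <= 1,
        unique (fun z : R =>
          ereal_sup [set (starI2 ups mu alpha + (2 * z * alpha)%:E)%E
                    | alpha in Aset mu] = 0%E) zeta &
        frostman_dim nuF = zeta%:E].
Proof.
have nu0 := furstenberg_no_atoms hirr hnuF.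
have [L [L0 hL]] := compact_snorm_bounded hcompact.
have [A0 [s0 [A00 s00 hA]]] := furstenberg_hoelder nu0 hprox hnuF L0 hL.
have [c [C [gamma [c0 C0 gamma0 htail]]]] := snorm_tail nu0 hprox hnuF L0 hL.
pose P := [set s : R | 0 <= s /\ exists C, 0 < C /\ forall (r : R) x, 0 < r ->
  (nuF (dP_ball x r) <= (C * r `^ s)%:E)%E].
have Ps0 : P s0 by split; [exact: ltW|exists A0; split=> // r x; exact: hA].
have PI s alpha : P s -> Aset mu alpha -> (starI2 ups mu alpha <= (- (2 * s * alpha))%:E)%E.
  move=> [sge0 [D [D0 hD]]] /(Aset_range hL)/andP[a0 _].
  exact: (frostman_starI2 hups nu0 hnuF D0 sge0 hD a0).
(* For alpha <= c / 2 the tail of |g| gives the rate -gamma / 2; for alpha > c / 2 the Hoelder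
   exponent s0 gives -2 s0 alpha <= -s0 c. *)
exists (sup P); apply: (@zero_of_supremum R (Aset mu) P (starI2 ups mu) L s0 (Num.min (gamma / 2) (s0 * c))) => //.
- by move=> alpha /(Aset_range hL).
- by move=> s [_ [D [_ hD]]]; exact: (frostman_exponent_le1 (nu := nuF) hD).
- move=> s d sge0 d0 h; split=> //.
  have d20 : 0 < d / 2 by rewrite divr_gt0.
  have [D D0 hD] := decay_frostman nu0 hprox hnuF L0 hL hups sge0 d20 (starE2_decay hups d0 h).
  by exists D.
- by rewrite lt_min !divr_gt0 ?mulr_gt0.
move=> alpha Aa; have /andP[a0 _] := Aset_range hL Aa.
have [h|h] := leP alpha (c / 2).
  apply: (le_trans (starI2_small hups c0 C0 gamma0 htail (alpha := alpha) _)); first by rewrite a0.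
  by rewrite lee_fin lerN2 ge_min lexx.
apply: (le_trans (PI s0 alpha Ps0 Aa)); rewrite lee_fin lerN2 ge_min.
by apply/orP; right; have := ler_wpM2l (ltW s00) (ltW h); lra.
Qed.
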